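(* Let $N,l$ be integers with $0<l<N$ and $l\le N-l$. Let $E=\mathcal{O}(N)\oplus\mathcal{O}(N)$ over $\mathbb{P}^1$, with the holomorphic section $\phi=(\phi_1,\phi_2)=(z^l,z^{N-l})$. Let $\alpha,\tau>0$ be real numbers satisfying $2N\alpha\tau=1$. Let $V$ be a real number satisfying $$N<\frac{\tau V}{2}<2N-2l .$$ Then there exist a smooth Kähler form $\omega$ on $\mathbb{P}^1$ with $\int_{\mathbb{P}^1}\omega=2\pi V$ and a smooth Hermitian metric $H$ on $E$ such that $$iF_H+\frac12\,\phi\otimes\phi^{*_H}\,\omega=\frac{\tau}{2}\,I\otimes\omega,$$ $$\mathrm{Ricci}(\omega)+\alpha\left(-2\sqrt{-1}\,\partial\bar\partial+\tau\omega\right)\left(\Vert\phi\Vert_H^2-2\tau\right)=0 .$$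
   Context: Here $z$ is the standard affine coordinate on $\mathbb{C}\subset\mathbb{P}^1$. Sections of $\mathcal{O}(N)$ are identified with polynomials in $z$ of degree at most $N$, via the usual trivialisation over $\mathbb{C}$. $F_H$ is the curvature of the Chern connection of $(E,H)$. In a holomorphic trivialisation $F_H=\bar\partial(H^{-1}\partial H)$, so that $\int_{\mathbb{P}^1}\mathrm{tr}(iF_H)=2\pi\deg E$. In such a trivialisation, with $\phi$ a column vector, $\phi\otimes\phi^{*_H}=\phi\phi^\dagger H$ (an endomorphism of $E$) and $\Vert\phi\Vert_H^2=\phi^\dagger H\phi$. $I$ is the identity endomorphism of $E$. $\mathrm{Ricci}(\omega)$ is the Ricci form, locally $-\sqrt{-1}\,\partial\bar\partial\ln(\omega_{z\bar z})$ where $\omega=\omega_{z\bar z}\, i\,dz\wedge d\bar z$. The notation $(-2\sqrt{-1}\,\partial\bar\partial+\tau\omega)(f)$ means $-2\sqrt{-1}\,\partial\bar\partial f+\tau f\omega$. *)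

(* Defs.v *)
From HB Require Import structures.
From mathcomp Require Import all_boot all_order all_algebra.
From mathcomp Require Import sesquilinear spectral.
From mathcomp Require Import complex.
From mathcomp Require Import all_classical all_reals all_analysis.

Set Implicit Arguments.
Unset Strict Implicit.
Unset Printing Implicit Defensive.

Import Order.TTheory GRing.Theory Num.Theory numFieldNormedType.Exports.

Local Open Scope ring_scope.
Local Open Scope complex_scope.
Local Open Scope sesquilinear_scope.

Section Plane.
Variable R : realType.
Implicit Types (p : R * R) (f : R * R -> R) (g : R * R -> R[i]).

(* The complex line is modelled by the real plane R * R, so that the topology,
   the directional derivatives and the Lebesgue measure are the library's. *)
Definition cplx p : R[i] := p.1 +i* p.2.

Definition plane (z : R[i]) : R * R := (complex.Re z, complex.Im z).

Definition normsq p : R := p.1 ^+ 2 + p.2 ^+ 2.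

Definition dx f p : R := 'D_((1, 0) : R * R) f p.
Definition dy f p : R := 'D_((0, 1) : R * R) f p.

Fixpoint Ck (k : nat) f : Prop :=
  continuous f /\
  if k is k'.+1 then
    [/\ forall p, derivable f p ((1, 0) : R * R),
        forall p, derivable f p ((0, 1) : R * R),
        Ck k' (dx f) & Ck k' (dy f)]
  else True.

Definition smooth f : Prop := forall k, Ck k f.

Definition csmooth g : Prop :=
  smooth (fun p => complex.Re (g p)) /\ smooth (fun p => complex.Im (g p)).

Definition cdx g p : R[i] :=
  dx (fun q => complex.Re (g q)) p +i* dx (fun q => complex.Im (g q)) p.
Definition cdy g p : R[i] :=
  dy (fun q => complex.Re (g q)) p +i* dy (fun q => complex.Im (g q)) p.

(* Wirtinger operators d/dz and d/dzbar. *)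
Definition dz g p : R[i] := (cdx g p - 'i * cdy g p) / 2.
Definition dzbar g p : R[i] := (cdx g p + 'i * cdy g p) / 2.

Definition mxdz m n (M : R * R -> 'M[R[i]]_(m, n)) p : 'M[R[i]]_(m, n) :=
  \matrix_(i, j) dz (fun q => M q i j) p.
Definition mxdzbar m n (M : R * R -> 'M[R[i]]_(m, n)) p : 'M[R[i]]_(m, n) :=
  \matrix_(i, j) dzbar (fun q => M q i j) p.

End Plane.

(* P^1 is glued from two copies of C, with coordinates z on chart0 and
   w = 1/z on chart_oo. *)
Variant chart := chart0 | chart_oo.

Definition other (c : chart) : chart :=
  if c is chart0 then chart_oo else chart0.

Section P1.
Variable R : realType.

Definition plane_inv (p : R * R) : R * R := plane (cplx p)^-1.

(* omega c is the coefficient of the form with respect to i dz /\ dzbar, z being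
   the coordinate of the chart c; the gluing law comes from
   i dw /\ dwbar = |z|^-4 i dz /\ dzbar. *)
Record kahler_form (omega : chart -> R * R -> R) : Prop := KahlerForm {
  kahler_smooth : forall c, smooth (omega c);
  kahler_pos : forall c p, 0 < omega c p;
  kahler_glue : forall c p, p != 0 ->
    omega (other c) (plane_inv p) = normsq p ^+ 2 * omega c p }.

(* The point at infinity is negligible and i dz /\ dzbar = 2 dx /\ dy. *)
Definition form_integral (omega : chart -> R * R -> R) : \bar R :=
  (\int[(@lebesgue_measure R \x @lebesgue_measure R)%E]_p
     (2 * omega chart0 p)%:E)%E.

(* H c is the Gram matrix of a Hermitian metric on O(N) (+) O(N), antilinear in
   the first argument, in the standard frame over the chart c.  A section with
   components s over one chart has components z^-N s over the other, whence the
   gluing law. *)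
Record hermitian_metric (N : nat) (H : chart -> R * R -> 'M[R[i]]_2) : Prop :=
  HermitianMetric {
  herm_smooth : forall c i j, csmooth (fun p => H c p i j);
  herm_sym : forall c p, H c p \is hermsymmx;
  herm_pos : forall c p (v : 'cV[R[i]]_2), v != 0 ->
    0 < (v^t* *m H c p *m v) 0 0;
  herm_glue : forall c p, p != 0 ->
    H (other c) (plane_inv p) = (normsq p ^+ N)%:C *: H c p }.

(* The local expression of the section of O(N) given by a polynomial s of degree
   at most N: s(z) on chart0, and w^N s(1/w) on chart_oo. *)
Definition section_loc (N : nat) (s : {poly R[i]}) (c : chart) (p : R * R) :
    R[i] :=
  match c with
  | chart0 => s.[cplx p]
  | chart_oo => (\poly_(i < N.+1) s`_(N - i)).[cplx p]
  end.

Definition section2_loc (N : nat) (s1 s2 : {poly R[i]}) (c : chart)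
    (p : R * R) : 'cV[R[i]]_2 :=
  \col_i (if i == 0 then section_loc N s1 c p else section_loc N s2 c p).

(* All 2-forms below are represented by their coefficient with respect to
   i dz /\ dzbar.  In particular dzbar /\ dz = - dz /\ dzbar yields the sign in
   i F_H = - d/dzbar (H^-1 dH/dz) i dz /\ dzbar. *)
Definition iF (H : R * R -> 'M[R[i]]_2) (p : R * R) : 'M[R[i]]_2 :=
  - mxdzbar (fun q => invmx (H q) *m mxdz H q) p.

Definition iddbar (g : R * R -> R[i]) (p : R * R) : R[i] := dz (dzbar g) p.

Definition Ricci (w : R * R -> R) (p : R * R) : R[i] :=
  - iddbar (fun q => (ln (w q))%:C) p.

Definition norm2_H (H : R * R -> 'M[R[i]]_2) (phi : R * R -> 'cV[R[i]]_2)
    (p : R * R) : R[i] :=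
  ((phi p)^t* *m H p *m phi p) 0 0.

Definition phi_phi_star (H : R * R -> 'M[R[i]]_2) (phi : R * R -> 'cV[R[i]]_2)
    (p : R * R) : 'M[R[i]]_2 :=
  phi p *m (phi p)^t* *m H p.

Definition vortex_eq (tau : R) (w : R * R -> R) (H : R * R -> 'M[R[i]]_2)
    (phi : R * R -> 'cV[R[i]]_2) : Prop :=
  forall p, iF H p + (w p / 2)%:C *: phi_phi_star H phi p
            = (tau / 2 * w p)%:C *: 1%:M.

Definition gravity_eq (alpha tau : R) (w : R * R -> R)
    (H : R * R -> 'M[R[i]]_2) (phi : R * R -> 'cV[R[i]]_2) : Prop :=
  let f q := norm2_H H phi q - (2 * tau)%:C in
  forall p, Ricci w p
            + alpha%:C * (- 2 * iddbar f p + tau%:C * f p * (w p)%:C) = 0.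

End P1.

(* Main.v *)
(* We look for a solution invariant under rotations of z and under z -> 1/z (with
   the two summands exchanged), and put t = |z|^2, x = ln t, k = N - 2l.  Write
   phi = z^l s with s = e1 + z^k e2.  Then H is determined by H(s, s) = exp (u t),
   by the projection zbar^k nu(t) of e2 onto s, and by the squared norm exp (v t)
   of the component of e2 orthogonal to s.  Imposing
   d/dzbar (zbar^k nu) = c zbar^(k-1) exp (v - u) decouples the vortex equation,
   and the gravity equation integrates explicitly, because 2 N alpha tau = 1.
   In the variables f = ln (|phi|^2 / tau) and g = v + (N - l) x + const one is left
   with the even solutions of
     f'' = P + (e^f - 1) w / 2,   g'' = - P - w / 2,
     P = C e^(g - f),   w = C' exp ((f + g - e^f) / N),
   where w is t times the density of tau omega.  The solution extends smoothly over
   the poles when -f' -> l and -g' -> N - l.  The energy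
   (f'^2 + g'^2) / 2 + P + N w / 2 is conserved; once its value is prescribed to be
   (l^2 + (N - l)^2) / 2, it is enough that f' + g' -> - N.  There remain two
   parameters, m = f(0) in [-M, 1] and the share th in [0, 1] of the w-term in the
   energy at x = 0, for the two conditions f' + g' -> - N and
   int_0^oo w dx = tau V / 2.  The hypothesis N < tau V / 2 < 2N - 2l fixes the
   signs of the two defects on the boundary of the rectangle of parameters, and
   Sperner's lemma produces a common zero. *)

Require Import Defs.
From mathcomp Require Import all_boot all_order all_algebra.
From mathcomp Require Import complex.
From mathcomp Require Import all_classical all_reals all_analysis.
From mathcomp Require Import sesquilinear measurable_realfun.
From mathcomp Require Import ring lra.

Set Implicit Arguments.
Unset Strict Implicit.
Unset Printing Implicit Defensive.

Import Order.TTheory GRing.Theory Num.Theory.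
Import numFieldNormedType.Exports.
Local Open Scope classical_set_scope.
Local Open Scope ring_scope.

(** * Calculus on the real line *)

Section Derivatives.
Variable R : realType.
Implicit Types (f g : R -> R) (x a b : R).

(** The window for [tau V / 2] is the gap between two extreme regimes. When [m] is very negative and
    [f' + g' -> - N], the factor [e^f] stays negligible and [f'' + g''] is almost [- w], which
    leaves [int_0^oo w] at most slightly above [N]. When [th = 1] the term [P] is absent, hence
    [g'' = - w / 2], and conservation of energy turns [f' + g' -> - N] into [int_0^oo w = 2N - 2l].

    The obstacle is that both conditions live at infinity, while Gronwall's estimate controls the
    dependence on [(m, th)] on bounded intervals only. The two quantities to be matched, [f' + g']
    and the primitive of [w], are chosen so that [P] drops out: their derivatives involve only [w]
    and [e^f w], for which a tail bound uniform in the parameters is available. The decay of [P] is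
    needed for the final solution alone, where it separates the limits of [f'] and [g']. The poles
    lie at infinity in [x], so smoothness there is regained in the variable [t], by a bootstrap on
    the equations for [t u'] and [t v']. *)

Lemma is_drv_eq f x a b : is_derive x 1 f a -> a = b -> is_derive x 1 f b.
Proof. by move=> h <-. Qed.

Lemma is_drv_cst (c : R) x : is_derive x 1 (fun=> c) 0.
Proof. exact: is_derive_cst. Qed.

Lemma is_drv_id x : is_derive x 1 (fun y : R => y) 1.
Proof. exact: is_derive_id. Qed.

Lemma is_drvD f g x a b : is_derive x 1 f a -> is_derive x 1 g b ->
  is_derive x 1 (fun y => f y + g y) (a + b).
Proof. by move=> hf hg; apply: is_deriveD. Qed.

Lemma is_drvN f x a : is_derive x 1 f a -> is_derive x 1 (fun y => - f y) (- a).
Proof. by move=> hf; apply: is_deriveN. Qed.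

Lemma is_drvB f g x a b : is_derive x 1 f a -> is_derive x 1 g b ->
  is_derive x 1 (fun y => f y - g y) (a - b).
Proof. by move=> hf hg; apply: is_deriveB. Qed.

Lemma is_drvM f g x a b : is_derive x 1 f a -> is_derive x 1 g b ->
  is_derive x 1 (fun y => f y * g y) (a * g x + f x * b).
Proof.
move=> hf hg; have h := @is_deriveM R R f g x 1 a b hf hg.
by apply: (is_drv_eq h); rewrite /GRing.scale /=; ring.
Qed.

Lemma is_drvZ (c : R) f x a : is_derive x 1 f a ->
  is_derive x 1 (fun y => c * f y) (c * a).
Proof. by move=> hf; apply: is_deriveZ. Qed.

Lemma is_drv_comp f g x a b : is_derive x 1 f a -> is_derive (f x) 1 g b ->
  is_derive x 1 (fun y => g (f y)) (b * a).
Proof. by move=> hf hg; have := @is_derive1_comp R g f x b a hg hf. Qed.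

Lemma is_drv_exp f x a : is_derive x 1 f a ->
  is_derive x 1 (fun y => expR (f y)) (a * expR (f x)).
Proof.
move=> hf; rewrite mulrC; apply: (@is_drv_comp f expR) => //; exact: is_derive_expR.
Qed.

Lemma is_drv_continuous f x a : is_derive x 1 f a -> {for x, continuous f}.
Proof.
by move=> [h _]; apply: differentiable_continuous; apply/derivable1_diffP.
Qed.

Lemma drv_continuous f f' : (forall x, is_derive x 1 f (f' x)) -> continuous f.
Proof. by move=> h x; apply: is_drv_continuous (h x). Qed.

Lemma mean_value f f' a b : (forall x, a <= x <= b -> is_derive x 1 f (f' x)) ->
  a < b -> exists2 c, a < c < b & f b - f a = f' c * (b - a).
Proof.
move=> h ab.
case: (@MVT R f f' a b ab).
- by move=> x; rewrite in_itv /= => /andP[h1 h2]; apply: h; rewrite !ltW.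
- apply: derivable_within_continuous => x; rewrite in_itv /= => xab; by have [] := h x xab.
- by move=> c; rewrite in_itv /= => cab e; exists c.
Qed.

Lemma drv_nondecreasing f f' a b :
  (forall x, a <= x <= b -> is_derive x 1 f (f' x)) ->
  (forall x, a <= x <= b -> 0 <= f' x) -> a <= b -> f a <= f b.
Proof.
move=> h h0; rewrite le_eqVlt => /predU1P[-> //|ab].
have [c /andP[c1 c2] e] := @mean_value f f' a b h ab.
by rewrite -subr_ge0 e mulr_ge0 ?subr_ge0 ?(ltW ab)// h0// !ltW.
Qed.

Lemma drv_le f f' g g' a b :
  (forall x, a <= x <= b -> is_derive x 1 f (f' x)) ->
  (forall x, a <= x <= b -> is_derive x 1 g (g' x)) ->
  (forall x, a <= x <= b -> f' x <= g' x) -> a <= b -> f b - f a <= g b - g a.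
Proof.
move=> hf hg h ab.
have := @drv_nondecreasing (fun x => g x - f x) (fun x => g' x - f' x) a b.
move=> /(_ _ _ ab) H; suff : g a - f a <= g b - f b by lra.
by apply: H => x xab; [apply: is_drvB; [exact: hg|exact: hf]|rewrite subr_ge0 h].
Qed.

Lemma drv0_const_seg f a b : (forall x, a <= x <= b -> is_derive x 1 f 0) ->
  a <= b -> f a = f b.
Proof.
rewrite le_eqVlt => h /predU1P[-> //|ab].
have [c _] := @mean_value f (fun=> 0) a b h ab.
by rewrite mul0r => /eqP; rewrite subr_eq0 => /eqP.
Qed.

Lemma drv0_const f a b : (forall x, is_derive x 1 f 0) -> f a = f b.
Proof.
by move=> h; case: (leP a b) => [|/ltW] ab; [|apply/esym]; exact: (drv0_const_seg (fun x _ => h x)).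
Qed.

(** Integration gains a factor [1 / c] on functions of growth [expR (c * x)]; with [c] large this
    makes the Picard operator a contraction on the whole half-line. *)
Lemma drv_exp_bound f f' (K c : R) : 0 < c -> 0 <= K -> f 0 = 0 ->
  (forall x, is_derive x 1 f (f' x)) ->
  (forall x, 0 <= x -> `|f' x| <= K * expR (c * x)) ->
  forall x, 0 <= x -> `|f x| <= K / c * expR (c * x).
Proof.
move=> c0 K0 f0 df hf x x0.
have de (y : R) : is_derive y 1 (fun x => K / c * expR (c * x)) (K * expR (c * y)).
  apply: (is_drv_eq (is_drvZ _ (is_drv_exp (is_drvZ _ (is_drv_id _))))).
  by field; rewrite gt_eqF.
have Kc : 0 <= K / c by rewrite divr_ge0// ltW.
have h y : 0 <= y -> - (K * expR (c * y)) <= f' y <= K * expR (c * y).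
  by move=> /hf; rewrite ler_norml.
have h1 : f x - f 0 <= K / c * expR (c * x) - K / c * expR (c * 0).
  apply: (drv_le (fun y _ => df y) (fun y _ => de y)) => // y /andP[y0 _].
  by have /andP[] := h y y0.
have h2 : - f x - - f 0 <= K / c * expR (c * x) - K / c * expR (c * 0).
  apply: (drv_le (fun y _ => is_drvN (df y)) (fun y _ => de y)) => // y /andP[y0 _].
  by have /andP[] := h y y0; lra.
move: h1 h2; rewrite f0 mulr0 expR0 mulr1 => h1 h2.
by rewrite ler_norml; apply/andP; split; lra.
Qed.

Lemma lipschitz_of_drv f f' (K : R) : (forall x, is_derive x 1 f (f' x)) ->
  (forall x, `|f' x| <= K) -> forall x y, `|f x - f y| <= K * `|x - y|.
Proof.
move=> df hf x y; wlog xy : x y / y <= x.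
  move=> H; case: (leP y x) => [/H//|/ltW/H]; by rewrite distrC [`|y - _|]distrC.
move: xy; rewrite le_eqVlt => /predU1P[->|yx]; first by rewrite !subrr !normr0 mulr0.
have [c _ ->] := @mean_value f f' y x (fun x _ => df x) yx.
by rewrite normrM ler_wpM2r.
Qed.

(** Completeness in a form that yields a limit together with its rate of convergence: the limit is a
    point separating lower bounds from upper bounds. *)
Lemma separating_point (T : Type) (D : T -> Prop) (lo hi : T -> R) t0 : D t0 ->
  (forall s t, D s -> D t -> lo s <= hi t) ->
  exists a, forall t, D t -> lo t <= a <= hi t.
Proof.
move=> D0 h; pose A := [set lo t | t in D].
have ubA t : D t -> ubound A (hi t) by move=> Dt _ [s Ds <-]; exact: h.
have supA : has_sup A by split; [exists (lo t0), t0|exists (hi t0); exact: ubA].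
exists (sup A) => t Dt; apply/andP; split.
  by apply: sup_upper_bound => //; exists t.
by apply: ge_sup; [case: supA|exact: ubA].
Qed.

End Derivatives.

Section Antiderivative.
Variable R : realType.
Implicit Types (f g : R -> R) (x a b : R).

Local Notation mu := (@lebesgue_measure R).

(** An integral from a fixed [a] is a primitive only to the right of [a]. The increment
    [I a x - I a 0] does not depend on [a], so the base point [m x] may move with [x] and be
    replaced by a constant near each point. *)
Lemma antiderivative f : continuous f ->
  exists2 F : R -> R, F 0 = 0 & forall x, is_derive x 1 F (f x).
Proof.
move=> cf.
pose I a x := (\int[mu]_(t in [set` `[a, x]]) f t)%R.
have dI a x : a < x -> is_derive x 1 (I a) (f x).
  move=> ax; have [||||h1 h2] := @continuous_FTC1_closed R f a x (x + 1).
  - lra.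
  - apply: continuous_compact_integrable; first exact: segment_compact.
    exact: continuous_subspaceT.
  - exact: ax.
  - exact: cf.
  - by rewrite derive1E in h2; split.
have Iab a b x : a < 0 -> b < 0 -> a < x -> b < x -> I a x - I a 0 = I b x - I b 0.
  move=> a0 b0 ax bx.
  have h y : a < y -> b < y -> is_derive y 1 (fun y => I a y - I b y) 0.
    by move=> ay byy; rewrite -(subrr (f y)); apply: is_drvB; exact: dI.
  suff : I a x - I b x = I a 0 - I b 0 by clear; lra.
  case: (leP x 0) => x0.
    by apply: (@drv0_const_seg _ (fun y => I a y - I b y)) => // y yx; apply: h; lra.
  apply/esym; apply: (@drv0_const_seg _ (fun y => I a y - I b y)); last exact: ltW.
  by move=> y yx; apply: h; lra.
pose m x := - (`|x| + 1).
have m0 x : m x < 0 by rewrite /m; have := normr_ge0 x; lra.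
have mx x : m x < x by rewrite /m; have := ler_norm (- x); rewrite normrN; lra.
exists (fun x => I (m x) x - I (m x) 0); first by rewrite subrr.
move=> x; pose b := - (`|x| + 2).
have b0 : b < 0 by rewrite /b; have := normr_ge0 x; lra.
have bx y : `|y - x| < 1 -> b < y.
  rewrite /b ltr_norml => /andP[]; have := ler_norm (- x); rewrite normrN; lra.
apply: (@near_eq_is_derive _ _ _ (fun y => I b y - I b 0)).
- near=> y; apply: Iab => //; apply: bx.
  near: y; apply/nbhs_ballP; exists 1 => //= z; by rewrite -ball_normE /= distrC.
- apply: (is_drv_eq (is_drvB (dI b x _) (is_drv_cst _ _))); last by rewrite subr0.
  by apply: bx; rewrite subrr normr0.
Unshelve. all: by end_near. Qed.

Lemma drv_even_odd f f' : (forall x, is_derive x 1 f (f' x)) ->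
  (forall x, f' (- x) = f' x) -> f 0 = 0 -> forall x, f (- x) = - f x.
Proof.
move=> df ef f0 x.
suff : f (- x) + f x = f (- 0) + f 0 by rewrite oppr0 f0; lra.
apply: (@drv0_const _ (fun y => f (- y) + f y)) => y.
apply: (is_drv_eq (is_drvD (is_drv_comp (is_drvN (is_drv_id y)) (df _)) (df y))).
by rewrite ef; ring.
Qed.

Lemma drv_odd_even f f' : (forall x, is_derive x 1 f (f' x)) ->
  (forall x, f' (- x) = - f' x) -> forall x, f (- x) = f x.
Proof.
move=> df ef x.
suff : f (- x) - f x = f (- 0) - f 0 by rewrite oppr0; lra.
apply: (@drv0_const _ (fun y => f (- y) - f y)) => y.
apply: (is_drv_eq (is_drvB (is_drv_comp (is_drvN (is_drv_id y)) (df _)) (df y))).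
by rewrite ef; ring.
Qed.

End Antiderivative.

(** * Picard iteration for even solutions *)

Section Picard.
Variable R : realType.
Implicit Types (f g : R -> R) (x y c : R).

Lemma exists_geom_lt c (e : R) : 0 < e -> exists n, c / 2 ^+ n < e.
Proof.
move=> e0; exists (Num.bound `|c / e|).
rewrite ltr_pdivrMr ?exprn_gt0// mulrC -ltr_pdivrMr//.
apply: (le_lt_trans (ler_norm _)).
apply: (lt_trans (archi_boundP (normr_ge0 _))).
by rewrite -natrX ltr_nat ltn_expl.
Qed.

Lemma geom_eq c x y : (forall n, `|x - y| <= c / 2 ^+ n) -> x = y.
Proof.
move=> h; apply/eqP/negPn/negP => xy.
have /(exists_geom_lt c)[n hn] : 0 < `|x - y| by rewrite normr_gt0 subr_eq0.
by have := h n; rewrite leNgt hn.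
Qed.

(** [d n] bounds the total length of the steps still to come, so [u n - d n] is nondecreasing and
    [u n + d n] nonincreasing. *)
Lemma geom_cvg (u : nat -> R) c : 0 <= c ->
  (forall n, `|u n.+1 - u n| <= c / 2 ^+ n) ->
  exists y, forall n, `|u n - y| <= 2 * c / 2 ^+ n.
Proof.
move=> c0 hu; pose d n : R := 2 * c / 2 ^+ n.
have dS n : d n = c / 2 ^+ n + d n.+1.
  by rewrite /d exprS; field; rewrite ?expf_neq0.
have lo m n : (m <= n)%N -> u m - d m <= u n - d n.
  elim: n m => [|n IH] m; first by rewrite leqn0 => /eqP ->.
  rewrite leq_eqVlt => /predU1P[-> //|/IH h]; apply: (le_trans h).
  by have := hu n; rewrite (dS n) ler_norml => /andP[]; lra.
have hi m n : (m <= n)%N -> u n + d n <= u m + d m.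
  elim: n m => [|n IH] m; first by rewrite leqn0 => /eqP ->.
  rewrite leq_eqVlt => /predU1P[-> //|/IH h]; apply: le_trans h.
  by have := hu n; rewrite (dS n) ler_norml => /andP[]; lra.
have d0 n : 0 <= d n by rewrite /d divr_ge0 ?exprn_ge0// mulr_ge0.
have lohi m n : u m - d m <= u n + d n.
  case: (leqP m n) => [/lo|/ltnW/hi] h.
    by apply: (le_trans h); have := d0 n; lra.
  by apply: le_trans h; have := d0 m; lra.
have [||y hy] := @separating_point R nat setT (fun n => u n - d n) (fun n => u n + d n) 0%N => //.
exists y => n; have /andP[h1 h2] := hy n I.
by rewrite -/(d n) ler_norml; apply/andP; split; lra.
Qed.

Lemma lipschitz2_continuous (A : R -> R -> R) (L : R) f g : 0 <= L ->
  (forall a b a' b', `|A a b - A a' b'| <= L * (`|a - a'| + `|b - b'|)) ->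
  continuous f -> continuous g -> continuous (fun x => A (f x) (g x)).
Proof.
move=> L0 lipA cf cg x; apply/cvgrPdist_lt => e e0.
have e2 : 0 < e / (2 * L + 2) by rewrite divr_gt0//; lra.
have /cvgrPdist_lt/(_ _ e2) hf := cf x; have /cvgrPdist_lt/(_ _ e2) hg := cg x.
near=> y; apply: (le_lt_trans (lipA _ _ _ _)).
have h1 : `|f x - f y| < e / (2 * L + 2) by near: y.
have h2 : `|g x - g y| < e / (2 * L + 2) by near: y.
apply: (@le_lt_trans _ _ (L * (e / (2 * L + 2) + e / (2 * L + 2)))).
  by apply: ler_wpM2l => //; lra.
have -> : L * (e / (2 * L + 2) + e / (2 * L + 2)) = e * (L / (L + 1)) by field; lra.
by rewrite gtr_pMr// ltr_pdivrMr; lra.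
Unshelve. all: by end_near. Qed.

Lemma norm_close x y : `|x - y| < 1 -> `|y| <= `|x| + 1.
Proof. by move=> xy; have := ler_normB x (x - y); rewrite opprB addrC subrK; lra. Qed.

(** The second-order system is a fixed-point equation for double primitives. In the norm weighted by
    [expR (- c * x)] on the half-line the operator halves distances, so the solution is global
    without any continuation argument. Evenness is an invariant of the iteration and reduces all
    estimates to [0 <= x]. *)
Lemma picard_even (A B : R -> R -> R) (L f0 g0 : R) : 0 <= L ->
  (forall a b a' b', `|A a b - A a' b'| <= L * (`|a - a'| + `|b - b'|)) ->
  (forall a b a' b', `|B a b - B a' b'| <= L * (`|a - a'| + `|b - b'|)) ->
  exists f g F G : R -> R,
  [/\ [/\ f 0 = f0, g 0 = g0, F 0 = 0 & G 0 = 0],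
      [/\ forall x, is_derive x 1 f (F x), forall x, is_derive x 1 g (G x),
       forall x, is_derive x 1 F (A (f x) (g x)) &
       forall x, is_derive x 1 G (B (f x) (g x))] &
      (forall x, f (- x) = f x) /\ (forall x, g (- x) = g x)].
Proof.
move=> L0 lipA lipB.
(* [J p] is the primitive of [p] vanishing at 0; its value on discontinuous functions is
   arbitrary. *)
have /choice[J HJ] : forall p : R -> R, exists P : R -> R, continuous p ->
    P 0 = 0 /\ forall x, is_derive x 1 P (p x).
  move=> p; case: (pselect (continuous p)) => [|np].
    by move=> /antiderivative[P P0 dP]; exists P.
  by exists p.
have JC (p : R -> R) : continuous p -> continuous (J p) by move=> /HJ[_]; exact: drv_continuous.
(* Two integrations and two components give the factor [2 * L / c ^+ 2], at most 1/2 for this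
   [c]. *)
pose c : R := 2 * L + 2.
have c0 : 0 < c by rewrite /c; lra.
have bndJ (p : R -> R) (K : R) : continuous p -> 0 <= K ->
    (forall x, 0 <= x -> `|p x| <= K * expR (c * x)) ->
    forall x, 0 <= x -> `|J (J p) x| <= K / c / c * expR (c * x).
  move=> cp K0 hp; have [J0 dJ] := HJ _ cp; have [JJ0 dJJ] := HJ _ (JC _ cp).
  apply: drv_exp_bound (dJJ) _ => //; first by rewrite divr_ge0// ltW.
  exact: drv_exp_bound (dJ) _.
have bndJB (p q : R -> R) (K : R) : continuous p -> continuous q -> 0 <= K ->
    (forall x, 0 <= x -> `|p x - q x| <= K * expR (c * x)) ->
    forall x, 0 <= x -> `|J (J p) x - J (J q) x| <= K / c / c * expR (c * x).
  move=> cp cq K0 hp.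
  have [Jp0 dJp] := HJ _ cp; have [JJp0 dJJp] := HJ _ (JC _ cp).
  have [Jq0 dJq] := HJ _ cq; have [JJq0 dJJq] := HJ _ (JC _ cq).
  apply: (drv_exp_bound c0 _ _ (fun x => is_drvB (dJJp x) (dJJq x))).
  - by rewrite divr_ge0// ltW.
  - by rewrite JJp0 JJq0 subrr.
  - apply: (drv_exp_bound c0 K0 _ (fun x => is_drvB (dJp x) (dJq x))) => //.
    by rewrite Jp0 Jq0 subrr.
pose app (D : R -> R -> R) (p : (R -> R) * (R -> R)) x := D (p.1 x) (p.2 x).
pose T p : (R -> R) * (R -> R) :=
  (fun x => f0 + J (J (app A p)) x, fun x => g0 + J (J (app B p)) x).
pose inv (p : (R -> R) * (R -> R)) := [/\ continuous p.1, continuous p.2,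
  forall x, p.1 (- x) = p.1 x & forall x, p.2 (- x) = p.2 x].
have cA p : inv p -> continuous (app A p) by case=> h1 h2 _ _; exact: (lipschitz2_continuous L0 lipA h1 h2).
have cB p : inv p -> continuous (app B p) by case=> h1 h2 _ _; exact: (lipschitz2_continuous L0 lipB h1 h2).
have evJ (p : R -> R) : continuous p -> (forall x, p (- x) = p x) ->
    forall x, J (J p) (- x) = J (J p) x.
  move=> cp ep; have [J0 dJ] := HJ _ cp; have [JJ0 dJJ] := HJ _ (JC _ cp).
  by apply: drv_odd_even dJJ _; exact: drv_even_odd dJ ep J0.
have invT p : inv p -> inv (T p).
  move=> ip; have [c1 c2 e1 e2] := ip; split => /=.
  - move=> x; apply: cvgD; first exact: cvg_cst.
    exact: (JC _ (JC _ (cA _ ip))).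
  - move=> x; apply: cvgD; first exact: cvg_cst.
    exact: (JC _ (JC _ (cB _ ip))).
  - by move=> x; rewrite evJ//; [exact: cA|move=> y; rewrite /app e1 e2].
  - by move=> x; rewrite evJ//; [exact: cB|move=> y; rewrite /app e1 e2].
pose dst (p q : (R -> R) * (R -> R)) (K : R) := forall x, 0 <= x ->
  `|p.1 x - q.1 x| + `|p.2 x - q.2 x| <= K * expR (c * x).
have dstT p q K : inv p -> inv q -> 0 <= K -> dst p q K -> dst (T p) (T q) (K / 2).
  move=> ip iq K0 h x x0 /=.
  have LK : 0 <= L * K by rewrite mulr_ge0.
  have bA : `|J (J (app A p)) x - J (J (app A q)) x| <= L * K / c / c * expR (c * x).
    apply: bndJB => //; [exact: cA|exact: cA|] => y y0.
    apply: (le_trans (lipA _ _ _ _)); rewrite -mulrA.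
    by apply: ler_wpM2l => //; exact: h.
  have bB : `|J (J (app B p)) x - J (J (app B q)) x| <= L * K / c / c * expR (c * x).
    apply: bndJB => //; [exact: cB|exact: cB|] => y y0.
    apply: (le_trans (lipB _ _ _ _)); rewrite -mulrA.
    by apply: ler_wpM2l => //; exact: h.
  have cancel (a u v : R) : a + u - (a + v) = u - v by ring.
  rewrite !cancel.
  apply: (le_trans (lerD bA bB)); rewrite -mulrDl ler_wpM2r ?expR_ge0//.
  have -> : L * K / c / c + L * K / c / c = K * (2 * L / c ^+ 2) by field; lra.
  apply: ler_wpM2l => //; rewrite ler_pdivrMr ?exprn_gt0// /c; nra.
pose S n := iter n T (fun=> f0, fun=> g0).
have invS n : inv (S n).
  elim: n => [|n IH]; last exact: invT.
  by split => //= x; exact: cvg_cst.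
pose C := (`|A f0 g0| + `|B f0 g0|) / c / c.
have C0 : 0 <= C by rewrite /C divr_ge0 ?(ltW c0)// divr_ge0 ?(ltW c0)// addr_ge0.
have dstS n : dst (S n.+1) (S n) (C / 2 ^+ n).
  elim: n => [|n IH].
    move=> x x0 /=; rewrite expr0 divr1 ![_ + J _ _]addrC !addrK /app /=.
    have e1 y : 0 <= y -> 1 <= expR (c * y) by move=> y0; rewrite -expR0 ler_expR mulr_ge0// ltW.
    have bA : `|J (J (fun=> A f0 g0)) x| <= `|A f0 g0| / c / c * expR (c * x).
      by apply: bndJ => //; [move=> ?; exact: cvg_cst|move=> y y0; rewrite ler_peMr ?e1].
    have bB : `|J (J (fun=> B f0 g0)) x| <= `|B f0 g0| / c / c * expR (c * x).
      by apply: bndJ => //; [move=> ?; exact: cvg_cst|move=> y y0; rewrite ler_peMr ?e1].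
    by apply: (le_trans (lerD bA bB)); rewrite -!mulrDl.
  rewrite exprSr invfM mulrA; have Cn : 0 <= C / 2 ^+ n by rewrite divr_ge0// exprn_ge0.
  exact: (dstT _ _ _ (invS n.+1) (invS n) Cn IH).
have cE x : 0 <= C * expR (c * x) by rewrite mulr_ge0// expR_ge0.
have climS (pr : (R -> R) * (R -> R) -> R -> R) :
    (forall p q x, `|pr p x - pr q x| <= `|p.1 x - q.1 x| + `|p.2 x - q.2 x|) ->
    exists f : R -> R, forall x n, 0 <= x -> `|pr (S n) x - f x| <= 2 * (C * expR (c * x)) / 2 ^+ n.
  move=> hpr.
  have /choice[f hf] : forall x, exists y, forall n, 0 <= x ->
      `|pr (S n) x - y| <= 2 * (C * expR (c * x)) / 2 ^+ n.
    move=> x; case: (leP 0 x) => [x0|]; last by exists 0.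
    have [|y hy] := @geom_cvg (fun n => pr (S n) x) _ (cE x); last by exists y.
    by move=> n; rewrite mulrAC; apply: le_trans (dstS n x x0); exact: hpr.
  by exists f.
have [f hf] := climS fst (fun p q x => ler_wpDr (normr_ge0 _) (lexx _)).
have [g hg] := climS snd (fun p q x => ler_wpDl (normr_ge0 _) (lexx _)).
(* The limits are controlled on [0 <= x] only, whence the even extension. *)
pose l : (R -> R) * (R -> R) := (fun x => f `|x|, fun x => g `|x|).
have Sabs1 n x : (S n).1 `|x| = (S n).1 x.
  by case: (leP 0 x) => [/ger0_norm -> //|/ltW/ler0_norm ->]; have [_ _ e _] := invS n.
have Sabs2 n x : (S n).2 `|x| = (S n).2 x.
  by case: (leP 0 x) => [/ger0_norm -> //|/ltW/ler0_norm ->]; have [_ _ _ e] := invS n.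
have dstl n : dst (S n) l (4 * C / 2 ^+ n).
  move=> x x0; rewrite /= (ger0_norm x0).
  apply: (le_trans (lerD (hf x n x0) (hg x n x0))).
  by rewrite le_eqVlt; apply/orP; left; apply/eqP; ring.
have climit (u : nat -> R -> R) (v : R -> R) :
    (forall n, continuous (u n)) ->
    (forall n x, `|u n x - v x| <= 2 * (C * expR (c * `|x|)) / 2 ^+ n) -> continuous v.
  move=> cu huv x; apply/cvgrPdist_lt => e e0; have e3 : 0 < e / 3 by lra.
  have [n hn] := exists_geom_lt (2 * (C * expR (c * (`|x| + 1)))) e3.
  have /cvgrPdist_lt/(_ _ e3) hun := cu n x.
  have hv y : `|y| <= `|x| + 1 -> `|u n y - v y| < e / 3.
    move=> yx; apply: le_lt_trans hn; apply: (le_trans (huv n y)).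
    rewrite ler_wpM2r ?invr_ge0 ?exprn_ge0//.
    by do 2 apply: ler_wpM2l => //; rewrite ler_expR; apply: ler_wpM2l => //; exact: ltW.
  near=> y.
  have -> : v x - v y = - (u n x - v x) + (u n x - u n y) + (u n y - v y) by ring.
  apply: (le_lt_trans (ler_normD _ _)).
  have h1 : `|- (u n x - v x) + (u n x - u n y)| <= `|u n x - v x| + `|u n x - u n y|.
    by apply: (le_trans (ler_normD _ _)); rewrite normrN.
  have h2 : `|u n x - v x| < e / 3 by apply: hv; rewrite lerDl.
  have h3 : `|u n y - v y| < e / 3.
    apply: hv; apply: norm_close.
    by near: y; apply/nbhs_ballP; exists 1 => //= z; rewrite -ball_normE.
  have h4 : `|u n x - u n y| < e / 3 by near: y.
  by clear -h1 h2 h3 h4; lra.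
have invl : inv l.
  split => /=; last by move=> x; rewrite normrN.
  - apply: (climit (fun n => (S n).1)); first by move=> n; have [] := invS n.
    by move=> n x; rewrite -Sabs1; exact: hf.
  - apply: (climit (fun n => (S n).2)); first by move=> n; have [] := invS n.
    by move=> n x; rewrite -Sabs2; exact: hg.
  - by move=> x; rewrite normrN.
(* For every [n], both [T l] and [l] are within a geometric error of [S n.+1]. *)
have fix_l x : (T l).1 x = l.1 x /\ (T l).2 x = l.2 x.
  have [_ _ e1 e2] := invl; have [_ _ e3 e4] := invT _ invl.
  wlog x0 : x / 0 <= x.
    move=> H; case: (leP 0 x) => [/H//|xn].
    by rewrite -e1 -e2 -e3 -e4; apply: H; lra.
  have h n : `|(T l).1 x - l.1 x| + `|(T l).2 x - l.2 x| <= 4 * C * expR (c * x) / 2 ^+ n.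
    have C4 : 0 <= 4 * C / 2 ^+ n by rewrite divr_ge0 ?exprn_ge0// mulr_ge0//.
    have := dstT _ _ _ (invS n) invl C4 (dstl n) x x0; have := dstl n.+1 x x0; rewrite -[T (S n)]/(S n.+1).
    set a := (S n.+1).1 x; set b := (S n.+1).2 x.
    have : `|(T l).1 x - l.1 x| <= `|a - (T l).1 x| + `|a - l.1 x|.
      by rewrite [`|a - _|]distrC; exact: ler_distD.
    have : `|(T l).2 x - l.2 x| <= `|b - (T l).2 x| + `|b - l.2 x|.
      by rewrite [`|b - _|]distrC; exact: ler_distD.
    have -> : 4 * C / 2 ^+ n.+1 * expR (c * x) = 4 * C / 2 ^+ n / 2 * expR (c * x).
      by rewrite exprSr invfM mulrA.
    have -> : 4 * C * expR (c * x) / 2 ^+ n = 4 * C / 2 ^+ n / 2 * expR (c * x) +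
        4 * C / 2 ^+ n / 2 * expR (c * x) by field; rewrite expf_neq0.
    by clear; lra.
  split; apply: (@geom_eq (4 * C * expR (c * x))) => n; apply: (le_trans _ (h n)).
    by rewrite lerDl.
  by rewrite lerDr.
have [cl1 cl2 el1 el2] := invl.
have [JA0 dJA] := HJ _ (cA _ invl); have [JJA0 dJJA] := HJ _ (JC _ (cA _ invl)).
have [JB0 dJB] := HJ _ (cB _ invl); have [JJB0 dJJB] := HJ _ (JC _ (cB _ invl)).
exists (T l).1, (T l).2, (J (app A l)), (J (app B l)); split.
- by split => //=; rewrite ?JJA0 ?JJB0 addr0.
- split => x.
  + exact: (is_drv_eq (is_drvD (is_drv_cst f0 x) (dJJA x)) (add0r _)).
  + exact: (is_drv_eq (is_drvD (is_drv_cst g0 x) (dJJB x)) (add0r _)).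
  + by have [-> ->] := fix_l x; exact: dJA.
  + by have [-> ->] := fix_l x; exact: dJB.
- by have [_ _] := invT _ invl.
Unshelve. all: by end_near. Qed.

End Picard.

(** * Bounded Lipschitz functions on a domain *)

Section LipschitzBounded.
Variables (R : realType) (T : Type) (D : T -> Prop) (d : T -> T -> R).
Implicit Types (p q : T -> R).

Definition lip p := exists2 K : R, 0 <= K &
  forall a b, D a -> D b -> `|p a - p b| <= K * d a b.
Definition bdd p := exists2 K : R, 0 <= K & forall a, D a -> `|p a| <= K.

Lemma bddM p q : bdd p -> bdd q -> bdd (fun a => p a * q a).
Proof.
move=> [K K0 hp] [L L0 hq]; exists (K * L); first exact: mulr_ge0.
by move=> a Da; rewrite normrM ler_pM// ?hp ?hq.
Qed.

Lemma lipD p q : lip p -> lip q -> lip (fun a => p a + q a).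
Proof.
move=> [K K0 hp] [L L0 hq]; exists (K + L); first exact: addr_ge0.
move=> a b Da Db; have := hp a b Da Db; have := hq a b Da Db.
have : `|p a + q a - (p b + q b)| <= `|p a - p b| + `|q a - q b|.
  rewrite (_ : _ - _ = p a - p b + (q a - q b)); [exact: ler_normD|by ring].
by rewrite mulrDl; lra.
Qed.

Lemma lipZ (c : R) p : lip p -> lip (fun a => c * p a).
Proof.
move=> [K K0 hp]; exists (`|c| * K); first exact: mulr_ge0.
by move=> a b Da Db; rewrite -mulrBr normrM -mulrA ler_wpM2l// hp.
Qed.

Lemma lipM p q : lip p -> bdd p -> lip q -> bdd q -> lip (fun a => p a * q a).
Proof.
move=> [K K0 hp] [K' K'0 bp] [L L0 hq] [L' L'0 bq].
exists (K * L' + K' * L); first by rewrite addr_ge0// mulr_ge0.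
move=> a b Da Db.
have -> : p a * q a - p b * q b = (p a - p b) * q a + p b * (q a - q b) by ring.
apply: (le_trans (ler_normD _ _)); rewrite !normrM.
have h1 : `|p a - p b| * `|q a| <= K * d a b * L' by apply: ler_pM => //; [exact: hp|exact: bq].
have h2 : `|p b| * `|q a - q b| <= K' * (L * d a b) by apply: ler_pM => //; [exact: bp|exact: hq].
by apply: (le_trans (lerD h1 h2)); rewrite le_eqVlt; apply/orP; left; apply/eqP; ring.
Qed.

Lemma lip_comp (phi : R -> R) (K : R) p : 0 <= K ->
  (forall x y, `|phi x - phi y| <= K * `|x - y|) -> lip p -> lip (fun a => phi (p a)).
Proof.
move=> K0 hphi [L L0 hp]; exists (K * L); first exact: mulr_ge0.
by move=> a b Da Db; apply: (le_trans (hphi _ _)); rewrite -mulrA ler_wpM2l// hp.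
Qed.

Lemma bdd_comp (phi : R -> R) (K : R) p : 0 <= K ->
  (forall x, `|phi x| <= K) -> bdd (fun a => phi (p a)).
Proof. by move=> K0 h; exists K. Qed.

End LipschitzBounded.

(** * Gronwall estimates *)

Section Gronwall.
Variable R : realType.
Implicit Types x y : R.

Lemma gronwall (h h' : R -> R) (c : R) :
  (forall x, is_derive x 1 h (h' x)) -> (forall x, 0 <= x -> h' x <= c * h x) ->
  forall x, 0 <= x -> h x <= h 0 * expR (c * x).
Proof.
move=> dh hh x x0.
have de y := is_drvM (dh y) (is_drv_exp (is_drvZ (- c) (is_drv_id y))).
have h0 : - (h 0 * expR (- c * 0)) <= - (h x * expR (- c * x)).
  apply: (drv_nondecreasing (fun y _ => is_drvN (de y))) => // y /andP[y0 _].
  have -> : - (h' y * expR (- c * y) + h y * (- c * 1 * expR (- c * y))) =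
    (c * h y - h' y) * expR (- c * y) by ring.
  by rewrite mulr_ge0 ?expR_ge0// subr_ge0 hh.
move: h0; rewrite mulr0 expR0 mulr1 lerN2 mulNr => h0.
by move: h0; rewrite expRN ler_pdivrMr ?expR_gt0.
Qed.

(** Gronwall's inequality for the sum of the squared differences, to which [eta ^+ 2] is added to
    absorb the mismatch of the parameters. The constant 9 comes from three right-hand sides, each
    with [(a + b + eta)^2 <= 3 (a^2 + b^2 + eta^2)]. *)
Lemma gronwall_second_order (f1 g1 F1 G1 Q1 A1 B1 W1 f2 g2 F2 G2 Q2 A2 B2 W2 : R -> R)
    (L eta : R) : 0 <= L ->
  (forall x, is_derive x 1 f1 (F1 x)) -> (forall x, is_derive x 1 g1 (G1 x)) ->
  (forall x, is_derive x 1 F1 (A1 x)) -> (forall x, is_derive x 1 G1 (B1 x)) ->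
  (forall x, is_derive x 1 Q1 (W1 x)) ->
  (forall x, is_derive x 1 f2 (F2 x)) -> (forall x, is_derive x 1 g2 (G2 x)) ->
  (forall x, is_derive x 1 F2 (A2 x)) -> (forall x, is_derive x 1 G2 (B2 x)) ->
  (forall x, is_derive x 1 Q2 (W2 x)) ->
  (forall x, 0 <= x -> [/\ `|A1 x - A2 x| <= L * (`|f1 x - f2 x| + `|g1 x - g2 x| + eta),
    `|B1 x - B2 x| <= L * (`|f1 x - f2 x| + `|g1 x - g2 x| + eta) &
    `|W1 x - W2 x| <= L * (`|f1 x - f2 x| + `|g1 x - g2 x| + eta)]) ->
  `|f1 0 - f2 0| <= eta -> g1 0 = g2 0 -> F1 0 = F2 0 -> G1 0 = G2 0 -> Q1 0 = Q2 0 ->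
  forall x, 0 <= x ->
    [/\ (F1 x - F2 x) ^+ 2 <= 2 * eta ^+ 2 * expR ((2 + 9 * L ^+ 2) * x),
        (G1 x - G2 x) ^+ 2 <= 2 * eta ^+ 2 * expR ((2 + 9 * L ^+ 2) * x) &
        (Q1 x - Q2 x) ^+ 2 <= 2 * eta ^+ 2 * expR ((2 + 9 * L ^+ 2) * x)].
Proof.
move=> L0 df1 dg1 dF1 dG1 dQ1 df2 dg2 dF2 dG2 dQ2 hL f0 g0 F0 G0 Q0 x x0.
pose sq (u v : R -> R) y := (u y - v y) * (u y - v y).
have dsq (u v u' v' : R -> R) : (forall y, is_derive y 1 u (u' y)) ->
    (forall y, is_derive y 1 v (v' y)) ->
    forall y, is_derive y 1 (sq u v) (2 * (u y - v y) * (u' y - v' y)).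
  move=> du dv y; apply: (is_drv_eq (is_drvM (is_drvB (du y) (dv y)) (is_drvB (du y) (dv y)))).
  by ring.
have sq0 u v y : 0 <= sq u v y by rewrite /sq -expr2 sqr_ge0.
pose h y := sq f1 f2 y + sq g1 g2 y + sq F1 F2 y + sq G1 G2 y + sq Q1 Q2 y + eta ^+ 2.
have dh y := is_drvD (is_drvD (is_drvD (is_drvD (is_drvD (dsq _ _ _ _ df1 df2 y)
  (dsq _ _ _ _ dg1 dg2 y)) (dsq _ _ _ _ dF1 dF2 y)) (dsq _ _ _ _ dG1 dG2 y))
  (dsq _ _ _ _ dQ1 dQ2 y)) (is_drv_cst (eta ^+ 2) y).
have hx : h x <= h 0 * expR ((2 + 9 * L ^+ 2) * x).
  apply: (gronwall dh) => // y y0; have [hA hB hW] := hL y y0.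
  have cross (u v : R) : `|v| <= L * (`|f1 y - f2 y| + `|g1 y - g2 y| + eta) ->
      2 * u * v <= u ^+ 2 + 3 * L ^+ 2 * (sq f1 f2 y + sq g1 g2 y + eta ^+ 2).
    move=> hv; have h1 : v ^+ 2 <= 3 * L ^+ 2 * (sq f1 f2 y + sq g1 g2 y + eta ^+ 2).
      rewrite -real_normK ?num_real//.
      apply: (@le_trans _ _ ((L * (`|f1 y - f2 y| + `|g1 y - g2 y| + eta)) ^+ 2)).
        by rewrite lerXn2r// nnegrE// (le_trans _ hv).
      rewrite exprMn (_ : 3 * L ^+ 2 * _ = L ^+ 2 * (3 * (sq f1 f2 y + sq g1 g2 y + eta ^+ 2))); last by ring.
      apply: ler_wpM2l; first exact: sqr_ge0.
      rewrite /sq -!expr2.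
      rewrite -[(f1 y - f2 y) ^+ 2]real_normK ?num_real//.
      rewrite -[(g1 y - g2 y) ^+ 2]real_normK ?num_real//.
      set a := `|_|; set b := `|_|.
      by have := sqr_ge0 (a - b); have := sqr_ge0 (a - eta); have := sqr_ge0 (b - eta); nra.
    by have := sqr_ge0 (u - v); nra.
  have cA := cross (F1 y - F2 y) _ hA; have cB := cross (G1 y - G2 y) _ hB.
  have cW := cross (Q1 y - Q2 y) _ hW.
  have s1 := sqr_ge0 (f1 y - f2 y - (F1 y - F2 y)).
  have s2 := sqr_ge0 (g1 y - g2 y - (G1 y - G2 y)).
  rewrite /h; move: cA cB cW s1 s2.
  have := mulr_ge0 (sqr_ge0 L) (sq0 F1 F2 y); have := mulr_ge0 (sqr_ge0 L) (sq0 G1 G2 y).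
  have := mulr_ge0 (sqr_ge0 L) (sq0 Q1 Q2 y).
  have := sq0 f1 f2 y; have := sq0 g1 g2 y; have := sq0 Q1 Q2 y; have := sqr_ge0 eta.
  have := sq0 F1 F2 y; have := sq0 G1 G2 y.
  rewrite /sq; set a := f1 y - f2 y; set b := g1 y - g2 y; set a' := F1 y - F2 y.
  set b' := G1 y - G2 y; set q := Q1 y - Q2 y; set A := A1 y - A2 y.
  set B := B1 y - B2 y; set W := W1 y - W2 y; rewrite -!expr2; clear.
  by move=> *; nra.
have h0 : h 0 <= 2 * eta ^+ 2.
  rewrite /h /sq g0 F0 G0 Q0 !subrr !mulr0 !addr0 -expr2 -real_normK ?num_real//.
  have : `|f1 0 - f2 0| ^+ 2 <= eta ^+ 2 by rewrite lerXn2r// nnegrE// (le_trans _ f0).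
  lra.
have hx' : h x <= 2 * eta ^+ 2 * expR ((2 + 9 * L ^+ 2) * x).
  by apply: (le_trans hx); rewrite ler_wpM2r ?expR_ge0.
move: hx'; rewrite /h; set C := 2 * _ * _ => hx'.
have := sq0 f1 f2 x; have := sq0 g1 g2 x; have := sq0 Q1 Q2 x; have := sqr_ge0 eta.
have := sq0 F1 F2 x; have := sq0 G1 G2 x; move: hx'; rewrite /sq -!expr2; clear.
by move=> *; split; lra.
Qed.

End Gronwall.

(** * The radial system *)

Section System.
Variables (R : realType) (n l : R).
Implicit Types x y m th : R.

Definition energy : R := (l ^+ 2 + (n - l) ^+ 2) / 2.
Definition kap y : R := expR ((y - expR y) / n).
(** The amplitudes are normalised at [x = 0], where [f = m] and [g = 0]: there [P] is
    [energy * (1 - th)] and [n * w / 2] is [energy * th], so that the total is the prescribed energy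
    for every [m] and [th]. *)
Definition wamp m th : R := 2 * energy / n * th * expR ((expR m - m) / n).
Definition Pdens m th (f g : R) : R := energy * (1 - th) * expR (g - (f - m)).
Definition wdens m th (f g : R) : R := wamp m th * kap f * expR (g / n).

(* [F], [G] are the derivatives of [f], [g], and [Q] is the primitive of the density.
   The signs in the last clause make the truncation below inactive. *)
Definition solves m th (f g F G Q : R -> R) : Prop :=
  [/\ [/\ f 0 = m, g 0 = 0, F 0 = 0, G 0 = 0 & Q 0 = 0],
      [/\ forall x, is_derive x 1 f (F x), forall x, is_derive x 1 g (G x),
          forall x, is_derive x 1 F (Pdens m th (f x) (g x) +
                      (expR (f x) - 1) / 2 * wdens m th (f x) (g x)),
          forall x, is_derive x 1 G (- Pdens m th (f x) (g x) -
                      wdens m th (f x) (g x) / 2) &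
          forall x, is_derive x 1 Q (wdens m th (f x) (g x))],
      forall x, f (- x) = f x, forall x, g (- x) = g x &
      forall x, g x <= 0 /\ g x - (f x - m) <= 0].

Hypothesis l_ge1 : 1 <= l.
Hypothesis l_lt : 2 * l + 1 <= n.

Let n_gt0 : 0 < n. Proof. by have := l_ge1; have := l_lt; lra. Qed.

Lemma energy_gt0 : 0 < energy.
Proof. by rewrite /energy; have := l_ge1; have := l_lt; nra. Qed.

(* Replacing the exponentials of [g / n] and [g - (f - m)] by [exm] makes the system
   globally Lipschitz. *)
Definition exm x : R := expR (Num.min x 0).

Lemma exm_lip x y : `|exm x - exm y| <= 1 * `|x - y|.
Proof.
wlog xy : x y / x <= y.
  by move=> H; case: (leP x y) => [/H//|/ltW/H]; rewrite distrC [`|x - _|]distrC.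
have e a b : a <= b -> b <= 0 -> expR b - expR a <= b - a :> R.
  move=> ab b0; have h := expR_ge1Dx (a - b).
  have -> : expR a = expR b * expR (a - b) by rewrite -expRD; congr expR; ring.
  have : expR b <= 1 by rewrite -expR0 ler_expR.
  have := expR_gt0 b; have : expR (a - b) <= 1 by rewrite -expR0 ler_expR; lra.
  by move=> *; nra.
have mxy : Num.min x 0 <= Num.min y 0 by case: (leP x 0) => ?; case: (leP y 0) => ?; lra.
rewrite mul1r distrC [`|x - y|]distrC !ger0_norm ?subr_ge0 ?ler_expR//.
apply: (le_trans (e _ _ mxy _)); first by case: (leP y 0) => ?; lra.
by case: (leP x 0) => ?; case: (leP y 0) => ?; lra.
Qed.

Lemma exm_bdd x : `|exm x| <= 1.
Proof.
by rewrite ger0_norm ?expR_ge0// -expR0 ler_expR; case: (leP x 0).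
Qed.

Lemma exmE x : x <= 0 -> exm x = expR x.
Proof. by move=> x0; rewrite /exm; case: (leP x 0) => // ?; lra. Qed.

(** [expR (y / n)] is at most [1 + expR y], and [expR (expR y / n)] is a cube that dominates
    [(1 + expR y) ^+ 3] up to a constant. The square on the left serves the Lipschitz bound on
    [kap1], whose derivative contains [expR y ^+ 2 * kap y]. *)
Lemma kap_bound y : (1 + expR y) ^+ 2 * kap y <= (3 * n) ^+ 3.
Proof.
have n0 : 0 < n := n_gt0.
have Y0 := expR_gt0 y; set Y := expR y in Y0 *.
have k1 : kap y <= (1 + Y) * expR (- Y / n).
  rewrite /kap -/Y mulrBl expRD -mulNr ler_wpM2r ?expR_ge0//.
  case: (leP y 0) => y0.
    have : expR (y / n) <= 1 by rewrite -expR0 ler_expR pmulr_lle0 ?invr_gt0.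
    lra.
  have : expR (y / n) <= Y by rewrite ler_expR ler_pdivrMr// ler_peMr; have := l_lt; have := l_ge1; lra.
  lra.
have h1 : (1 + Y) / (3 * n) <= expR (Y / (3 * n)).
  apply: le_trans (expR_ge1Dx _); rewrite mulrDl lerD2r ler_pdivrMr; have := l_lt; have := l_ge1; lra.
have h2 : ((1 + Y) / (3 * n)) ^+ 3 <= expR (Y / n).
  have -> : expR (Y / n) = expR (Y / (3 * n)) ^+ 3.
    by rewrite -expRM_natl; congr expR; field; rewrite gt_eqF.
  by rewrite lerXn2r// nnegrE ?expR_ge0// divr_ge0//; lra.
apply: (@le_trans _ _ ((1 + Y) ^+ 3 * expR (- Y / n))).
  rewrite (exprSr _ 2) -mulrA; apply: ler_wpM2l => //; exact: sqr_ge0.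
rewrite mulNr expRN ler_pdivrMr ?expR_gt0//.
have h3 : 0 < (3 * n) ^+ 3 by rewrite exprn_gt0// mulr_gt0.
by move: h2; rewrite expr_div_n ler_pdivrMr// mulrC.
Qed.

Lemma kap_bounds y : [/\ 0 < kap y, kap y <= (3 * n) ^+ 3,
  expR y * kap y <= (3 * n) ^+ 3 & expR y ^+ 2 * kap y <= (3 * n) ^+ 3].
Proof.
have k0 : 0 < kap y by exact: expR_gt0.
have := kap_bound y; have Y0 := expR_gt0 y; set Y := expR y in Y0 *; set k := kap y in k0 *.
have := mulr_gt0 Y0 k0; have := mulr_gt0 Y0 (mulr_gt0 Y0 k0) => h1 h2 h3.
by split => //; nra.
Qed.

Lemma is_drv_kap x : is_derive x 1 kap ((1 - expR x) / n * kap x).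
Proof.
have := is_drv_exp (is_drvM (is_drvB (is_drv_id x) (is_derive_expR x)) (is_drv_cst n^-1 x)).
by move=> h; apply: (is_drv_eq h); rewrite /kap; ring.
Qed.

Let n_ge1 : 1 <= n. Proof. by have := l_ge1; have := l_lt; lra. Qed.
Let invn_le1 : n^-1 <= 1. Proof. by rewrite invf_le1. Qed.
Let invn_gt0 : 0 < n^-1. Proof. by rewrite invr_gt0. Qed.

Lemma kap_lip x y : `|kap x - kap y| <= (3 * n) ^+ 3 * `|x - y|.
Proof.
apply: (lipschitz_of_drv is_drv_kap) => z.
have [k0 k1 k2 k3] := kap_bounds z; have Y0 := expR_gt0 z.
have kb : kap z * (1 + expR z) <= (3 * n) ^+ 3.
  have := kap_bound z; have := mulr_gt0 Y0 k0; have := mulr_gt0 Y0 (mulr_gt0 Y0 k0); nra.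
rewrite ler_norml; apply/andP; split.
  have : kap z * (1 + expR z) * n^-1 <= (3 * n) ^+ 3.
    by apply: le_trans kb; rewrite ger_pMr// mulr_gt0//; lra.
  have : 0 < kap z * n^-1 by rewrite mulr_gt0.
  by move=> *; nra.
have : kap z * (1 + expR z) * n^-1 <= (3 * n) ^+ 3.
  by apply: le_trans kb; rewrite ger_pMr// mulr_gt0//; lra.
have := mulr_gt0 Y0 (mulr_gt0 k0 invn_gt0).
by move=> *; nra.
Qed.

Definition kap1 y : R := expR y * kap y.

Lemma kap1_lip x y : `|kap1 x - kap1 y| <= 2 * (3 * n) ^+ 3 * `|x - y|.
Proof.
have d z := is_drvM (is_derive_expR z) (is_drv_kap z).
apply: (lipschitz_of_drv d) => z.
have [k0 k1 k2 k3] := kap_bounds z; have Y0 := expR_gt0 z.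
have kb : expR z * kap z * (1 + expR z) <= (3 * n) ^+ 3.
  have := kap_bound z; have := mulr_gt0 Y0 k0; have := mulr_gt0 Y0 (mulr_gt0 Y0 k0); nra.
have h : expR z * kap z * (1 + expR z) * n^-1 <= (3 * n) ^+ 3.
  by apply: le_trans kb; rewrite ger_pMr// mulr_gt0// ?mulr_gt0//; lra.
have h1 := mulr_gt0 Y0 (mulr_gt0 k0 invn_gt0).
have h2 := mulr_gt0 Y0 (mulr_gt0 Y0 (mulr_gt0 k0 invn_gt0)).
have h3 := mulr_gt0 Y0 k0.
have K0 : 0 < (3 * n) ^+ 3 by rewrite exprn_gt0// mulr_gt0.
by rewrite ler_norml; apply/andP; split; nra.
Qed.

Section Truncated.
Variable M : R.
Local Notation T := ((R * R) * (R * R))%type.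
(** A point is [((f, g), (m, th))]. With the parameters as further coordinates, one Lipschitz
    constant serves both for the existence of solutions and for their dependence on the parameters;
    [f] and [g] are unrestricted. *)
Definition rect_dom (a : T) : Prop := - M <= a.2.1 <= 1 /\ 0 <= a.2.2 <= 1.
Definition param_dist (a b : T) : R :=
  `|a.1.1 - b.1.1| + `|a.1.2 - b.1.2| + (`|a.2.1 - b.2.1| + `|a.2.2 - b.2.2|).

Local Notation lip := (lip rect_dom param_dist).
Local Notation bdd := (bdd rect_dom).

Definition Ptrunc (a : T) : R := energy * (1 - a.2.2) * exm (a.1.2 - (a.1.1 - a.2.1)).
Definition wtrunc (a : T) : R := wamp a.2.1 a.2.2 * kap a.1.1 * exm (a.1.2 / n).
Definition Ywtrunc (a : T) : R := wamp a.2.1 a.2.2 * kap1 a.1.1 * exm (a.1.2 / n).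

Let pd0 a b : 0 <= param_dist a b. Proof. by rewrite /param_dist !addr_ge0. Qed.

Let lip_proj p : (forall a b, `|p a - p b| <= param_dist a b) -> lip p.
Proof. by move=> h; exists 1 => // a b _ _; rewrite mul1r. Qed.

Let dist_coord a b : [/\ `|a.1.1 - b.1.1| <= param_dist a b, `|a.1.2 - b.1.2| <= param_dist a b,
  `|a.2.1 - b.2.1| <= param_dist a b & `|a.2.2 - b.2.2| <= param_dist a b].
Proof.
rewrite /param_dist; move: (normr_ge0 (a.1.1 - b.1.1)) (normr_ge0 (a.1.2 - b.1.2)).
by move: (normr_ge0 (a.2.1 - b.2.1)) (normr_ge0 (a.2.2 - b.2.2)); split; lra.
Qed.

Let lip_f : lip (fun a => a.1.1). Proof. by apply: lip_proj => a b; case: (dist_coord a b). Qed.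
Let lip_g : lip (fun a => a.1.2). Proof. by apply: lip_proj => a b; case: (dist_coord a b). Qed.
Let lip_m : lip (fun a => a.2.1). Proof. by apply: lip_proj => a b; case: (dist_coord a b). Qed.
Let lip_th : lip (fun a => a.2.2). Proof. by apply: lip_proj => a b; case: (dist_coord a b). Qed.
Let bdd_th : bdd (fun a => a.2.2).
Proof. by exists 1 => // a [_ /andP[h1 h2]]; rewrite ger0_norm. Qed.
Let lip_cst (c : R) : lip (fun=> c).
Proof. by exists 0 => // a b _ _; rewrite subrr normr0 mul0r. Qed.
Let bdd_cst (c : R) : bdd (fun=> c).
Proof. by exists `|c|. Qed.

Let wexp m := expR ((expR m - m) / n).

Let lip_wexp : lip (fun a => wexp a.2.1).
Proof.
have d z := is_drv_exp (is_drvM (is_drvB (is_derive_expR z) (is_drv_id z)) (is_drv_cst n^-1 z)).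
pose K := (expR 1 + 1) * expR ((expR 1 + M) / n).
have K0 : 0 <= K by rewrite mulr_ge0 ?expR_ge0// addr_ge0 ?expR_ge0.
exists K => // a b [/andP[a1 a2] _] [/andP[b1 b2] _].
have : `|wexp a.2.1 - wexp b.2.1| <= K * `|a.2.1 - b.2.1|.
  move: (a.2.1) (b.2.1) a1 a2 b1 b2 => x y x1 x2 y1 y2.
  wlog xy : x y x1 x2 y1 y2 / y <= x.
    by move=> H; case: (leP y x) => [/H|/ltW/H]; [exact|rewrite distrC [`|y - _|]distrC; exact].
  move: xy; rewrite le_eqVlt => /predU1P[->|yx]; first by rewrite !subrr !normr0 mulr0.
  have [c /andP[c1 c2] ->] := mean_value (fun z _ => d z) yx.
  rewrite normrM; apply: ler_wpM2r => //; rewrite normrM; apply: ler_pM => //.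
    rewrite mulr0 addr0 normrM [`|n^-1|]ger0_norm ?(ltW invn_gt0)//.
    apply: (@le_trans _ _ `|expR c - 1|); first by rewrite ler_piMr.
    apply: (le_trans (ler_normB _ _)); rewrite normr1 ger0_norm ?expR_ge0// lerD2r ler_expR; lra.
  rewrite ger0_norm ?expR_ge0// ler_expR ler_wpM2r ?(ltW invn_gt0)//.
  have : expR c <= expR 1 by rewrite ler_expR; lra.
  lra.
by move=> h; apply: (le_trans h); apply: ler_wpM2l => //; case: (dist_coord a b).
Qed.

Let bdd_wexp : bdd (fun a => wexp a.2.1).
Proof.
exists (expR ((expR 1 + M) / n)); first exact: expR_ge0.
move=> a [/andP[a1 a2] _]; rewrite ger0_norm ?expR_ge0// ler_expR ler_wpM2r ?(ltW invn_gt0)//.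
have : expR a.2.1 <= expR 1 by rewrite ler_expR.
lra.
Qed.

Let wamp_lb : lip (fun a => wamp a.2.1 a.2.2) /\ bdd (fun a => wamp a.2.1 a.2.2).
Proof.
have h1 : lip (fun a => 2 * energy / n * a.2.2) by exact: lipZ.
have h2 : bdd (fun a => 2 * energy / n * a.2.2) by exact: bddM.
by split; [exact: (lipM h1 h2 lip_wexp bdd_wexp)|exact: bddM].
Qed.

Let exm_lb p : lip p -> lip (fun a => exm (p a)) /\ bdd (fun a => exm (p a)).
Proof.
move=> hp; split; first exact: (lip_comp (phi := exm) _ exm_lip hp).
exact: (bdd_comp _ _ (K := 1) _ exm_bdd).
Qed.

Lemma lip_trunc : [/\ lip Ptrunc, lip wtrunc & lip Ywtrunc].
Proof.
have K0 : 0 <= (3 * n) ^+ 3 by rewrite exprn_ge0// mulr_ge0// ltW.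
have [lw bw] := wamp_lb.
have [lg bg] : lip (fun a => exm (a.1.2 / n)) /\ bdd (fun a => exm (a.1.2 / n)).
  apply: (exm_lb (p := fun a => a.1.2 / n)).
  have [K h0 h] := lipZ n^-1 lip_g; exists K => // a b Da Db; have := h a b Da Db.
  by rewrite ![n^-1 * _]mulrC.
have lk : lip (fun a => kap a.1.1) := lip_comp K0 kap_lip lip_f.
have bk : bdd (fun a => kap a.1.1).
  exists ((3 * n) ^+ 3) => // a _; have [h1 h2 _ _] := kap_bounds a.1.1.
  by rewrite ger0_norm// ltW.
have K1 : 0 <= 2 * (3 * n) ^+ 3 by rewrite mulr_ge0.
have lk1 : lip (fun a => kap1 a.1.1) := lip_comp K1 kap1_lip lip_f.
have bk1 : bdd (fun a => kap1 a.1.1).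
  exists ((3 * n) ^+ 3) => // a _; have [h1 _ h2 _] := kap_bounds a.1.1.
  by rewrite ger0_norm// mulr_ge0 ?expR_ge0// ltW.
split; last 2 first.
- exact: (lipM (lipM lw bw lk bk) (bddM bw bk) lg bg).
- exact: (lipM (lipM lw bw lk1 bk1) (bddM bw bk1) lg bg).
have l1 : lip (fun a => energy * (1 - a.2.2)).
  apply: lipZ; apply: lipD => //.
  have [K h0 h] := lipZ (-1) lip_th; exists K => // a b Da Db; have := h a b Da Db.
  by rewrite !mulN1r.
have b1 : bdd (fun a => energy * (1 - a.2.2)).
  exists energy; first exact: (ltW energy_gt0).
  move=> a [_ /andP[h1 h2]]; rewrite normrM !ger0_norm ?(ltW energy_gt0)// ?subr_ge0//.
  by rewrite ler_piMr ?(ltW energy_gt0)//; lra.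
have [l2 b2] : lip (fun a => exm (a.1.2 - (a.1.1 - a.2.1))) /\
               bdd (fun a => exm (a.1.2 - (a.1.1 - a.2.1))).
  apply: (exm_lb (p := fun a => a.1.2 - (a.1.1 - a.2.1))).
  have := lipD lip_g (lipD (lipZ (-1) lip_f) lip_m).
  move=> [K h0 h]; exists K => // a b Da Db; apply: le_trans (h a b Da Db).
  by rewrite le_eqVlt; apply/orP; left; apply/eqP; congr (`| _ |); ring.
exact: (lipM l1 b1 l2 b2).
Qed.

Definition Ftrunc (a : T) : R := Ptrunc a + (Ywtrunc a - wtrunc a) / 2.
Definition Gtrunc (a : T) : R := - Ptrunc a - wtrunc a / 2.

Lemma trunc_forces_lip : exists2 L : R, 0 <= L & forall a b, rect_dom a -> rect_dom b ->
  [/\ `|Ftrunc a - Ftrunc b| <= L * param_dist a b,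
      `|Gtrunc a - Gtrunc b| <= L * param_dist a b &
      `|wtrunc a - wtrunc b| <= L * param_dist a b].
Proof.
have [[K1 K10 h1] [K2 K20 h2] [K3 K30 h3]] := lip_trunc.
exists (K1 + K2 + K3); first by rewrite !addr_ge0.
move=> a b Da Db; have := h1 a b Da Db; have := h2 a b Da Db; have := h3 a b Da Db.
have d0 := pd0 a b.
have := mulr_ge0 K10 d0; have := mulr_ge0 K20 d0; have := mulr_ge0 K30 d0.
rewrite /Ftrunc /Gtrunc !mulrDl !ler_norml => ? ? ? /andP[? ?] /andP[? ?] /andP[? ?].
by split; apply/andP; split; lra.
Qed.

(** The truncated system has a global solution. Its densities are nonnegative, so [G] and [G - F]
    decrease from 0 on the half-line; hence [g] and [g - (f - m)] are nonpositive, a region where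
    [exm] coincides with the exponential. *)
Lemma ex_solves m th : - M <= m <= 1 -> 0 <= th <= 1 ->
  exists f g F G Q : R -> R, solves m th f g F G Q.
Proof.
move=> hm hth; have [L L0 hL] := trunc_forces_lip.
have e0 := energy_gt0.
have dmt a b a' b' : param_dist ((a, b), (m, th)) ((a', b'), (m, th)) = `|a - a'| + `|b - b'|.
  by rewrite /param_dist /= !subrr normr0 !addr0.
have dom a b : rect_dom ((a, b), (m, th)) by [].
have [||f [g [F [G [[f0 g0 F0 G0] [df dg dF dG] [ef eg]]]]]] :=
  @picard_even R (fun a b => Ftrunc ((a, b), (m, th)))
                 (fun a b => Gtrunc ((a, b), (m, th))) L m 0 L0.
- by move=> a b a' b'; rewrite -dmt; have [] := hL _ _ (dom a b) (dom a' b').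
- by move=> a b a' b'; rewrite -dmt; have [] := hL _ _ (dom a b) (dom a' b').
pose W x := wtrunc ((f x, g x), (m, th)).
have cW : continuous W.
  apply: (@lipschitz2_continuous R (fun a b => wtrunc ((a, b), (m, th))) L) => //.
  - by move=> a b a' b'; rewrite -dmt; have [] := hL _ _ (dom a b) (dom a' b').
  - exact: drv_continuous df.
  - exact: drv_continuous dg.
have [Q Q0 dQ] := antiderivative cW.
have r0 : 0 <= wamp m th.
  have /andP[th0 _] := hth; rewrite /wamp mulr_ge0 ?expR_ge0// mulr_ge0//.
  by rewrite divr_ge0 ?(ltW n_gt0)// mulr_ge0 ?(ltW e0).
have P0 x : 0 <= Ptrunc ((f x, g x), (m, th)).
  rewrite /Ptrunc /= mulr_ge0 ?expR_ge0// mulr_ge0 ?(ltW e0)//; case/andP: hth; lra.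
have W0 x : 0 <= W x by exact: (mulr_ge0 (mulr_ge0 r0 (expR_ge0 _)) (expR_ge0 _)).
have YW0 x : 0 <= Ywtrunc ((f x, g x), (m, th)).
  exact: (mulr_ge0 (mulr_ge0 r0 (mulr_ge0 (expR_ge0 _) (expR_ge0 _))) (expR_ge0 _)).
have Gle x : 0 <= x -> G x <= 0.
  move=> x0; rewrite -oppr_ge0 -oppr0 -G0.
  apply: (drv_nondecreasing (fun y _ => is_drvN (dG y))) => // y _.
  by rewrite /Gtrunc; have := P0 y; have := W0 y; rewrite /W; lra.
have gle x : g x <= 0.
  wlog x0 : x / 0 <= x.
    by move=> H; case: (leP 0 x) => [/H//|xn]; rewrite -eg; apply: H; lra.
  rewrite -oppr_ge0 -oppr0 -g0.
  apply: (drv_nondecreasing (fun y _ => is_drvN (dg y))) => // y /andP[y0 _].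
  by rewrite oppr_ge0 Gle.
have GFle x : 0 <= x -> G x - F x <= 0.
  move=> x0.
  have H := drv_nondecreasing (fun y _ => is_drvN (is_drvB (dG y) (dF y))) _ x0.
  suff : - (G 0 - F 0) <= - (G x - F x) by rewrite G0 F0; lra.
  apply: H => y _.
  rewrite /Gtrunc /Ftrunc; have := P0 y; have := YW0 y; lra.
have dle x : g x - (f x - m) <= 0.
  wlog x0 : x / 0 <= x.
    by move=> H; case: (leP 0 x) => [/H//|xn]; rewrite -eg -ef; apply: H; lra.
  have := drv_nondecreasing (fun y _ => is_drvN (is_drvB (dg y) (df y))) _ x0.
  move=> H; suff : - (g 0 - f 0) <= - (g x - f x) by rewrite f0 g0; lra.
  by apply: H => y /andP[y0 _]; rewrite oppr_ge0 GFle.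
have gn x : g x / n <= 0 by rewrite pmulr_lle0 ?invr_gt0// gle.
have eP x : Ptrunc ((f x, g x), (m, th)) = Pdens m th (f x) (g x).
  by rewrite /Ptrunc /Pdens /= exmE.
have eW x : wtrunc ((f x, g x), (m, th)) = wdens m th (f x) (g x).
  by rewrite /wtrunc /wdens /= exmE.
have eY x : Ywtrunc ((f x, g x), (m, th)) = expR (f x) * wdens m th (f x) (g x).
  by rewrite /Ywtrunc /wdens /kap1 /= exmE//; ring.
exists f, g, F, G, Q; split => //; split => // x.
- by apply: (is_drv_eq (dF x)); rewrite /Ftrunc eP eW eY; ring.
- by apply: (is_drv_eq (dG x)); rewrite /Gtrunc eP eW.
- by apply: (is_drv_eq (dQ x)); rewrite /W eW.
Qed.

(** The sign clause of [solves] makes every solution one of the truncated system, whose Lipschitz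
    constant is common to all parameters in the rectangle. *)
Lemma solves_dependence : exists2 L : R, 0 <= L &
  forall m th m' th' f g F G Q f' g' F' G' Q',
  - M <= m <= 1 -> 0 <= th <= 1 -> - M <= m' <= 1 -> 0 <= th' <= 1 ->
  solves m th f g F G Q -> solves m' th' f' g' F' G' Q' ->
  forall (eta x : R), `|m - m'| + `|th - th'| <= eta -> 0 <= x ->
    [/\ (F x - F' x) ^+ 2 <= 2 * eta ^+ 2 * expR (L * x),
        (G x - G' x) ^+ 2 <= 2 * eta ^+ 2 * expR (L * x) &
        (Q x - Q' x) ^+ 2 <= 2 * eta ^+ 2 * expR (L * x)].
Proof.
have [L L0 hL] := trunc_forces_lip.
exists (2 + 9 * L ^+ 2); first by rewrite addr_ge0// mulr_ge0// sqr_ge0.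
move=> m th m' th' f g F G Q f' g' F' G' Q' hm hth hm' hth'.
move=> [[f0 g0 F0 G0 Q0] [df dg dF dG dQ] _ _ hneg].
move=> [[f0' g0' F0' G0' Q0'] [df' dg' dF' dG' dQ'] _ _ hneg'] eta x heta x0.
have eP m0 th0 (u v : R -> R) y : v y - (u y - m0) <= 0 ->
    Ptrunc ((u y, v y), (m0, th0)) = Pdens m0 th0 (u y) (v y).
  by move=> h; rewrite /Ptrunc /Pdens /= exmE.
have eW m0 th0 (u v : R -> R) y : v y <= 0 ->
    wtrunc ((u y, v y), (m0, th0)) = wdens m0 th0 (u y) (v y).
  by move=> h; rewrite /wtrunc /wdens /= exmE// pmulr_lle0.
have eY m0 th0 (u v : R -> R) y : v y <= 0 ->
    Ywtrunc ((u y, v y), (m0, th0)) = expR (u y) * wdens m0 th0 (u y) (v y).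
  by move=> h; rewrite /Ywtrunc /wdens /kap1 /= exmE ?pmulr_lle0 ?invr_gt0//; ring.
have mm : `|m - m'| <= eta by have := normr_ge0 (th - th'); lra.
apply: (gronwall_second_order L0 df dg dF dG dQ df' dg' dF' dG' dQ') => //; last 5 first.
- by rewrite f0 f0'.
- by rewrite g0 g0'.
- by rewrite F0 F0'.
- by rewrite G0 G0'.
- by rewrite Q0 Q0'.
move=> y y0; have [n1 n2] := hneg y; have [n1' n2'] := hneg' y.
pose a := ((f y, g y), (m, th)); pose b := ((f' y, g' y), (m', th')).
have Da : rect_dom a by []. have Db : rect_dom b by [].
have Dab : L * param_dist a b <= L * (`|f y - f' y| + `|g y - g' y| + eta).
  by apply: ler_wpM2l => //; rewrite /param_dist /= lerD2l.
have [h1 h2 h3] := hL _ _ Da Db.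
have e1 : Ftrunc a = Pdens m th (f y) (g y) + (expR (f y) - 1) / 2 * wdens m th (f y) (g y).
  by rewrite /Ftrunc /a eP// eW// eY//; ring.
have e2 : Ftrunc b = Pdens m' th' (f' y) (g' y) + (expR (f' y) - 1) / 2 * wdens m' th' (f' y) (g' y).
  by rewrite /Ftrunc /b eP// eW// eY//; ring.
have e3 : Gtrunc a = - Pdens m th (f y) (g y) - wdens m th (f y) (g y) / 2.
  by rewrite /Gtrunc /a eP// eW.
have e4 : Gtrunc b = - Pdens m' th' (f' y) (g' y) - wdens m' th' (f' y) (g' y) / 2.
  by rewrite /Gtrunc /b eP// eW.
rewrite -e1 -e2 -e3 -e4 -!eW//; split; exact: le_trans Dab.
Qed.

End Truncated.
End System.

(** * Limits at infinity and hitting times *)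

Section Asymptotics.
Variable R : realType.
Implicit Types (h : R -> R) (x y : R).

(** Subtracting or adding the tail integral [e] of the bound makes [h] monotone; the limit is a
    point separating [h - e] from [h + e]. *)
Lemma exp_tail_limit h h' (K c : R) : 0 < c -> (forall x, is_derive x 1 h (h' x)) ->
  (forall x, 0 <= x -> `|h' x| <= K * expR (- c * x)) ->
  exists a : R, forall x, 0 <= x -> `|h x - a| <= K / c * expR (- c * x).
Proof.
move=> c0 dh hh.
pose e x : R := K / c * expR (- c * x).
have de x : is_derive x 1 e (- (K * expR (- c * x))).
  apply: (is_drv_eq (is_drvZ (K / c) (is_drv_exp (is_drvZ (- c) (is_drv_id x))))).
  by field; rewrite gt_eqF.
have hb x : 0 <= x -> - (K * expR (- c * x)) <= h' x <= K * expR (- c * x).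
  by move=> /hh; rewrite ler_norml.
have lo x y : 0 <= x -> x <= y -> h x - e x <= h y - e y.
  move=> x0 xy; apply: (drv_nondecreasing (fun z _ => is_drvB (dh z) (de z))) => // z /andP[xz _].
  by have /andP[] := hb z (le_trans x0 xz); lra.
have hi x y : 0 <= x -> x <= y -> h y + e y <= h x + e x.
  move=> x0 xy; suff : - (h x + e x) <= - (h y + e y) by lra.
  apply: (drv_nondecreasing (fun z _ => is_drvN (is_drvD (dh z) (de z)))) => // z /andP[xz _].
  by have /andP[] := hb z (le_trans x0 xz); lra.
have e0 x : 0 <= e x.
  have K0 : 0 <= K by have := hh 0 (lexx 0); rewrite mulr0 expR0 mulr1; apply: le_trans.
  by rewrite /e mulr_ge0 ?expR_ge0// divr_ge0// ltW.
have lohi x y : 0 <= x -> 0 <= y -> h x - e x <= h y + e y.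
  move=> x0 y0; case: (leP x y) => [xy|/ltW yx].
    by have := lo x y x0 xy; have := e0 y; lra.
  by have := hi y x y0 yx; have := e0 x; lra.
have [//|a ha] := @separating_point R R (fun x => 0 <= x) (fun x => h x - e x) (fun x => h x + e x) 0 _ lohi.
exists a => x x0; have /andP[h1 h2] := ha x x0.
by rewrite ler_norml -/(e x); apply/andP; split; lra.
Qed.

Lemma cvg_expRN (c : R) : 0 < c -> expR (- c * x) @[x --> +oo] --> (0 : R).
Proof.
move=> c0; apply/cvgrPdist_lt => e e0; near=> x.
  rewrite sub0r normrN ger0_norm ?expR_ge0// mulNr expRN.
  rewrite invf_plt ?posrE ?expR_gt0//.
  apply: (@lt_le_trans _ _ (1 + c * x)); last exact: expR_ge1Dx.
  rewrite -ltrBlDl -ltr_pdivrMl//; near: x; by apply: nbhs_pinfty_gt; exact: num_real.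
Unshelve. all: by end_near. Qed.

Lemma exp_tail_cvg h (a K c : R) : 0 < c ->
  (forall x, 0 <= x -> `|h x - a| <= K * expR (- c * x)) -> h x @[x --> +oo] --> a.
Proof.
move=> c0 hh; apply/cvgrPdist_lt => e e0.
have K0 : 0 <= K by have := hh 0 (lexx 0); rewrite mulr0 expR0 mulr1; apply: le_trans.
have K1 : 0 < e / (K + 1) by rewrite divr_gt0//; lra.
have /cvgrPdist_lt/(_ _ K1) ec := cvg_expRN c0.
near=> x; rewrite distrC; apply: (@le_lt_trans _ _ (K * expR (- c * x))).
  by apply: hh; near: x; by apply: nbhs_pinfty_ge; exact: num_real.
have : `|0 - expR (- c * x)| < e / (K + 1) by near: x.
rewrite sub0r normrN ger0_norm ?expR_ge0// ltr_pdivlMr; last by lra.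
by have := expR_gt0 (- c * x); nra.
Unshelve. all: by end_near. Qed.

Lemma cvgy_le h (a c X : R) : h x @[x --> +oo] --> a -> (forall x, X <= x -> h x <= c) -> a <= c.
Proof.
move=> ha hc; rewrite -(cvg_lim _ ha)//; apply: limr_le; first by apply/cvg_ex; exists a.
by near=> x; apply: hc; near: x; by apply: nbhs_pinfty_ge; exact: num_real.
Unshelve. all: by end_near. Qed.

Lemma cvgy_ge h (a c X : R) : h x @[x --> +oo] --> a -> (forall x, X <= x -> c <= h x) -> c <= a.
Proof.
move=> ha hc; rewrite -lerN2; apply: (@cvgy_le (fun x => - h x) _ _ X); first exact: cvgN.
by move=> x /hc; rewrite lerN2.
Qed.

Lemma cvgy_unique h (a b : R) : h x @[x --> +oo] --> a -> h x @[x --> +oo] --> b -> a = b.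
Proof. by move=> ha hb; rewrite -(cvg_lim _ ha)// -(cvg_lim _ hb). Qed.

(** Barrier arguments run up to the infimum [X] of the times with [c <= h], before which [h <= c] is
    available. *)
Lemma first_hitting h (c x : R) : continuous h -> h 0 < c -> 0 <= x -> c <= h x ->
  exists2 X, 0 < X <= x & h X = c /\ forall y, 0 <= y <= X -> h y <= c.
Proof.
move=> ch h0 x0 hx.
pose A := [set y : R | 0 <= y <= x /\ c <= h y].
have infA : has_inf A by split; [exists x; split => //; rewrite x0 lexx|exists 0 => y [/andP[]]].
have below y : 0 <= y -> y < inf A -> h y < c.
  move=> y0 yA; rewrite ltNge; apply/negP => hy.
  have yx : y <= x by apply: (le_trans (ltW yA)); apply: inf_lbound; [case: infA|split => //; rewrite x0 lexx].
  by move: yA; rewrite ltNge => /negP; apply; apply: inf_lbound; [case: infA|split => //; rewrite y0 yx].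
have A0 : 0 <= inf A by apply: lb_le_inf; [case: infA|move=> y [/andP[]]].
have Ax : inf A <= x by apply: inf_lbound; [case: infA|split => //; rewrite x0 lexx].
have hge : c <= h (inf A).
  rewrite leNgt; apply/negP => hlt.
  have /cvgrPdist_lt/(_ (c - h (inf A))) := ch (inf A); rewrite subr_gt0 => /(_ hlt).
  case=> e /= e0 he.
  have [y [/andP[y0 yx] hy] ye] := inf_adherent e0 infA.
  have Ay : inf A <= y by apply: inf_lbound; [case: infA|split => //; rewrite y0 yx].
  have := he y; rewrite /= distrC ger0_norm ?subr_ge0// ltrBlDl => /(_ ye).
  by rewrite distrC ltr_norml => /andP[_]; lra.
have Apos : 0 < inf A.
  rewrite lt_neqAle A0 andbT; apply/negP => /eqP e; move: hge; rewrite -e; lra.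
have hle : h (inf A) <= c.
  rewrite leNgt; apply/negP => hgt.
  have /cvgrPdist_lt/(_ (h (inf A) - c)) := ch (inf A); rewrite subr_gt0 => /(_ hgt).
  case=> e /= e0 he.
  pose y := Num.max 0 (inf A - e / 2).
  have y0 : 0 <= y by rewrite /y le_max lexx.
  have yA : y < inf A by rewrite /y gt_max Apos/=; lra.
  have ye : inf A - y < e by have : inf A - e / 2 <= y by [rewrite /y le_max lexx orbT]; lra.
  have := he y; rewrite /= ger0_norm ?subr_ge0 ?(ltW yA)// => /(_ ye).
  by have := below y y0 yA; rewrite ltr_norml => ? /andP[_]; lra.
exists (inf A); first by rewrite Apos Ax.
split; first by apply/eqP; rewrite eq_le hle hge.
move=> y /andP[y0]; rewrite le_eqVlt => /predU1P[->//|yA]; exact: ltW (below y y0 yA).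
Qed.

End Asymptotics.

(** * A single solution: conservation law and signs of the defects *)

Section Solution.
Variables (R : realType) (n l m th : R) (f g F G Q : R -> R).
Implicit Types x y : R.
Hypothesis l_ge1 : 1 <= l.
Hypothesis l_lt : 2 * l + 1 <= n.
Hypothesis th01 : 0 <= th <= 1.
Hypothesis sol : solves n l m th f g F G Q.

Let P x := Pdens n l m th (f x) (g x).
Let w x := wdens n l m th (f x) (g x).
Let Y x := expR (f x).

Let n_gt0 : 0 < n. Proof. by have := l_ge1; have := l_lt; lra. Qed.
Let f0 : f 0 = m. Proof. by have [[]] := sol. Qed.
Let g0 : g 0 = 0. Proof. by have [[]] := sol. Qed.
Let F0 : F 0 = 0. Proof. by have [[]] := sol. Qed.
Let G0 : G 0 = 0. Proof. by have [[]] := sol. Qed.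
Let Q0 : Q 0 = 0. Proof. by have [[]] := sol. Qed.
Let df x : is_derive x 1 f (F x). Proof. by have [_ []] := sol. Qed.
Let dg x : is_derive x 1 g (G x). Proof. by have [_ []] := sol. Qed.
Let dF x : is_derive x 1 F (P x + (Y x - 1) / 2 * w x). Proof. by have [_ []] := sol. Qed.
Let dG x : is_derive x 1 G (- P x - w x / 2). Proof. by have [_ []] := sol. Qed.
Let dQ x : is_derive x 1 Q (w x). Proof. by have [_ []] := sol. Qed.
Let ef x : f (- x) = f x. Proof. by have [_ _] := sol. Qed.
Let eg x : g (- x) = g x. Proof. by have [_ _] := sol. Qed.
Let E0 : 0 < energy n l := energy_gt0 l_ge1 l_lt.

Lemma wamp_ge0 : 0 <= wamp n l m th.
Proof.
have /andP[h _] := th01; rewrite /wamp mulr_ge0 ?expR_ge0// mulr_ge0//.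
by rewrite divr_ge0 ?(ltW n_gt0)// mulr_ge0 ?(ltW E0).
Qed.

Lemma P_ge0 x : 0 <= P x.
Proof.
by have /andP[_ h] := th01; rewrite /P /Pdens mulr_ge0 ?expR_ge0// mulr_ge0 ?(ltW E0)// subr_ge0.
Qed.

Lemma w_ge0 x : 0 <= w x.
Proof. exact: (mulr_ge0 (mulr_ge0 wamp_ge0 (expR_ge0 _)) (expR_ge0 _)). Qed.

Let Y_gt0 x : 0 < Y x. Proof. exact: expR_gt0. Qed.

Lemma dP x : is_derive x 1 P ((G x - F x) * P x).
Proof.
have h := is_drvZ (energy n l * (1 - th))
  (is_drv_exp (is_drvB (dg x) (is_drvB (df x) (is_drv_cst m x)))).
by apply: (is_drv_eq h); rewrite /P /Pdens; ring.
Qed.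

Lemma dw x : is_derive x 1 w ((F x + G x - F x * Y x) / n * w x).
Proof.
have h := is_drvM (is_drvZ (wamp n l m th) (is_drv_comp (df x) (is_drv_kap n (f x))))
  (is_drv_exp (is_drvM (dg x) (is_drv_cst n^-1 x))).
by apply: (is_drv_eq h); rewrite /w /wdens /Y; ring.
Qed.

Lemma P_at0 : P 0 = energy n l * (1 - th).
Proof. by rewrite /P /Pdens f0 g0 !subrr expR0 mulr1. Qed.

Lemma w_at0 : n * w 0 = 2 * energy n l * th.
Proof.
rewrite /w /wdens /wamp /kap f0 g0 mul0r expR0 mulr1 -mulrA -expRD.
rewrite (_ : (expR m - m) / n + (m - expR m) / n = 0); last by ring.
by rewrite expR0; field; rewrite gt_eqF.
Qed.

(** The system is Newton's equation for the potential [P + n / 2 * w], whose partial derivatives in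
    [f] and [g] are the opposites of the two forces. The constant is read off at [x = 0], where the
    slopes vanish. *)
Lemma energy_conserved x : (F x ^+ 2 + G x ^+ 2) / 2 + P x + n / 2 * w x = energy n l.
Proof.
pose H y := (F y * F y + G y * G y) / 2 + P y + n / 2 * w y.
have dH y : is_derive y 1 H 0.
  have h := is_drvD (is_drvD (is_drvM (is_drvD (is_drvM (dF y) (dF y)) (is_drvM (dG y) (dG y)))
    (is_drv_cst 2^-1 y)) (dP y)) (is_drvZ (n / 2) (dw y)).
  by apply: (is_drv_eq h); field; rewrite gt_eqF.
have -> : energy n l = H 0.
  rewrite /H F0 G0 P_at0 (_ : n / 2 * w 0 = n * w 0 / 2); last by field.
  by rewrite w_at0; field.
by rewrite -(drv0_const x 0 dH) /H !expr2.
Qed.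

Lemma F_odd x : F (- x) = - F x.
Proof.
apply: (drv_even_odd dF) => // y; by rewrite /P /w /Y !ef !eg.
Qed.

Lemma G_odd x : G (- x) = - G x.
Proof. by apply: (drv_even_odd dG) => // y; rewrite /P /w !ef !eg. Qed.

Lemma Q_odd x : Q (- x) = - Q x.
Proof. by apply: (drv_even_odd dQ) => // y; rewrite /w !ef !eg. Qed.

Lemma FG_sqr_le x : F x ^+ 2 + G x ^+ 2 <= 2 * energy n l.
Proof.
have := energy_conserved x; have := P_ge0 x.
by have := mulr_ge0 (ltW n_gt0) (w_ge0 x); lra.
Qed.

Lemma energyE : 2 * energy n l = n ^+ 2 - 2 * (l * (n - l)).
Proof. by rewrite /energy; field. Qed.

Lemma slope_norm_le x : `|F x| <= n /\ `|G x| <= n.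
Proof.
have := FG_sqr_le x; rewrite energyE; have := sqr_ge0 (F x); have := sqr_ge0 (G x).
have hl := l_ge1; have hln := l_lt => G2 F2 FG.
by split; rewrite -(@ler_pXn2r _ 2) ?nnegrE ?(ltW n_gt0)// real_normK ?num_real//; nra.
Qed.

Lemma F_norm_le x : `|F x| <= n. Proof. by case: (slope_norm_le x). Qed.
Lemma G_norm_le x : `|G x| <= n. Proof. by case: (slope_norm_le x). Qed.

Lemma G_le0 x : 0 <= x -> G x <= 0.
Proof.
move=> x0; rewrite -oppr_ge0 -oppr0 -G0.
apply: (drv_nondecreasing (fun y _ => is_drvN (dG y))) => // y _.
by have := P_ge0 y; have := w_ge0 y; lra.
Qed.

Lemma GF_le0 x : 0 <= x -> G x - F x <= 0.
Proof.
move=> x0; have H := drv_nondecreasing (fun y _ => is_drvN (is_drvB (dG y) (dF y))) _ x0.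
suff : - (G 0 - F 0) <= - (G x - F x) by rewrite G0 F0; lra.
apply: H => y _.
by have := P_ge0 y; have := mulr_ge0 (ltW (Y_gt0 y)) (w_ge0 y); nra.
Qed.

Lemma Q_bounds x : 0 <= x -> 0 <= Q x <= - 2 * G x.
Proof.
move=> x0; apply/andP; split.
  by rewrite -Q0; apply: (drv_nondecreasing (fun y _ => dQ y)) => // y _; exact: w_ge0.
have := drv_le (fun y _ => dQ y) (fun y _ => is_drvZ (- 2) (dG y)) _ x0.
rewrite Q0 G0 mulr0 !subr0; apply => y _.
by have := P_ge0 y; lra.
Qed.

Lemma Q_le x : 0 <= x -> Q x <= 2 * n.
Proof.
by move=> /Q_bounds/andP[_ h]; have := G_norm_le x; rewrite ler_norml => /andP[]; lra.
Qed.

Lemma f_growth x y : x <= y -> `|f y - f x| <= n * (y - x).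
Proof.
rewrite le_eqVlt => /predU1P[->|xy]; first by rewrite !subrr normr0 mulr0.
have [c _ ->] := mean_value (fun z _ => df z) xy.
have d : 0 <= y - x by rewrite subr_ge0 ltW.
by rewrite normrM (ger0_norm d); apply: ler_wpM2r => //; exact: F_norm_le.
Qed.

Lemma ds x : is_derive x 1 (fun y => F y + G y) ((Y x / 2 - 1) * w x).
Proof. by apply: (is_drv_eq (is_drvD (dF x) (dG x))); field. Qed.

(* Combined with [G <= F], this makes [(F + G)^2 / 2 + n w] a Lyapunov function. *)
Lemma dlyap x : is_derive x 1 (fun y => (F y + G y) * (F y + G y) / 2 + n * w y)
  ((G x - F x) / 2 * (Y x * w x)).
Proof.
have h := is_drvD (is_drvM (is_drvM (ds x) (ds x)) (is_drv_cst 2^-1 x)) (is_drvZ n (dw x)).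
by apply: (is_drv_eq h); field; rewrite gt_eqF.
Qed.

Variables (K c : R).
Hypothesis c_gt0 : 0 < c.
Hypothesis w_tail : forall x, 0 <= x ->
  w x <= K * expR (- c * x) /\ expR (f x) * w x <= K * expR (- c * x).

Let P0 x : 0 <= P x := P_ge0 x.
Let w0 x : 0 <= w x := w_ge0 x.
Let Yw0 x : 0 <= Y x * w x. Proof. by rewrite mulr_ge0// ltW. Qed.
Let cf : continuous f := drv_continuous df.

Lemma ex_limits : exists s q : R,
  (forall x, 0 <= x -> `|F x + G x - s| <= K / c * expR (- c * x)) /\
  (forall x, 0 <= x -> `|Q x - q| <= K / c * expR (- c * x)).
Proof.
have [s hs] : exists s, forall x, 0 <= x -> `|F x + G x - s| <= K / c * expR (- c * x).
  apply: (exp_tail_limit c_gt0 ds) => x x0; have [h1 h2] := w_tail x0.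
  rewrite -/(Y x) in h2.
  by have := w0 x; have := Yw0 x; rewrite ler_norml => *; apply/andP; split; lra.
have [q hq] : exists q, forall x, 0 <= x -> `|Q x - q| <= K / c * expR (- c * x).
  apply: (exp_tail_limit c_gt0 dQ) => x x0; have [h1 h2] := w_tail x0.
  by rewrite ger0_norm.
by exists s, q.
Qed.

Variables (s q : R).
Hypothesis hs : F x + G x @[x --> +oo] --> s.
Hypothesis hq : Q x @[x --> +oo] --> q.

Lemma w_cvg0 : w x @[x --> +oo] --> (0 : R).
Proof.
apply: (exp_tail_cvg (K := K) c_gt0) => x x0; have [h _] := w_tail x0.
by rewrite subr0 ger0_norm.
Qed.

(** The five sign lemmas are named after the sides of the rectangle, with [m] horizontal and [th]
    vertical, and after its top left corner. Here the term [w] is absent, so [F + G] is constant. *)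
Lemma bottom_sign : th = 0 -> s = 0.
Proof.
move=> th0; have ww x : w x = 0 by rewrite /w /wdens /wamp th0 mulr0 !mul0r.
apply: (cvgy_unique hs); rewrite (_ : (fun x => F x + G x) = fun=> 0); first exact: cvg_cst.
apply/funext => x; have := drv0_const x 0 (f := fun y => F y + G y).
rewrite F0 G0 addr0; apply => y.
by apply: (is_drv_eq (ds y)); rewrite ww mulr0.
Qed.

(** As long as [f] is nonnegative, [F] increases from 0; since [f] starts at 1, this lasts forever.
    Only [G] can then make [F + G] negative, and [G ^+ 2] is at most [2 * energy], which is less
    than [n ^+ 2]. *)
Lemma right_sign : m = 1 -> - n < s.
Proof.
move=> m1; have hl := l_ge1; have hln := l_lt; have n0 := n_gt0.
have fpos x : 0 <= x -> 0 < f x.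
  move=> x0; rewrite ltNge; apply/negP => fx.
  have cNf : continuous (fun y => - f y) by move=> y; apply: cvgN; exact: cf.
  have [||X /andP[X0 Xx] [fX hX]] := first_hitting cNf (c := 0) _ x0.
  - by rewrite f0; lra.
  - by rewrite oppr_ge0.
  have Fpos y : 0 <= y <= X -> 0 <= F y.
    move=> /andP[y0 yX]; rewrite -F0.
    apply: (drv_nondecreasing (fun z _ => dF z)) => // z /andP[z0 zy].
    have := hX z; rewrite z0 (le_trans zy yX) oppr_le0 => /(_ isT) fz.
    have : 1 <= Y z by rewrite /Y -expR0 ler_expR.
    by have := P0 z; have := w0 z; nra.
  have := drv_nondecreasing (fun z _ => df z) Fpos (ltW X0).
  by rewrite f0; lra.
have Fpos x : 0 <= x -> 0 <= F x.
  move=> x0; rewrite -F0; apply: (drv_nondecreasing (fun z _ => dF z)) => // z /andP[z0 _].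
  have : 1 <= Y z by rewrite /Y -expR0 ler_expR ltW// fpos.
  by have := P0 z; have := w0 z; nra.
(* A bound for the square root of [2 * energy] without roots: [b ^+ 2] exceeds [2 * energy] by
   [(l * (n - l) / n) ^+ 2]. *)
pose b := n - l * (n - l) / n.
have ln0 : 0 < l * (n - l) by rewrite mulr_gt0; lra.
have b0 : 0 <= b.
  rewrite /b subr_ge0 ler_pdivrMr//; nra.
have bE : 2 * energy n l <= b ^+ 2.
  rewrite energyE /b (_ : (n - l * (n - l) / n) ^+ 2 = n ^+ 2 - 2 * (l * (n - l)) + (l * (n - l) / n) ^+ 2).
    by rewrite lerDl sqr_ge0.
  by field; rewrite gt_eqF.
have : - b <= s.
  apply: (cvgy_ge hs (X := 0)) => x x0.
  have : G x ^+ 2 <= b ^+ 2.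
    apply: le_trans bE; apply: le_trans (FG_sqr_le x).
    by rewrite lerDr sqr_ge0.
  rewrite -[G x ^+ 2]real_normK ?num_real// ler_pXn2r ?nnegrE// ler_norml => /andP[h _].
  by have := Fpos x x0; lra.
have : 0 < l * (n - l) / n by rewrite divr_gt0.
by rewrite /b; lra.
Qed.

(** The sum and the sum of squares determine the pair up to order. Hence the energy and the limit of
    [F + G] fix both slopes at infinity, once it is known which is the larger. *)
Lemma roots_of_slopes (a b : R) : a + b = n -> a ^+ 2 + b ^+ 2 = 2 * energy n l -> a <= b ->
  b = n - l.
Proof.
move=> e1 e2 ab; have hl := l_ge1; have hln := l_lt; move: e2; rewrite energyE => e2.
have ea : a = n - b by lra.
move: e2; rewrite ea => e2.
have : (b - l) * (b - (n - l)) = 0 by nra.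
move=> /eqP; rewrite mulf_eq0 => /orP[]; rewrite subr_eq0 => /eqP //; lra.
Qed.

Lemma energy_at_infinity (a b : R) : F x @[x --> +oo] --> a -> G x @[x --> +oo] --> b ->
  P x @[x --> +oo] --> (0 : R) -> a ^+ 2 + b ^+ 2 = 2 * energy n l.
Proof.
move=> hF hG hP.
have h : (fun x => (F x * F x + G x * G x) / 2 + P x + n / 2 * w x) x @[x --> +oo] -->
   (a * a + b * b) / 2 + 0 + n / 2 * 0.
  apply: cvgD; first apply: cvgD => //.
  - by apply: cvgMr_tmp; apply: cvgD; apply: cvgM.
  - by apply: cvgMl_tmp; exact: w_cvg0.
have e x : (F x * F x + G x * G x) / 2 + P x + n / 2 * w x = energy n l.
  by rewrite -!expr2; exact: (energy_conserved).
rewrite (_ : (fun x => _) = fun=> energy n l) in h; last by apply/funext => x; exact: e.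
have hc : (fun x : R => energy n l) x @[x --> +oo] --> energy n l by exact: cvg_cst.
by have := cvgy_unique h hc; rewrite !expr2; lra.
Qed.

(** Without [P], the equation for [G] integrates to [G = - Q / 2]. The limits of [F] and [G] are
    thus functions of [s] and [q], and the energy at infinity together with [G <= F] leaves a single
    value of [q]. *)
Lemma top_sign : th = 1 -> s = - n -> q = 2 * (n - l).
Proof.
move=> th1 sn.
have PP x : P x = 0 by rewrite /P /Pdens th1 subrr mulr0 mul0r.
have GQ x : G x = - (Q x / 2).
  have := drv0_const x 0 (f := fun y => G y + Q y / 2).
  rewrite G0 Q0 mul0r addr0 => H; suff : G x + Q x / 2 = 0 by lra.
  apply: H => y; apply: (is_drv_eq (is_drvD (dG y) (is_drvM (dQ y) (is_drv_cst 2^-1 y)))).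
  by rewrite PP; ring.
have hG : G x @[x --> +oo] --> - (q / 2).
  rewrite (_ : G = fun x => - (Q x / 2)); last by apply/funext.
  by apply: cvgN; apply: cvgMr_tmp.
have hF : F x @[x --> +oo] --> s - - (q / 2).
  rewrite (_ : F = fun x => (F x + G x) - G x); last by apply/funext => x; rewrite addrK.
  exact: cvgB.
have hP : P x @[x --> +oo] --> (0 : R).
  rewrite (_ : P = fun=> 0); last by apply/funext.
  exact: cvg_cst.
have eE := energy_at_infinity hF hG hP.
have GF : - (q / 2) - (s - - (q / 2)) <= 0.
  apply: (cvgy_le (cvgB hG hF) (X := 0)) => x x0.
  exact: (GF_le0).
have := @roots_of_slopes (n - q / 2) (q / 2).
rewrite subrK => /(_ erefl) H.
suff : q / 2 = n - l by lra.
apply: H; last by lra.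
by rewrite -eE sn; ring.
Qed.

(** Since [P] vanishes, [f] stays below [- M], so the Lyapunov function [L], equal to [2 * energy]
    at 0, loses at most [n * expR (- M) * Q]. In the limit [s ^+ 2 > 4 * energy - 1], and
    [4 * energy - n ^+ 2 = (n - 2 * l) ^+ 2] is at least 1. *)
Lemma corner_sign (M : R) : 0 < M -> 4 * n ^+ 2 * expR (- M) < 1 -> m = - M -> th = 1 -> s < - n.
Proof.
move=> M0 hM mM th1; have hl := l_ge1; have hln := l_lt; have n0 := n_gt0.
have PP x : P x = 0 by rewrite /P /Pdens th1 subrr mulr0 mul0r.
have fneg x : 0 <= x -> f x < 0.
  move=> x0; rewrite ltNge; apply/negP => fx.
  have [||X /andP[X0 Xx] [fX hX]] := first_hitting cf (c := 0) _ x0.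
  - by rewrite f0 mM; lra.
  - by [].
  have Fneg y : 0 <= y <= X -> 0 <= - F y.
    move=> /andP[y0 yX]; rewrite -oppr0 -F0.
    apply: (drv_nondecreasing (fun z _ => is_drvN (dF z))) => // z /andP[z0 zy].
    have := hX z; rewrite z0 (le_trans zy yX) => /(_ isT) fz.
    have : Y z <= 1 by rewrite /Y -expR0 ler_expR.
    by rewrite PP; have := w0 z; nra.
  have := drv_nondecreasing (fun z _ => is_drvN (df z)) Fneg (ltW X0).
  by rewrite f0; lra.
have Fneg x : 0 <= x -> 0 <= - F x.
  move=> x0; rewrite -oppr0 -F0.
  apply: (drv_nondecreasing (fun z _ => is_drvN (dF z))) => // z /andP[z0 _].
  have : Y z <= 1 by rewrite /Y -expR0 ler_expR ltW// fneg.
  by rewrite PP; have := w0 z; nra.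
have fM x : 0 <= x -> f x <= - M.
  move=> x0; rewrite -mM -f0 -lerN2.
  by apply: (drv_nondecreasing (fun z _ => is_drvN (df z))) => // z /andP[z0 _]; exact: Fneg.
pose L x := (F x + G x) * (F x + G x) / 2 + n * w x.
have Lx x : 0 <= x -> 2 * energy n l - n * expR (- M) * Q x <= L x.
  move=> x0.
  have := drv_le (fun z _ => is_drvZ (- (n * expR (- M))) (dQ z))
    (fun z _ => dlyap z) _ x0.
  have wz := w_at0.
  rewrite -/(L x) -/(L 0) Q0 mulr0 subr0.
  have -> : L 0 = 2 * energy n l by rewrite /L F0 G0 addr0 mulr0 mul0r add0r wz th1 mulr1.
  move=> H; suff : - (n * expR (- M)) * Q x <= L x - 2 * energy n l by lra.
  apply: H => z /andP[z0 _].
  have GFz : - (2 * n) <= G z - F z.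
    have := F_norm_le z; have := G_norm_le z.
    by rewrite !ler_norml => /andP[? ?] /andP[? ?]; lra.
  have Yz : Y z <= expR (- M) by rewrite /Y ler_expR fM.
  have h1 : (G z - F z) / 2 * (Y z * w z) >= - n * (Y z * w z) by apply: ler_wpM2r => //; lra.
  have h2 : n * (Y z * w z) <= n * (expR (- M) * w z) by apply: ler_wpM2l; [lra|exact: ler_wpM2r].
  by rewrite -/(w z) -/(Y z); lra.
have hL : L x @[x --> +oo] --> s * s / 2 + n * 0.
  apply: cvgD; last by apply: cvgMl_tmp; exact: w_cvg0.
  by apply: cvgMr_tmp; apply: cvgM.
have : 2 * energy n l - n * expR (- M) * (2 * n) <= s * s / 2 + n * 0.
  apply: (cvgy_ge hL (X := 0)) => x x0; apply: le_trans (Lx x x0).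
  rewrite lerD2l lerN2; apply: ler_wpM2l; first by rewrite mulr_ge0 ?expR_ge0// ltW.
  exact: (Q_le).
rewrite mulr0 addr0 energyE => h.
have s0 : s <= 0.
  apply: (cvgy_le hs (X := 0)) => x x0.
  by have := Fneg x x0; have := G_le0 x0; lra.
have : n ^+ 2 < s * s by nra.
by rewrite ltNge => h2; rewrite ltNge; apply/negP => h3; move/negP: h2; apply; nra.
Qed.

Lemma weighted_slope (a b y : R) : y <= 1 -> 0 <= y -> a + b <= 0 -> b <= 0 ->
  0 <= - (a + b - a * y).
Proof. by move=> *; case: (leP 0 a) => ?; nra. Qed.

(** If [f] stays below [- M / 2], then [(F + G + Q)' = e^f w / 2] is small and [s + q] nearly
    vanishes. Otherwise [f], whose slope is at most [n], reaches [- M / 2] so late that [w] is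
    already tiny at some earlier time with [F > 0]; from there on the Lyapunov function decreases,
    which forces [s ^+ 2 < n ^+ 2] against [s = - n]. *)
Lemma left_sign (M : R) : 8 * n ^+ 3 < M -> m = - M -> s = - n ->
  q <= n + n * expR (- (M / 2)).
Proof.
move=> hM mM sn; have hl := l_ge1; have hln := l_lt; have n0 := n_gt0.
have n1 : 1 <= n by lra.
have n3 : 0 < n ^+ 3 by rewrite exprn_gt0.
have M0 : 0 < M by lra.
have Qle := Q_le.
have [fs|] := pselect (forall x, 0 <= x -> f x < - (M / 2)).
  have key x : 0 <= x -> F x + G x + Q x <= expR (- (M / 2)) / 2 * Q x.
    move=> x0.
    have := drv_le (fun z _ => is_drvD (ds z) (dQ z))
       (fun z _ => is_drvZ (expR (- (M / 2)) / 2) (dQ z)) _ x0.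
    rewrite F0 G0 Q0 mulr0 !addr0 !subr0; apply => z /andP[z0 _].
    have : Y z <= expR (- (M / 2)) by rewrite /Y ler_expR ltW// fs.
    by have := w0 z; nra.
  have key2 : s + q <= expR (- (M / 2)) / 2 * (2 * n).
    apply: (cvgy_le (cvgD hs hq) (X := 0)) => x x0; apply: (le_trans (key x x0)).
    by apply: ler_wpM2l; [rewrite divr_ge0 ?expR_ge0|exact: Qle].
  by rewrite sn in key2; lra.
move=> /existsNP[x /not_implyP[x0 /negP]]; rewrite -leNgt => fx; exfalso.
have [||X /andP[X0 Xx] [fX hX]] := first_hitting cf (c := - (M / 2)) _ x0.
- by rewrite f0 mM; lra.
- by [].
(* [f] cannot exceed [- 3 M / 4] before [X'], so the mean value theorem on [[X', X]] gives a late
   time [c1] with [F c1 > 0]. *)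
pose X' := M / (4 * n).
have X'0 : 0 < X' by rewrite /X' divr_gt0// mulr_gt0.
have nX' : n * X' = M / 4 by rewrite /X'; field; rewrite gt_eqF.
have fX' z : 0 <= z <= X' -> f z <= - (3 * M / 4).
  move=> /andP[z0 zX']; have := f_growth z0.
  rewrite f0 mM subr0 ler_norml => /andP[_].
  have : n * z <= n * X' by apply: ler_wpM2l => //; exact: ltW.
  lra.
have X'X : X' < X.
  rewrite ltNge; apply/negP => h; have := fX' X; rewrite (ltW X0) h fX => /(_ isT); lra.
have [c1 /andP[c1a c1b] ec] := mean_value (fun z _ => df z) X'X.
have Fc : 0 < F c1.
  have : 0 < F c1 * (X - X') by rewrite -ec fX; have := fX' X'; rewrite lexx (ltW X'0) => /(_ isT); lra.
  by rewrite pmulr_lgt0// subr_gt0.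
have c10 : 0 < c1 by lra.
have Yle z : 0 <= z <= c1 -> Y z <= 1.
  move=> /andP[z0 zc]; rewrite /Y -expR0 ler_expR.
  have := hX z; rewrite z0 => /(_ _)H; have : f z <= - (M / 2) by apply: H; lra.
  lra.
have sle z : 0 <= z <= c1 -> F z + G z <= 0.
  move=> /andP[z0 zc].
  have := drv_le (fun u _ => ds u) (fun u _ => is_drv_cst 0 u) _ z0.
  rewrite F0 G0 addr0 !subr0; apply => u /andP[u0 uz].
  by have := Yle u; rewrite u0 (le_trans uz zc) => /(_ isT); have := w0 u; nra.
(* [w] is nonincreasing up to [c1] and has integral at most [2 * n], hence [w c1] is at most
   [2 * n / c1]. *)
have wdec z : 0 <= z <= c1 -> w c1 <= w z.
  move=> /andP[z0 zc]; rewrite -lerN2.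
  apply: (drv_nondecreasing (fun u _ => is_drvN (dw u))) => // u /andP[zu uc].
  have uu : 0 <= u <= c1 by rewrite uc (le_trans z0 zu).
  rewrite -mulNr; apply: mulr_ge0; last exact: w0.
  rewrite -mulNr; apply: mulr_ge0; last by rewrite invr_ge0 ltW.
  by apply: weighted_slope (Yle u uu) (ltW (Y_gt0 u)) (sle u uu) _; apply: G_le0; lra.
have wc : w c1 * c1 <= 2 * n.
  apply: le_trans (Qle c1 (ltW c10)).
  have := drv_le (fun u _ => is_drvZ (w c1) (is_drv_id u)) (fun u _ => dQ u) _ (ltW c10).
  by rewrite Q0 mulr0 !subr0; apply => u uu; rewrite mulr1; exact: wdec.
have wc2 : w c1 * M <= 8 * n ^+ 2.
  have : w c1 * X' <= 2 * n by apply: le_trans wc; apply: ler_wpM2l; [exact: w0|exact: ltW].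
  rewrite /X' mulrA ler_pdivrMr; last by rewrite mulr_gt0.
  by move=> h; apply: (le_trans h); rewrite le_eqVlt; apply/orP; left; apply/eqP; ring.
have wc3 : n * w c1 < 1.
  have h : w c1 * M * n <= 8 * n ^+ 3.
    by rewrite (_ : 8 * n ^+ 3 = 8 * n ^+ 2 * n); [apply: ler_wpM2r => //; exact: ltW|ring].
  rewrite -(ltr_pM2l M0) mulr1; lra.
pose L z := (F z + G z) * (F z + G z) / 2 + n * w z.
have Ldec z : c1 <= z -> L z <= L c1.
  move=> cz; rewrite -lerN2.
  apply: (drv_nondecreasing (fun u _ => is_drvN (dlyap u))) => // u /andP[cu _].
  have GFu : G u - F u <= 0 by apply: (GF_le0); lra.
  by rewrite -mulNr mulr_ge0 ?Yw0//; lra.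
have hL : L x @[x --> +oo] --> s * s / 2 + n * 0.
  apply: cvgD; last by apply: cvgMl_tmp; exact: w_cvg0.
  by apply: cvgMr_tmp; apply: cvgM.
have Linf := cvgy_le hL Ldec.
have cc : 0 <= c1 <= c1 by rewrite lexx ltW.
have sc := sle c1 cc.
(* As [F c1 > 0] and [F c1 + G c1 <= 0], the value of [L] at [c1] is below [energy + 1], whereas its
   limit is [n ^+ 2 / 2 = energy + l * (n - l)]. *)
have ssq : (F c1 + G c1) * (F c1 + G c1) <= G c1 ^+ 2 by nra.
have := FG_sqr_le c1; rewrite energyE.
have := sqr_ge0 (F c1).
move: Linf; rewrite /L sn mulr0 addr0 mulrNN -expr2.
have : 1 <= l * (n - l) by nra.
lra.
Qed.

End Solution.


(** * Tail bounds uniform in the parameters *)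

Section Tail.
Variables (R : realType) (n l M : R).
Hypothesis l_ge1 : 1 <= l.
Hypothesis l_lt : 2 * l + 1 <= n.
Hypothesis M_ge0 : 0 <= M.
Implicit Types (x m th : R) (f g F G Q : R -> R).

(** [k0] bounds [kap] from below on [[- M - n, 1 + n]]. The constant [d0] lies below both
    [energy * expR (- 2 * n)], which bounds the [P]-term, and [energy / n * (k0 * expR (- 1))],
    which bounds the [w]-term. *)
Let k0 : R := expR ((- M - n - expR (1 + n)) / n).
Let d0 : R := energy n l * expR (- 2 * n) * (k0 * expR (- 1) / n).

Let n0 : 0 < n. Proof. by have := l_ge1; have := l_lt; lra. Qed.
Let E0 : 0 < energy n l := energy_gt0 l_ge1 l_lt.

Let d00 : 0 < d0.
Proof.
have k00 : 0 < k0 := expR_gt0 _.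
exact: (mulr_gt0 (mulr_gt0 E0 (expR_gt0 _)) (divr_gt0 (mulr_gt0 k00 (expR_gt0 _)) n0)).
Qed.

(** The two terms carry the weights [1 - th] and [th], so they cannot both degenerate: each is at
    least its weight times [d0]. *)
Lemma force_lower_bound m th y z : - M <= m <= 1 -> 0 <= th <= 1 ->
  `|y - m| <= n -> - n <= z -> d0 <= Pdens n l m th y z + wdens n l m th y z / 2.
Proof.
have hl := l_ge1; have hln := l_lt; have hM := M_ge0.
have k00 : 0 < k0 by exact: expR_gt0.
have k01 : k0 <= 1.
  rewrite /k0 -[leRHS]expR0 ler_expR pmulr_lle0 ?invr_gt0//.
  by have := expR_gt0 (1 + n); lra.
have e1 : expR (- 1) <= 1 :> R by rewrite -[leRHS]expR0 ler_expR; lra.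
have kk : k0 * expR (- 1) / n <= 1.
  rewrite ler_pdivrMr// mul1r; apply: (@le_trans _ _ 1); last by lra.
  by rewrite mulr_ile1 ?expR_ge0 ?(ltW k00).
have c1 : d0 <= energy n l * expR (- 2 * n).
  rewrite /d0 -[leRHS]mulr1; apply: ler_wpM2l => //.
  by rewrite mulr_ge0 ?expR_ge0 ?(ltW E0).
have c2 : d0 <= energy n l / n * (k0 * expR (- 1)).
  rewrite /d0 (_ : energy n l / n * (k0 * expR (- 1)) = energy n l * 1 * (k0 * expR (- 1) / n)); last by ring.
  apply: ler_wpM2r; first by rewrite divr_ge0 ?(ltW n0)// mulr_ge0 ?expR_ge0 ?(ltW k00).
  apply: ler_wpM2l; first exact: ltW.
  by rewrite -[leRHS]expR0 ler_expR; lra.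
move=> /andP[m1 m2] /andP[th0 th1]; rewrite ler_norml => /andP[hf1 hf2] gx.
have En : 0 <= 2 * energy n l / n * th.
  by rewrite mulr_ge0// divr_ge0 ?(ltW n0)// mulr_ge0 ?(ltW E0).
have wamp_lo : 2 * energy n l / n * th <= wamp n l m th.
  rewrite /wamp ler_peMr// -expR0 ler_expR divr_ge0 ?(ltW n0)//.
  by have := expR_ge1Dx m; lra.
have kx : k0 <= kap n y.
  rewrite /k0 /kap ler_expR ler_wpM2r ?invr_ge0 ?(ltW n0)//.
  have : expR y <= expR (1 + n) by rewrite ler_expR; lra.
  lra.
have Px : energy n l * (1 - th) * expR (- 2 * n) <= Pdens n l m th y z.
  apply: ler_wpM2l; first by rewrite mulr_ge0 ?(ltW E0) ?subr_ge0.
  by rewrite ler_expR; lra.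
have wx : 2 * energy n l / n * th * k0 * expR (- 1) <= wdens n l m th y z.
  apply: ler_pM; [exact: mulr_ge0 En (ltW k00)|exact: expR_ge0| |].
    exact: ler_pM En (ltW k00) wamp_lo kx.
  by rewrite ler_expR ler_pdivlMr//; lra.
apply: le_trans (lerD Px (ler_wpM2r (_ : 0 <= 2^-1) wx)); last by rewrite invr_ge0.
have -> : energy n l * (1 - th) * expR (-2 * n) + 2 * energy n l / n * th * k0 * expR (-1) / 2 =
   (1 - th) * (energy n l * expR (- 2 * n)) + th * (energy n l / n * (k0 * expR (- 1))).
  by field; rewrite gt_eqF.
have -> : d0 = (1 - th) * d0 + th * d0 by ring.
by rewrite lerD// ler_wpM2l// subr_ge0.
Qed.

(* By [force_lower_bound], [- G'] is bounded below on [0, 1] independently of the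
   parameters, so that [g] decreases at least linearly, at a uniform rate. *)
Lemma uniform_tail : exists K c : R, 0 < c /\
  forall m th f g F G Q, - M <= m <= 1 -> 0 <= th <= 1 -> solves n l m th f g F G Q ->
  forall x, 0 <= x -> let w := wdens n l m th (f x) (g x) in
    w <= K * expR (- c * x) /\ expR (f x) * w <= K * expR (- c * x).
Proof.
pose A := 2 * energy n l / n * expR ((expR 1 + M) / n).
have A0 : 0 <= A by rewrite /A mulr_ge0 ?expR_ge0// divr_ge0 ?(ltW n0)// mulr_ge0 ?(ltW E0).
exists (A * (3 * n) ^+ 3 * expR (d0 / n)), (d0 / n); split; first by rewrite divr_gt0.
move=> m th f g F G Q hm hth sol.
have [[f0 g0 F0 G0 Q0] [df dg dF dG dQ] ef eg hneg] := sol.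
have Fn := F_norm_le l_ge1 l_lt hth sol; have Gn := G_norm_le l_ge1 l_lt hth sol.
have fn := f_growth l_ge1 l_lt hth sol.
have gn x : 0 <= x -> - n * x <= g x.
  rewrite le_eqVlt => /predU1P[<-|x0]; first by rewrite g0 mulr0.
  have [c _] := mean_value (fun z _ => dg z) x0; rewrite g0 !subr0 => ->.
  by rewrite ler_wpM2r ?(ltW x0)//; have := Gn c; rewrite ler_norml => /andP[].
have Gd x : 0 <= x -> x <= 1 -> d0 <= Pdens n l m th (f x) (g x) + wdens n l m th (f x) (g x) / 2.
  move=> x0 x1; have nx : n * x <= n by rewrite ler_piMr// ltW.
  apply: force_lower_bound => //.
    by have := fn _ _ x0; rewrite subr0 f0 => /le_trans; apply.
  by apply: le_trans (gn x x0); rewrite mulNr lerN2.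
have Gx x : 1 <= x -> G x <= - d0.
  move=> x1; have G1 : G 1 <= - d0.
    have := drv_le (fun y _ => dG y) (fun y _ => is_drvZ (- d0) (is_drv_id y)) _ (@ler01 R).
    rewrite G0 mulr0 !subr0 mulr1; apply=> y /andP[y0 y1].
    by have := Gd y y0 y1; lra.
  apply: le_trans G1; rewrite -lerN2.
  apply: (drv_nondecreasing (fun y _ => is_drvN (dG y))) => // y _.
  by have := P_ge0 m f g l_ge1 l_lt hth y; have := w_ge0 m f g l_ge1 l_lt hth y; lra.
have gx x : 0 <= x -> g x <= - d0 * (x - 1).
  move=> x0; case: (leP x 1) => x1.
    by have [h _] := hneg x; apply: (le_trans h); rewrite mulNr -mulrN mulr_ge0 ?(ltW d00)//; lra.
  have := drv_le (fun y _ => dg y) (fun y _ => is_drvZ (- d0) (is_drv_id y)) _ (ltW x1).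
  have [g1 _] := hneg 1 => H.
  suff : g x - g 1 <= - d0 * x - - d0 * 1 by lra.
  by apply: H => y /andP[y1 _]; rewrite mulr1; exact: Gx.
have wampA : wamp n l m th <= A.
  have /andP[th0 th1] := hth; have /andP[m1 m2] := hm.
  rewrite /wamp /A; apply: ler_pM; rewrite ?expR_ge0//.
  - by rewrite mulr_ge0// divr_ge0 ?(ltW n0)// mulr_ge0 ?(ltW E0).
  - by rewrite ler_piMr// divr_ge0 ?(ltW n0)// mulr_ge0 ?(ltW E0).
  - rewrite ler_expR ler_wpM2r ?invr_ge0 ?(ltW n0)//.
    have : expR m <= expR 1 by rewrite ler_expR.
    lra.
have wamp0 := wamp_ge0 m l_ge1 l_lt hth.
move=> x x0 /=.
have [ka kb kc _] := kap_bounds l_ge1 l_lt (f x).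
have eg' : expR (g x / n) <= expR (d0 / n) * expR (- (d0 / n) * x).
  rewrite -expRD ler_expR (_ : d0 / n + - (d0 / n) * x = (- d0 * (x - 1)) / n); last by ring.
  by apply: ler_wpM2r; [rewrite invr_ge0 ltW|exact: gx].
have wk p : 0 <= p -> p <= (3 * n) ^+ 3 ->
    wamp n l m th * p * expR (g x / n) <= A * (3 * n) ^+ 3 * expR (d0 / n) * expR (- (d0 / n) * x).
  move=> p0 pk; rewrite -[X in _ <= X]mulrA; apply: ler_pM; rewrite ?expR_ge0//.
    by rewrite mulr_ge0.
  exact: ler_pM.
split; first by apply: wk => //; exact: ltW.
rewrite /wdens (_ : _ * _ = wamp n l m th * (expR (f x) * kap n (f x)) * expR (g x / n)); last by ring.
by apply: wk => //; rewrite mulr_ge0 ?expR_ge0// ltW.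
Qed.

End Tail.

(** * A zero of a map of the square *)

Section TwoDimensionalZero.
Variable R : realType.
Implicit Types (x y : R).

(* Colours of the vertices of a grid: [None] where [u < 0], and otherwise
   [Some b] with [b] telling whether [0 <= v]. *)
Definition edge01 (a b : option bool) : bool :=
  match a, b with
  | None, Some true => true | Some true, None => true | _, _ => false
  end.

Definition rainbow (a b c : option bool) : Prop :=
  [/\ None \in [:: a; b; c], Some true \in [:: a; b; c] & Some false \in [:: a; b; c]].

(** A triangle with at most two colours has an even number of edges joining two given distinct
    colours. *)
Lemma rainbowP (a b c : option bool) :
  edge01 a b (+) edge01 b c (+) edge01 a c -> rainbow a b c.
Proof. by move: a b c => [[]|] [[]|] [[]|]. Qed.

(** Edges between [None] and [Some true] are counted modulo 2. Without rainbow triangles the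
    boundary of each cell has an even number of them, and summing row by row transports the parity
    from the bottom to the top, the vertical sides contributing nothing. On the top the sum
    telescopes to the colours of the two corners. *)
Lemma sperner_parity (N : nat) (col : nat -> nat -> option bool) :
  (forall i j, (i < N)%N -> (j < N)%N ->
    ~ rainbow (col i j) (col i.+1 j) (col i.+1 j.+1) /\
    ~ rainbow (col i j) (col i j.+1) (col i.+1 j.+1)) ->
  (forall i, (i <= N)%N -> col i 0%N = None) -> (forall j, (j <= N)%N -> col N j = None) ->
  (forall j, (j < N)%N -> edge01 (col 0%N j) (col 0%N j.+1) = false) ->
  (forall i, (i < N)%N -> edge01 (col i N) (col i.+1 N) = isSome (col i N) (+) isSome (col i.+1 N)) ->
  col 0%N N = None.
Proof.
move=> hr hbot hright hleft htop.
pose h i j := edge01 (col i j) (col i.+1 j).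
pose v i j := edge01 (col i j) (col i j.+1).
have cell i j : (i < N)%N -> (j < N)%N -> h i j (+) h i j.+1 = v i j (+) v i.+1 j.
  move=> iN jN; have [/(contra_not (@rainbowP _ _ _))/negP h1 /(contra_not (@rainbowP _ _ _))/negP h2] := hr i j iN jN.
  move: h1 h2; rewrite /h /v.
  by move: (edge01 _ _) (edge01 _ _) (edge01 _ _) (edge01 _ _) (edge01 _ _) => [] [] [] [] [].
pose S j n := \big[addb/false]_(i < n) h i j.
have row j n : (j < N)%N -> (n <= N)%N -> S j n (+) S j.+1 n = v 0%N j (+) v n j.
  move=> jN; elim: n => [|n IH] nN; first by rewrite /S !big_ord0 !addbb.
  rewrite /S !big_ord_recr /= -/(S j n) -/(S j.+1 n).
  have := IH (ltnW nN); have := cell n j nN jN.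
  by move: (S j n) (S j.+1 n) (h n j) (h n j.+1) (v 0%N j) (v n j) (v n.+1 j) => [] [] [] [] [] [] [].
have rowN j : (j <= N)%N -> S j N = false.
  elim: j => [_|j IH jN].
    by rewrite /S big1// => i _; rewrite /h !hbot// ltnW.
  have := row j N jN (leqnn N); rewrite (IH (ltnW jN)) /= => ->.
  by rewrite /v hleft// !hright// ltnW.
have top n : (n <= N)%N -> S N n = isSome (col 0%N N) (+) isSome (col n N).
  elim: n => [|n IH] nN; first by rewrite /S big_ord0 addbb.
  rewrite /S big_ord_recr /= -/(S N n) IH ?(ltnW nN)// /h htop//.
  by case: (isSome (col n N)); case: (isSome _); case: (isSome _).
have := top N (leqnn N); rewrite rowN// hright//=.
by case: (col 0%N N).
Qed.

Lemma unif_cont_continuous (h : R -> R) :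
  (forall e : R, 0 < e -> exists2 d : R, 0 < d & forall x y, `|x - y| < d -> `|h x - h y| < e) ->
  continuous h.
Proof.
move=> hu x; apply/cvgrPdist_lt => e e0; have [d d0 hd] := hu e e0.
near=> y; apply: hd; near: y; apply/nbhs_ballP; exists d => //= z; by rewrite -ball_normE.
Unshelve. all: by end_near. Qed.

(** Minimisation in [y], then in [x]: the partial minimum inherits the modulus of continuity of
    [h]. *)
Lemma square_min (h : R -> R -> R) :
  (forall e : R, 0 < e -> exists2 d : R, 0 < d & forall x y x' y',
    `|x - x'| + `|y - y'| < d -> `|h x y - h x' y'| < e) ->
  exists x0 y0, [/\ 0 <= x0 <= 1, 0 <= y0 <= 1 &
    forall x y, 0 <= x <= 1 -> 0 <= y <= 1 -> h x0 y0 <= h x y].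
Proof.
move=> hu.
have /choice[ym hym] : forall x, exists y0, 0 <= y0 <= 1 /\
    forall y, 0 <= y <= 1 -> h x y0 <= h x y.
  move=> x; have cy : continuous (h x).
    apply: unif_cont_continuous => e e0; have [d d0 hd] := hu e e0.
    by exists d => // y y' yy; apply: hd; rewrite subrr normr0 add0r.
  have [y0 y01 hy0] := EVT_min (@ler01 R) (continuous_subspaceT cy).
  exists y0; split; first by move: y01; rewrite in_itv.
  by move=> y y1; apply: hy0; rewrite in_itv.
have cm : continuous (fun x => h x (ym x)).
  apply: unif_cont_continuous => e e0; have [d d0 hd] := hu e e0.
  exists d => // x x' xx.
  have [y1 h1] := hym x; have [y2 h2] := hym x'.
  have le1 := h1 _ y2; have le2 := h2 _ y1.
  have := hd x (ym x) x' (ym x); rewrite subrr normr0 addr0 => /(_ xx).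
  have := hd x (ym x') x' (ym x'); rewrite subrr normr0 addr0 => /(_ xx).
  by rewrite !ltr_norml => /andP[? ?] /andP[? ?]; apply/andP; split; lra.
have [x0 x01 hx0] := EVT_min (@ler01 R) (continuous_subspaceT cm).
have [y1 h1] := hym x0.
exists x0, (ym x0); split => //.
move=> x y x1 y01; have [_ h2] := hym x; apply: le_trans (h2 y y01).
by apply: hx0; rewrite in_itv.
Qed.

(** The zero lies between [a] and [b], hence close to [b]: this carries boundary information at
    zeros of [u] over to neighbouring grid points. *)
Lemma crossing (g : R -> R) a b : continuous g -> 0 <= a <= 1 -> 0 <= b <= 1 ->
  g a < 0 -> 0 <= g b -> exists z, [/\ 0 <= z <= 1, g z = 0 & `|z - b| <= `|a - b|].
Proof.
move=> cg /andP[a0 a1] /andP[b0 b1] ga gb.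
case: (leP a b) => ab.
  have [|z] := IVT ab (v := 0) (continuous_subspaceT cg).
    by rewrite ge_min le_max (ltW ga) gb orbT.
  rewrite in_itv /= => /andP[az zb] gz; exists z; split => //.
    by rewrite (le_trans a0 az) (le_trans zb b1).
  by rewrite distrC [leRHS]distrC !ger0_norm ?subr_ge0//; lra.
have [|z] := IVT (ltW ab) (v := 0) (continuous_subspaceT cg).
  by rewrite ge_min le_max (ltW ga) gb orbT.
rewrite in_itv /= => /andP[az zb] gz; exists z; split => //.
  by rewrite (le_trans b0 az) (le_trans zb a1).
by rewrite !ger0_norm ?subr_ge0//; lra.
Qed.

Lemma opposite_far_apart (v1 v2 e : R) : 0 < e -> 2 * e < v1 -> 2 * e < - v2 -> ~ `|v1 - v2| < e.
Proof. by rewrite ltr_norml => ? ? ? /andP[]; lra. Qed.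

(** Without a common zero, [|u| + |v|] is at least [3 * e] on the square. On a fine grid, a vertex
    with [0 <= u] next to one with [u < 0] has [|u| < e], hence [|v| > 2 * e], and two such vertices
    of one triangle cannot carry opposite signs of [v]. So there is no rainbow triangle, and parity
    contradicts [0 < u 0 1]. *)
Lemma zero_in_square (u v : R -> R -> R) :
  (forall e : R, 0 < e -> exists2 d : R, 0 < d & forall x y x' y',
    `|x - x'| + `|y - y'| < d -> `|u x y - u x' y'| < e /\ `|v x y - v x' y'| < e) ->
  (forall x, 0 <= x <= 1 -> u x 0 < 0) -> (forall y, 0 <= y <= 1 -> u 1 y < 0) ->
  (forall x, 0 <= x <= 1 -> u x 1 = 0 -> 0 < v x 1) ->
  (forall y, 0 <= y <= 1 -> u 0 y = 0 -> v 0 y < 0) -> 0 < u 0 1 ->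
  exists x y, [/\ 0 <= x <= 1, 0 <= y <= 1, u x y = 0 & v x y = 0].
Proof.
move=> uc hbot hright htop hleft hcorner.
have [|x0 [y0 [x01 y01 hmin]]] := @square_min (fun x y => `|u x y| + `|v x y|).
  move=> e e0; have e2 : 0 < e / 2 by lra.
  have [d d0 hd] := uc _ e2; exists d => // x y x' y' /hd[hu hv].
  have := ler_dist_dist (u x y) (u x' y'); have := ler_dist_dist (v x y) (v x' y').
  rewrite ltr_norml !ler_norml => /andP[? ?] /andP[? ?]; apply/andP; split; lra.
have [z0|znz] := pselect (u x0 y0 = 0 /\ v x0 y0 = 0).
  by exists x0, y0; case: z0.
exfalso.
pose e := (`|u x0 y0| + `|v x0 y0|) / 3.
have e0 : 0 < e.
  rewrite /e divr_gt0// lt_neqAle addr_ge0// andbT eq_sym paddr_eq0// !normr_eq0.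
  by apply/negP => /andP[/eqP ? /eqP ?]; apply: znz.
have hsum x y : 0 <= x <= 1 -> 0 <= y <= 1 -> 3 * e <= `|u x y| + `|v x y|.
  by move=> x1 y1; have := hmin x y x1 y1; rewrite /e; lra.
have [d d0 hd] := uc e e0.
(* In the sum norm the diagonal of a cell has length [2 / N.+1]. *)
have [N hN] : exists N : nat, 2 / N.+1%:R < d.
  exists (Num.bound `|2 / d|); rewrite ltr_pdivrMr ?ltr0n// mulrC -ltr_pdivrMr//.
  apply: (le_lt_trans (ler_norm _)); apply: (lt_trans (archi_boundP (normr_ge0 _))).
  by rewrite ltr_nat.
pose pt (i : nat) : R := i%:R / N.+1%:R.
have pt01 i : (i <= N.+1)%N -> 0 <= pt i <= 1.
  move=> iN; rewrite /pt divr_ge0 ?ler0n//= ler_pdivrMr ?ltr0n// mul1r ler_nat//.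
have pt0 : pt 0%N = 0 by rewrite /pt mul0r.
have ptS i : `|pt i - pt i.+1| = 1 / N.+1%:R.
  rewrite /pt -mulrBl -natr1 opprD addrA subrr add0r normrM normrN normr1.
  by rewrite ger0_norm// invr_ge0 ler0n.
have dS : 1 / N.+1%:R + 1 / N.+1%:R < d by rewrite -mulrDl; exact: hN.
have c0 : 0 <= 1 / N.+1%:R :> R by rewrite divr_ge0 ?ler0n.
have d1 : 1 / N.+1%:R < d by apply: le_lt_trans dS; rewrite lerDl.
pose col i j := if u (pt i) (pt j) < 0 then None else Some (0 <= v (pt i) (pt j)).
have near_ok (p q : R * R) : 0 <= p.1 <= 1 -> 0 <= p.2 <= 1 -> 0 <= q.1 <= 1 -> 0 <= q.2 <= 1 ->
    `|p.1 - q.1| + `|p.2 - q.2| < d -> 0 <= u p.1 p.2 -> u q.1 q.2 < 0 ->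
    `|u p.1 p.2| < e /\ 2 * e < `|v p.1 p.2|.
  move=> p1 p2 q1 q2 /hd[hu hv] up uq.
  have h1 : `|u p.1 p.2| < e.
    by rewrite ger0_norm//; move: hu uq; clear; rewrite ltr_norml => /andP[]; lra.
  by split => //; have := hsum _ _ p1 p2; move: h1; clear; lra.
have cont1 y : continuous (u ^~ y).
  apply: unif_cont_continuous => e1 e10; have [d' d'0 hd'] := uc e1 e10.
  by exists d' => // x x' xx; have [] := hd' x y x' y; rewrite ?subrr ?normr0 ?addr0.
have cont2 x : continuous (u x).
  apply: unif_cont_continuous => e1 e10; have [d' d'0 hd'] := uc e1 e10.
  by exists d' => // y y' xx; have [] := hd' x y x y'; rewrite ?subrr ?normr0 ?add0r.
have colN : col 0%N N.+1 = None.
  apply: (@sperner_parity N.+1 col).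
  - move=> i j iN jN.
    have trio (p q r : R * R) (cl : R * R -> option bool) :
        (forall s, cl s = if u s.1 s.2 < 0 then None else Some (0 <= v s.1 s.2)) ->
        (forall s t, s \in [:: p; q; r] -> t \in [:: p; q; r] ->
           [/\ 0 <= s.1 <= 1, 0 <= s.2 <= 1 & `|s.1 - t.1| + `|s.2 - t.2| < d]) ->
        ~ rainbow (cl p) (cl q) (cl r).
      move=> hcl hcls [].
      rewrite -[[:: cl p; cl q; cl r]]/(map cl [:: p; q; r]).
      move=> /mapP[s1 s1in e1] /mapP[s2 s2in e2] /mapP[s3 s3in e3].
      move: e1; rewrite hcl; case: ltP => // us1 _.
      move: e2; rewrite hcl; case: ltP => // us2 [vs2].
      move: e3; rewrite hcl; case: ltP => // us3 [vs3].
      have [a1 a2 a3] := hcls _ _ s1in s1in.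
      have [b1 b2 b3] := hcls _ _ s2in s1in.
      have [c1 c2 c3] := hcls _ _ s3in s1in.
      have [_ _ bc] := hcls _ _ s2in s3in.
      have [_ h2] := near_ok _ _ b1 b2 a1 a2 b3 us2 us1.
      have [_ h3] := near_ok _ _ c1 c2 a1 a2 c3 us3 us1.
      have [_] := hd _ _ _ _ bc.
      move: h2; rewrite ger0_norm -?vs2// => h2.
      move: h3; rewrite ltr0_norm; last by rewrite ltNge -vs3.
      by move=> h3; exact: opposite_far_apart e0 h2 h3.
    have pi := pt01 i (ltnW iN); have pi1 := pt01 i.+1 iN.
    have pj := pt01 j (ltnW jN); have pj1 := pt01 j.+1 jN.
    have dd a b a' b' : `|pt a - pt a'| <= 1 / N.+1%:R -> `|pt b - pt b'| <= 1 / N.+1%:R ->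
      `|pt a - pt a'| + `|pt b - pt b'| < d.
      by move=> h1 h2; apply: le_lt_trans dS; exact: lerD.
    have z0 a : `|pt a - pt a| <= 1 / N.+1%:R by rewrite subrr normr0 divr_ge0.
    have z1 a : `|pt a - pt a.+1| <= 1 / N.+1%:R by rewrite ptS.
    have z2 a : `|pt a.+1 - pt a| <= 1 / N.+1%:R by rewrite distrC ptS.
    pose cl (s : R * R) := if u s.1 s.2 < 0 then None else Some (0 <= v s.1 s.2).
    split.
      apply: (trio (pt i, pt j) (pt i.+1, pt j) (pt i.+1, pt j.+1) cl) => // s t.
      by rewrite !inE => /or3P[] /eqP -> /or3P[] /eqP -> /=; split => //; apply: dd.
    apply: (trio (pt i, pt j) (pt i, pt j.+1) (pt i.+1, pt j.+1) cl) => // s t.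
    by rewrite !inE => /or3P[] /eqP -> /or3P[] /eqP -> /=; split => //; apply: dd.
  - by move=> i iN; rewrite /col pt0 hbot// pt01.
  - move=> j jN; rewrite /col (_ : pt N.+1 = 1); last by rewrite /pt divff// pnatr_eq0.
    by rewrite hright// pt01.
  (* Next to a sign change of [u] on the left side there is a zero of [u], where [v < 0]; closeness
     propagates the sign, so the vertex with [0 <= u] is coloured [Some false]. The top side is
     symmetric, with [Some true]. *)
  - have left_ok y1 y2 : 0 <= y1 <= 1 -> 0 <= y2 <= 1 -> `|y1 - y2| < d ->
        u 0 y1 < 0 -> 0 <= u 0 y2 -> v 0 y2 < 0.
      move=> y11 y21 yd u1 u2; have [z [z01 uz zy]] := @crossing (u 0) y1 y2 (cont2 0) y11 y21 u1 u2.
      have vz := hleft z z01 uz; have := hsum 0 z; rewrite lexx ler01 uz normr0 add0r => /(_ isT z01).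
      rewrite ltr0_norm// => ev; have [] := hd 0 z 0 y2.
        by rewrite subrr normr0 add0r; exact: le_lt_trans zy yd.
      by move=> _; move: ev e0; clear; rewrite ltr_norml => ? ? /andP[]; lra.
    move=> j jN; have pj := pt01 j (ltnW jN); have pj1 := pt01 j.+1 jN.
    rewrite /col pt0.
    case: (ltP (u 0 (pt j))) => u1; case: (ltP (u 0 (pt j.+1))) => u2 //=.
      have := left_ok _ _ pj pj1 _ u1 u2; rewrite ptS => /(_ d1).
      by rewrite ltNge => /negbTE ->.
      have := left_ok _ _ pj1 pj _ u2 u1; rewrite distrC ptS => /(_ d1).
      by rewrite ltNge => /negbTE ->.
    by case: (0 <= v _ _); case: (0 <= v _ _).
  - have top_ok y1 y2 : 0 <= y1 <= 1 -> 0 <= y2 <= 1 -> `|y1 - y2| < d ->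
        u y1 1 < 0 -> 0 <= u y2 1 -> 0 <= v y2 1.
      move=> y11 y21 yd u1 u2; have [z [z01 uz zy]] := @crossing (u^~ 1) y1 y2 (cont1 1) y11 y21 u1 u2.
      have vz := htop z z01 uz; have := hsum z 1 z01; rewrite lexx ler01 uz normr0 add0r => /(_ isT).
      rewrite gtr0_norm// => ev; have [] := hd z 1 y2 1.
        by rewrite subrr normr0 addr0; exact: le_lt_trans zy yd.
      by move=> _; move: ev e0; clear; rewrite ltr_norml => ? ? /andP[]; lra.
    move=> i iN; have pi := pt01 i (ltnW iN); have pi1 := pt01 i.+1 iN.
    have e1 : pt N.+1 = 1 by rewrite /pt divff// pnatr_eq0.
    rewrite /col e1.
    case: (ltP (u (pt i) 1)) => u1; case: (ltP (u (pt i.+1) 1)) => u2 //=.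
      have := top_ok _ _ pi pi1; rewrite ptS => /(_ d1 u1 u2) ->; by [].
      have := top_ok _ _ pi1 pi; rewrite distrC ptS => /(_ d1 u2 u1) ->; by [].
    by case: (0 <= v _ _); case: (0 <= v _ _).
move: colN; rewrite /col (_ : pt N.+1 = 1); last by rewrite /pt divff// pnatr_eq0.
rewrite pt0.
by rewrite ltNge (ltW hcorner).
Qed.

End TwoDimensionalZero.

(** * Existence of the radial solution *)

Section Existence.
Variables (R : realType) (n l rho : R).
Hypothesis l_ge1 : 1 <= l.
Hypothesis l_lt : 2 * l + 1 <= n.
Hypothesis rho_lo : n < rho.
Hypothesis rho_hi : rho < 2 * (n - l).
Implicit Types x y m th : R.

Lemma limits_close (a a' s s' b e : R) : `|a - a'| < e / 3 -> `|a - s| <= b -> `|a' - s'| <= b ->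
  b < e / 3 -> `|s - s'| < e.
Proof.
rewrite !ltr_norml !ler_norml => /andP[? ?] /andP[? ?] /andP[? ?] ?.
by apply/andP; split; lra.
Qed.

Lemma force_norm_le (p w b : R) : 0 <= p -> 0 <= w -> p <= b -> w <= b ->
  `|- p - w / 2| <= 2 * b.
Proof. by rewrite ler_norml => *; apply/andP; split; lra. Qed.

(** Retraction onto [[0, 1]]: composed with it, the shooting functions become uniformly continuous
    on the whole plane, as [zero_in_square] asks. *)
Definition clamp x : R := Num.max 0 (Num.min x 1).

Lemma clamp_cases x :
  [\/ x <= 0 /\ clamp x = 0, 0 <= x <= 1 /\ clamp x = x | 1 <= x /\ clamp x = 1].
Proof.
rewrite /clamp; case: (leP x 1) => x1; last first.
  by apply: Or33; rewrite (ltW x1) (elimT max_idPr).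
case: (leP 0 x) => x0; last by apply: Or31; rewrite (ltW x0).
by apply: Or32.
Qed.

Lemma clamp01 x : 0 <= clamp x <= 1.
Proof. by case: (clamp_cases x) => [[_ ->]|[h ->]|[_ ->]]; rewrite ?lexx ?ler01. Qed.

Lemma clampE x : 0 <= x <= 1 -> clamp x = x.
Proof. by move=> /andP[x0 x1]; case: (clamp_cases x) => [[h ->]|[h ->]|[h ->]]; lra. Qed.

Lemma clamp_lip x y : `|clamp x - clamp y| <= `|x - y|.
Proof.
wlog xy : x y / x <= y.
  by move=> H; case: (leP x y) => [/H//|/ltW/H]; rewrite distrC [`|y - _|]distrC.
rewrite distrC [leRHS]distrC [leRHS]ger0_norm ?subr_ge0// ler_norml.
case: (clamp_cases x) => [[h1 ->]|[/andP[h1 h1'] ->]|[h1 ->]];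
  case: (clamp_cases y) => [[h2 ->]|[/andP[h2 h2'] ->]|[h2 ->]];
  by apply/andP; split; lra.
Qed.

(** Since [th < 1], [P] is positive and [G - F] strictly decreases; beyond [x = 1] it is at most
    [- d1 < 0], and [d1] is the rate of decay of [P]. This rate depends on the solution, which
    suffices for the one found in the end. *)
Lemma P_tail m th f g F G Q : 0 <= th < 1 -> solves n l m th f g F G Q ->
  exists K c : R, 0 < c /\ forall x, 0 <= x -> Pdens n l m th (f x) (g x) <= K * expR (- c * x).
Proof.
move=> /andP[th0 th1] sol; have hl := l_ge1; have hln := l_lt.
have th01 : 0 <= th <= 1 by rewrite th0 ltW.
have E0 := energy_gt0 l_ge1 l_lt.
have [[f0 g0 F0 G0 Q0] [df dg dF dG dQ] ef eg hneg] := sol.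
pose P x := Pdens n l m th (f x) (g x); pose w x := wdens n l m th (f x) (g x).
have P0 x : 0 < P x by rewrite /P /Pdens mulr_gt0 ?expR_gt0// mulr_gt0// subr_gt0.
have w0 x : 0 <= w x := w_ge0 m f g l_ge1 l_lt th01 x.
have dd x : is_derive x 1 (fun y => G y - F y) (- (2 * P x + expR (f x) * w x / 2)).
  by apply: (is_drv_eq (is_drvB (dG x) (dF x))); rewrite /P /w; field.
have neg x : - (2 * P x + expR (f x) * w x / 2) < 0.
  by have := P0 x; have := mulr_ge0 (ltW (expR_gt0 (f x))) (w0 x); lra.
pose d1 := - (G 1 - F 1).
have d10 : 0 < d1.
  have [c _] := mean_value (fun z _ => dd z) (@ltr01 R); rewrite /d1 G0 F0 !subr0 mulr1 => ->.
  by have := neg c; lra.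
have GF x : 1 <= x -> G x - F x <= - d1.
  move=> x1; rewrite /d1 opprK -lerN2.
  apply: (drv_nondecreasing (fun z _ => is_drvN (dd z))) => // z _.
  by have := neg z; lra.
have hd x : 0 <= x -> g x - (f x - m) <= - d1 * (x - 1).
  move=> x0; case: (leP x 1) => x1.
    by have [_ h] := hneg x; apply: (le_trans h); rewrite mulNr -mulrN mulr_ge0 ?(ltW d10)//; lra.
  have H := drv_le (fun y _ => is_drvB (dg y) (df y)) (fun y _ => is_drvZ (- d1) (is_drv_id y)) _ (ltW x1).
  have [_ g1] := hneg 1.
  suff : g x - f x - (g 1 - f 1) <= - d1 * x - - d1 * 1 by lra.
  by apply: H => y /andP[y1 _]; rewrite mulr1; exact: GF.
exists (energy n l * expR d1), d1; split => // x x0.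
rewrite /Pdens -mulrA -mulrA -expRD; apply: ler_wpM2l; first exact: ltW.
apply: (@le_trans _ _ (1 * expR (d1 + - d1 * x))); last by rewrite mul1r.
apply: ler_pM; rewrite ?expR_ge0//; [by rewrite subr_ge0 ltW|lra|].
by rewrite ler_expR; have := hd x x0; lra.
Qed.

Lemma solution_family : exists M K c : R, [/\ 0 < M, 0 < c, 0 <= K & 
  [/\ 8 * n ^+ 3 < M, 4 * n ^+ 2 * expR (- M) < 1, n * expR (- (M / 2)) < rho - n &
  forall m th, - M <= m <= 1 -> 0 <= th <= 1 -> exists f g F G Q,
    solves n l m th f g F G Q /\
    forall x, 0 <= x -> let w := wdens n l m th (f x) (g x) in
      w <= K * expR (- c * x) /\ expR (f x) * w <= K * expR (- c * x)]].
Proof.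
have hl := l_ge1; have hln := l_lt; have hr := rho_lo.
have n0 : 0 < n by lra.
have n2 : 0 < n ^+ 2 by rewrite exprn_gt0.
have n3 : 0 < n ^+ 3 by rewrite exprn_gt0.
have r0 : 0 < rho - n by lra.
(* Each of the first three summands of [M] serves one largeness condition, the exponential ones
   through [1 + a <= expR a]; [t] is made for the condition involving [rho - n]. *)
pose t := 2 * n / (rho - n); have t0 : 0 < t by rewrite /t divr_gt0//; lra.
pose M := 8 * n ^+ 3 + 4 * n ^+ 2 + t + 1.
have M0 : 0 < M by rewrite /M; lra.
have [K [c [c0 hK]]] := uniform_tail l_ge1 l_lt (ltW M0).
have expN (a b : R) : 0 <= a -> b < 1 + a -> b * expR (- a) < 1.
  move=> a0 ba; rewrite expRN ltr_pdivrMr ?expR_gt0// mul1r.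
  exact: lt_le_trans ba (expR_ge1Dx a).
exists M, K, c; split => //.
  have [||f [g [F [G [Q sol]]]]] := @ex_solves R n l l_ge1 l_lt M 0 0.
  - by rewrite ler01 oppr_le0 ltW.
  - by rewrite lexx ler01.
  have [||h _] := hK 0 0 f g F G Q _ _ sol 0 (lexx 0).
  - by rewrite ler01 oppr_le0 ltW.
  - by rewrite lexx ler01.
  move: h; rewrite mulr0 expR0 mulr1; apply: le_trans.
  by apply: (w_ge0 0 f g l_ge1 l_lt); rewrite lexx ler01.
split.
- by rewrite /M; lra.
- by apply: expN; rewrite ?(ltW M0)// /M; lra.
- have : n / (rho - n) * expR (- (M / 2)) < 1.
    apply: expN; first by rewrite divr_ge0 ?(ltW M0).
    have -> : n / (rho - n) = t / 2 by rewrite /t; field; rewrite gt_eqF.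
    by rewrite /M; lra.
  by rewrite mulrAC ltr_pdivrMr// mul1r.
- move=> m th hm hth; have [f [g [F [G [Q sol]]]]] := @ex_solves R n l l_ge1 l_lt M m th hm hth.
  by exists f, g, F, G, Q; split => // x x0; exact: (hK m th f g F G Q hm hth sol x x0).
Qed.

(** [u] and [v] are the defects of the two limits, extended to the plane by clamping. Their uniform
    continuity combines the tail bound beyond a time [X] with Gronwall's estimate at [X], and the
    sign lemmas give the boundary conditions of [zero_in_square]. At the zero, [th] is neither 0 nor
    1, and the energy at infinity separates the limits of [F] and [G]. *)
Theorem radial_solution : exists m th f g F G Q, [/\ 0 < th < 1, solves n l m th f g F G Q,
  [/\ F x @[x --> +oo] --> - l, G x @[x --> +oo] --> - (n - l) & Q x @[x --> +oo] --> rho] &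
  exists K c : R, 0 < c /\ forall x, 0 <= x ->
    [/\ Pdens n l m th (f x) (g x) <= K * expR (- c * x),
        wdens n l m th (f x) (g x) <= K * expR (- c * x) &
        expR (f x) * wdens n l m th (f x) (g x) <= K * expR (- c * x)]].
Proof.
have hl := l_ge1; have hln := l_lt; have hr := rho_lo; have hr' := rho_hi.
have n0 : 0 < n by lra.
have [M [K [c [M0 c0 K0 [hM1 hM2 hM3 fam]]]]] := solution_family.
have [L L0 hL] := solves_dependence l_ge1 l_lt M.
pose B x := K / c * expR (- c * x).
(* The pair of limits is chosen as a function of the parameters; outside the rectangle its value is
   arbitrary. *)
have /choice[sq hsq] : forall p : R * R, exists sq : R * R,
    - M <= p.1 <= 1 -> 0 <= p.2 <= 1 -> exists f g F G Q,
    [/\ solves n l p.1 p.2 f g F G Q,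
       forall x, 0 <= x -> let w := wdens n l p.1 p.2 (f x) (g x) in
         w <= K * expR (- c * x) /\ expR (f x) * w <= K * expR (- c * x),
       forall x, 0 <= x -> `|F x + G x - sq.1| <= B x &
       forall x, 0 <= x -> `|Q x - sq.2| <= B x].
  move=> [m th] /=; have [hm|hm] := boolP (- M <= m <= 1); last by exists (0, 0).
  have [hth|hth] := boolP (0 <= th <= 1); last by exists (0, 0).
  have [f [g [F [G [Q [sol hw]]]]]] := fam m th hm hth.
  have [s [q [hs hq]]] := ex_limits l_ge1 l_lt hth sol c0 hw.
  by exists (s, q) => _ _; exists f, g, F, G, Q.
pose mm x := - M + (M + 1) * clamp x.
have mm1 x : - M <= mm x <= 1.
  have /andP[a b] := clamp01 x; rewrite /mm; have := mulr_ge0 (_ : 0 <= M + 1) a.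
  by move=> /(_ _)h; apply/andP; split; nra.
pose u x y := - (sq (mm x, clamp y)).1 - n.
pose v x y := (sq (mm x, clamp y)).2 - rho.
have lims x y : exists f g F G Q, [/\ solves n l (mm x) (clamp y) f g F G Q,
    forall z, 0 <= z -> let w := wdens n l (mm x) (clamp y) (f z) (g z) in
         w <= K * expR (- c * z) /\ expR (f z) * w <= K * expR (- c * z),
    F z + G z @[z --> +oo] --> - n - u x y & Q z @[z --> +oo] --> rho + v x y].
  have [f [g [F [G [Q [sol hw hs hq]]]]]] := hsq (mm x, clamp y) (mm1 x) (clamp01 y).
  exists f, g, F, G, Q; split => //.
    apply: (exp_tail_cvg (K := K / c) c0) => z z0; rewrite /u.
    by rewrite (_ : - n - _ = (sq (mm x, clamp y)).1); [exact: hs|ring].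
  apply: (exp_tail_cvg (K := K / c) c0) => z z0; rewrite /v.
  by rewrite (_ : rho + _ = (sq (mm x, clamp y)).2); [exact: hq|ring].
have [||||||x0 [y0 [x01 y01 ux vx]]] := @zero_in_square R u v.
- move=> e e0.
  have Kc : 0 <= K / c by rewrite divr_ge0// ltW.
  (* Solution of [e / 3 * (c * X) = K / c], so that [1 + a <= expR a] brings the tail at [X] below
     [e / 3]. *)
  pose X := 3 * (K / c) / (e * c).
  have X0 : 0 <= X by apply: divr_ge0; apply: mulr_ge0 => //; exact: ltW.
  have BX : B X < e / 3.
    rewrite /B mulNr expRN ltr_pdivrMr ?expR_gt0//.
    apply: (@lt_le_trans _ _ (e / 3 * (1 + c * X))).
      have -> : e / 3 * (1 + c * X) = e / 3 + K / c by rewrite /X; field; rewrite !gt_eqF.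
      by rewrite ltrDr; lra.
    by apply: ler_wpM2l; [lra|exact: expR_ge1Dx].
  pose EX := expR (L * X).
  have EX1 : 1 <= EX by rewrite /EX -expR0 ler_expR mulr_ge0.
  (* With 12 the Gronwall bound gives differences below [e / 6] at time [X], which leaves [e / 3]
     for the sum [F + G]. *)
  pose eta := e / (12 * EX).
  have eta0 : 0 < eta by rewrite /eta divr_gt0// mulr_gt0//; lra.
  exists (eta / (M + 1)); first by rewrite divr_gt0//; lra.
  move=> x y x' y' xy.
  have heta : `|mm x - mm x'| + `|clamp y - clamp y'| <= eta.
    have h1 : `|mm x - mm x'| <= (M + 1) * `|x - x'|.
      rewrite /mm opprD addrACA opprK addNr add0r -mulrBr normrM ger0_norm; last by lra.
      by apply: ler_wpM2l; [lra|exact: clamp_lip].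
    have h2 : `|clamp y - clamp y'| <= (M + 1) * `|y - y'|.
      apply: (le_trans (clamp_lip y y')); rewrite ler_peMl//; lra.
    apply: (le_trans (lerD h1 h2)); rewrite -mulrDr.
    by move: xy; rewrite ltr_pdivlMr; [rewrite mulrC => /ltW|lra].
  have [f [g [F [G [Q [sol hw hs hq]]]]]] := hsq (mm x, clamp y) (mm1 x) (clamp01 y).
  have [f' [g' [F' [G' [Q' [sol' hw' hs' hq']]]]]] := hsq (mm x', clamp y') (mm1 x') (clamp01 y').
  have [dF dG dQ] := hL _ _ _ _ _ _ _ _ _ _ _ _ _ _ (mm1 x) (clamp01 y) (mm1 x') (clamp01 y')
    sol sol' _ _ heta X0.
  have small (a : R) : a ^+ 2 <= 2 * eta ^+ 2 * EX -> `|a| < e / 6.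
    move=> h; rewrite -(@ltr_pXn2r _ 2) ?nnegrE//; last by lra.
    rewrite real_normK ?num_real//; apply: (le_lt_trans h).
    have -> : 2 * eta ^+ 2 * EX = e ^+ 2 / 72 / EX.
      by rewrite /eta; field; rewrite gt_eqF//; lra.
    rewrite ltr_pdivrMr; last by lra.
    have e2 : 0 < e ^+ 2 by rewrite exprn_gt0.
    have -> : (e / 6) ^+ 2 * EX = e ^+ 2 / 36 * EX by field.
    by nra.
  have FG : `|F X + G X - (F' X + G' X)| < e / 3.
    rewrite opprD addrACA (_ : e / 3 = e / 6 + e / 6); last by field.
    exact: le_lt_trans (ler_normD _ _) (ltrD (small _ dF) (small _ dG)).
  have Q3 : `|Q X - Q' X| < e / 3.
    by apply: lt_trans (small _ dQ) _; rewrite ltr_pM2l// ltf_pV2 ?posrE// ltr_nat.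
  split; rewrite /u /v.
    by rewrite opprB addrA subrK -opprB normrN opprK addrC; exact: (limits_close FG (hs X X0) (hs' X X0) BX).
  by rewrite opprB addrA subrK; exact: (limits_close Q3 (hq X X0) (hq' X X0) BX).
- move=> x _; have [f [g [F [G [Q [sol hw hs hq]]]]]] := lims x 0.
  have c00 : clamp 0 = 0 by rewrite clampE// lexx ler01.
  by have := bottom_sign sol hs c00; lra.
- move=> y _; have [f [g [F [G [Q [sol hw hs hq]]]]]] := lims 1 y.
  have c11 : mm 1 = 1 by rewrite /mm clampE ?lexx ?ler01//; ring.
  by have := right_sign l_ge1 l_lt (clamp01 y) sol hs c11; lra.
- move=> x _ u0; have [f [g [F [G [Q [sol hw hs hq]]]]]] := lims x 1.
  have c11 : clamp 1 = 1 :> R by rewrite clampE// lexx ler01.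
  rewrite u0 subr0 in hs.
  by have := top_sign l_ge1 l_lt (clamp01 1) sol c0 hw hs hq c11 erefl; lra.
- move=> y _ u0; have [f [g [F [G [Q [sol hw hs hq]]]]]] := lims 0 y.
  have c00 : mm 0 = - M by rewrite /mm clampE ?lexx ?ler01//; ring.
  rewrite u0 subr0 in hs.
  by have := left_sign l_ge1 l_lt (clamp01 y) sol c0 hw hs hq hM1 c00 erefl; lra.
- have [f [g [F [G [Q [sol hw hs hq]]]]]] := lims 0 1.
  have c00 : mm 0 = - M by rewrite /mm clampE ?lexx ?ler01//; ring.
  have c11 : clamp 1 = 1 :> R by rewrite clampE// lexx ler01.
  by have := corner_sign l_ge1 l_lt (clamp01 1) sol c0 hw hs M0 hM2 c00 c11; lra.
have [f [g [F [G [Q [sol hw hs hq]]]]]] := lims x0 y0.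
move: hs hq; rewrite ux vx subr0 addr0 => hs hq.
pose m := mm x0; pose th := clamp y0.
have th01 : 0 <= th <= 1 := clamp01 y0.
(* At [th = 1] the integral would be [2 * (n - l)], which exceeds [rho]. The exclusion matters
   because [P_tail] needs [th < 1]. *)
have th1 : th != 1.
  apply/eqP => e1; have := top_sign l_ge1 l_lt th01 sol c0 hw hs hq e1 erefl; lra.
have th0 : th != 0.
  by apply/eqP => e1; have := bottom_sign sol hs e1; lra.
have thlt : 0 < th < 1.
  by have /andP[a b] := th01; rewrite !lt_neqAle a b th1 eq_sym th0.
have th' : 0 <= th < 1 by have /andP[a b] := thlt; rewrite (ltW a) b.
have [KP [cP [cP0 hP]]] := P_tail th' sol.
have [[f0 g0 F0 G0 Q0] [df dg dF dG dQ] ef eg hneg] := sol.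
pose cc := Num.min c cP; have cc0 : 0 < cc by rewrite /cc lt_min c0 cP0.
have KP0 : 0 <= KP.
  have := hP 0 (lexx 0); rewrite mulr0 expR0 mulr1; apply: le_trans.
  exact: (P_ge0 m f g l_ge1 l_lt th01).
pose KK := K + KP.
have bigger (a b z : R) : 0 <= a -> a <= KK -> cc <= b -> 0 <= z ->
    a * expR (- b * z) <= KK * expR (- cc * z).
  move=> a0 aK cb z0; apply: ler_pM; rewrite ?expR_ge0// ler_expR !mulNr lerN2.
  by apply: ler_wpM2r.
have cc_c : cc <= c by rewrite /cc ge_min lexx.
have cc_cP : cc <= cP by rewrite /cc ge_min lexx orbT.
have tails z : 0 <= z ->
    [/\ Pdens n l m th (f z) (g z) <= KK * expR (- cc * z),
        wdens n l m th (f z) (g z) <= KK * expR (- cc * z) &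
        expR (f z) * wdens n l m th (f z) (g z) <= KK * expR (- cc * z)].
  move=> z0; have [h1 h2] := hw z z0; split.
  - by apply: le_trans (hP z z0) _; apply: bigger => //; rewrite /KK lerDr.
  - by apply: le_trans h1 _; apply: bigger => //; rewrite /KK lerDl.
  - by apply: le_trans h2 _; apply: bigger => //; rewrite /KK lerDl.
have [b hb] : exists b, forall z, 0 <= z -> `|G z - b| <= 2 * KK / cc * expR (- cc * z).
  apply: (exp_tail_limit cc0 dG) => z z0; have [h1 h2 h3] := tails z z0.
  rewrite -mulrA; exact: force_norm_le (P_ge0 m f g l_ge1 l_lt th01 z) (w_ge0 m f g l_ge1 l_lt th01 z) h1 h2.
have hG := exp_tail_cvg cc0 hb.
have hF : F z @[z --> +oo] --> - n - b.
  rewrite (_ : F = fun z => (F z + G z) - G z); last by apply/funext => z; rewrite addrK.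
  exact: cvgB.
have hP0 : Pdens n l m th (f z) (g z) @[z --> +oo] --> (0 : R).
  apply: (exp_tail_cvg (K := KP) cP0) => z z0.
  by rewrite subr0 ger0_norm ?hP//; exact: (P_ge0 m f g l_ge1 l_lt th01).
have eE := energy_at_infinity l_ge1 l_lt th01 sol c0 hw hF hG hP0.
have GF : b - (- n - b) <= 0.
  by apply: (cvgy_le (cvgB hG hF) (X := 0)) => z z0; exact: (GF_le0 l_ge1 l_lt th01 sol).
have bE : - b = n - l.
  apply: (roots_of_slopes l_ge1 l_lt (a := n + b)); [by ring| |lra].
  by rewrite -eE; ring.
exists m, th, f, g, F, G, Q; split => //.
  split => //; last by rewrite -bE opprK.
  by rewrite (_ : - l = - n - b)// bE; ring.
by exists KK, cc.
Qed.

End Existence.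

(** * Smooth functions on the half-line *)

Section HalfLine.
Variable R : realType.
Implicit Types (h : R -> R) (s t : R) (k m : nat).

Definition hcont h : Prop := forall t, 0 <= t -> forall e : R, 0 < e ->
  exists2 d : R, 0 < d & forall s, 0 <= s -> `|t - s| < d -> `|h t - h s| < e.

Fixpoint Cr k h : Prop :=
  hcont h /\ if k is k'.+1 then
    exists2 h' : R -> R, (forall t, 0 < t -> is_derive t 1 h (h' t)) & Cr k' h'
  else True.

Lemma Cr_hcont k h : Cr k h -> hcont h.
Proof. by case: k => [|k] []. Qed.

Lemma CrW k h : Cr k.+1 h -> Cr k h.
Proof.
elim: k h => [|k IH] h [ch [h' dh Ch']]; first by split.
by split => //; exists h' => //; exact: IH.
Qed.

Lemma hcont_continuous h : continuous h -> hcont h.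
Proof.
move=> ch t _ e e0; have /cvgrPdist_lt/(_ e e0) := ch t.
by case=> d /= d0 hd; exists d => // s _ ts; exact: hd.
Qed.

Lemma hcontD h1 h2 : hcont h1 -> hcont h2 -> hcont (fun t => h1 t + h2 t).
Proof.
move=> c1 c2 t t0 e e0; have e2 : 0 < e / 2 by lra.
have [d1 d10 h1d] := c1 t t0 _ e2; have [d2 d20 h2d] := c2 t t0 _ e2.
exists (Num.min d1 d2); first by rewrite lt_min d10.
move=> s s0; rewrite lt_min => /andP[/(h1d s s0) + /(h2d s s0)].
by rewrite !ltr_norml => /andP[? ?] /andP[? ?]; apply/andP; split; lra.
Qed.

Lemma hcontM h1 h2 : hcont h1 -> hcont h2 -> hcont (fun t => h1 t * h2 t).
Proof.
move=> c1 c2 t t0 e e0.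
pose B := `|h1 t| + `|h2 t| + 1.
have B0 : 0 < B by rewrite /B; have := normr_ge0 (h1 t); have := normr_ge0 (h2 t); lra.
pose e' := Num.min 1 (e / (2 * B)).
have e'0 : 0 < e' by rewrite /e' lt_min ltr01 divr_gt0// mulr_gt0.
have e'1 : e' <= 1 by rewrite /e' ge_min lexx.
have e'2 : e' * (2 * B) <= e by rewrite -ler_pdivlMr ?mulr_gt0// /e' ge_min lexx orbT.
have [d1 d10 h1d] := c1 t t0 _ e'0; have [d2 d20 h2d] := c2 t t0 _ e'0.
exists (Num.min d1 d2); first by rewrite lt_min d10.
move=> s s0; rewrite lt_min => /andP[/(h1d s s0) a /(h2d s s0) b].
have -> : h1 t * h2 t - h1 s * h2 s =
  (h1 t - h1 s) * h2 t + h1 t * (h2 t - h2 s) - (h1 t - h1 s) * (h2 t - h2 s) by ring.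
apply: (le_lt_trans (ler_normB _ _)); apply: (le_lt_trans (lerD (ler_normD _ _) (lexx _))).
rewrite !normrM; move: a b; rewrite /B in e'2 *.
set x := `|h1 t - h1 s|; set y := `|h2 t - h2 s|; move=> a b.
have x0 : 0 <= x by exact: normr_ge0.
have y0 : 0 <= y by exact: normr_ge0.
have := normr_ge0 (h1 t); have := normr_ge0 (h2 t).
rewrite /B in e'2; set p := `|h1 t| in e'2 *; set q := `|h2 t| in e'2 *; move=> q0 p0.
have a1 : x * q <= e' * q by rewrite ler_wpM2r// ltW.
have a2 : p * y <= p * e' by rewrite ler_wpM2l// ltW.
have a3 : x * y < e' * 1.
  apply: (@le_lt_trans _ _ (x * 1)); last by rewrite !mulr1.
  by rewrite ler_wpM2l// ltW//; lra.
nra.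
Qed.

Lemma hcont_comp (phi : R -> R) h : continuous phi -> hcont h -> hcont (fun t => phi (h t)).
Proof.
move=> cp ch t t0 e e0; have /cvgrPdist_lt/(_ e e0) := cp (h t).
case=> d /= d0 hd; have [d' d'0 hd'] := ch t t0 d d0.
by exists d' => // s s0 ts; apply: hd; exact: hd'.
Qed.

Lemma hcontB h1 h2 : hcont h1 -> hcont h2 -> hcont (fun t => h1 t - h2 t).
Proof. by move=> c1 c2; apply: hcontD => //; apply: (hcont_comp (phi := -%R)) => // x; exact: cvgN. Qed.

Lemma Cr_cst k (c : R) : Cr k (fun=> c).
Proof.
elim: k c => [|k IH] c; split => //; try by apply: hcont_continuous => t; exact: cvg_cst.
by exists (fun=> 0) => // t _; exact: is_drv_cst.
Qed.

Lemma Cr_id k : Cr k (fun t => t).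
Proof.
case: k => [|k]; split => //; try by apply: hcont_continuous => t; exact: cvg_id.
exists (fun=> 1); last exact: Cr_cst.
by move=> t _; exact: is_drv_id.
Qed.

Lemma CrD k h1 h2 : Cr k h1 -> Cr k h2 -> Cr k (fun t => h1 t + h2 t).
Proof.
elim: k h1 h2 => [|k IH] h1 h2 [c1 C1] [c2 C2]; split => //; try exact: hcontD.
have [h1' d1 C1'] := C1; have [h2' d2 C2'] := C2.
exists (fun t => h1' t + h2' t); last exact: IH.
by move=> t t0; exact: (is_drvD (d1 t t0) (d2 t t0)).
Qed.

Lemma CrM k h1 h2 : Cr k h1 -> Cr k h2 -> Cr k (fun t => h1 t * h2 t).
Proof.
elim: k h1 h2 => [|k IH] h1 h2 C1 C2; first by split; [exact: hcontM C1.1 C2.1|].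
have [c1 [h1' d1 C1']] := C1; have [c2 [h2' d2 C2']] := C2.
split; first exact: hcontM.
exists (fun t => h1' t * h2 t + h1 t * h2' t).
  by move=> t t0; exact: (is_drvM (d1 t t0) (d2 t t0)).
by apply: CrD; apply: IH => //; exact: CrW.
Qed.

Lemma CrZ k (c : R) h : Cr k h -> Cr k (fun t => c * h t).
Proof. by move=> Ch; apply: CrM Ch; exact: Cr_cst. Qed.

Lemma CrB k h1 h2 : Cr k h1 -> Cr k h2 -> Cr k (fun t => h1 t - h2 t).
Proof.
by move=> C1 C2; apply: CrD => //; under eq_fun do rewrite -mulN1r; exact: CrZ.
Qed.

Lemma CrX k m : Cr k (fun t => t ^+ m).
Proof.
elim: m => [|m IH]; first by under eq_fun do rewrite expr0; exact: Cr_cst.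
by under eq_fun do rewrite exprS; apply: CrM => //; exact: Cr_id.
Qed.

Lemma Cr_exp k h : Cr k h -> Cr k (fun t => expR (h t)).
Proof.
elim: k h => [|k IH] h Ch.
  by split => //; apply: hcont_comp (Cr_hcont Ch); exact: continuous_expR.
have [c1 [h' d1 C1']] := Ch.
split; first by apply: hcont_comp c1; exact: continuous_expR.
exists (fun t => h' t * expR (h t)); last by apply: CrM => //; apply: IH; exact: CrW.
by move=> t t0; exact: (is_drv_exp (d1 t t0)).
Qed.

(** When [Th] is the primitive of [t ^+ m * G] vanishing at 0, this is the integral of [r^m G(r t)]
    over [0 <= r <= 1], a weighted mean of [G]; hence the value at 0. *)
Definition avg m (Th G : R -> R) t : R :=
  if 0 < t then Th t / t ^+ m.+1 else G 0 / m.+1%:R.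

Lemma is_drv_pow m t : is_derive t 1 (fun s => s ^+ m.+1) (m.+1%:R * t ^+ m).
Proof.
elim: m => [|m IH].
  rewrite expr0 mulr1; rewrite (_ : (fun s => _) = fun s => s); last by apply/funext => s; rewrite expr1.
  exact: is_drv_id.
rewrite (_ : (fun s => _) = fun s => s * s ^+ m.+1); last by apply/funext => s; rewrite exprS.
apply: (is_drv_eq (is_drvM (is_drv_id t) IH)).
by rewrite -[m.+2%:R]natr1 !exprS; ring.
Qed.

Lemma is_drv_near h1 h2 t (a : R) : 0 < t -> (forall s, 0 < s -> h1 s = h2 s) ->
  is_derive t 1 h1 a -> is_derive t 1 h2 a.
Proof.
move=> t0 h12; apply: near_eq_is_derive; near=> s; apply: h12.
near: s; exact: lt_nbhsr.
Unshelve. all: by end_near. Qed.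

(* Cauchy's mean value theorem: [Th t / t ^ m.+1 = G s / m.+1] for some [s] in (0, t). *)
Lemma avg_hcont m (Th G : R -> R) : Th 0 = 0 -> hcont Th -> hcont G ->
  (forall t, 0 < t -> is_derive t 1 Th (t ^+ m * G t)) -> hcont (avg m Th G).
Proof.
move=> Th0 cT cG dT t; rewrite le_eqVlt => /predU1P[<-|t0] e e0; last first.
  have tm : t ^+ m.+1 != 0 by rewrite expf_neq0// gt_eqF.
  have ca : {for t, continuous (fun s => Th s / s ^+ m.+1)}.
    apply: cvgM; first exact: is_drv_continuous (dT t t0).
    apply: cvgV => //; exact: is_drv_continuous (is_drv_pow m t).
  have /cvgrPdist_lt/(_ e e0)[d /= d0 hd] := ca.
  exists (Num.min d t); first by rewrite lt_min d0.
  move=> s s0; rewrite lt_min => /andP[sd st].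
  have spos : 0 < s by move: st; rewrite ltr_norml => /andP[]; lra.
  by rewrite /avg t0 spos; exact: hd.
have m0 : 0 < m.+1%:R :> R by rewrite ltr0n.
have [d d0 hd] := cG 0 (lexx 0) e e0.
exists d => // s s0; rewrite sub0r normrN ger0_norm// => sd; rewrite /avg ltxx.
move: s0; rewrite le_eqVlt => /predU1P[<-|s0]; first by rewrite ltxx subrr normr0.
rewrite s0.
pose phi x := Th x * s ^+ m.+1 - Th s * x ^+ m.+1.
have dphi (x : R) : 0 < x -> is_derive x 1 phi (x ^+ m * G x * s ^+ m.+1 - Th s * (m.+1%:R * x ^+ m)).
  move=> x0; have h := is_drvB (is_drvM (dT x x0) (is_drv_cst (s ^+ m.+1) x)) (is_drvZ (Th s) (is_drv_pow m x)).
  by apply: (is_drv_eq h); rewrite mulr0 addr0.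
have cphi : {within `[0, s], continuous phi}.
  apply/continuous_within_itvP => //; split.
  - move=> x; rewrite in_itv /= => /andP[x0 _]; exact: is_drv_continuous (dphi x x0).
  - have cp : hcont phi.
      by apply: hcontB; apply: hcontM => //; try exact: Cr_hcont (Cr_cst 0 _); exact: Cr_hcont (CrX 0 m.+1).
    apply/cvgrPdist_lt => e1 e10; have [d1 d10 hd1] := cp 0 (lexx 0) e1 e10.
    near=> x; apply: hd1; first by near: x; exact: nbhs_right_ge.
    by rewrite sub0r normrN gtr0_norm; near: x; [exact: nbhs_right_lt|exact: nbhs_right_gt].
  - apply: cvg_at_left_filter; exact: is_drv_continuous (dphi s s0).
have [|c cs] := @MVT R phi (fun x => x ^+ m * G x * s ^+ m.+1 - Th s * (m.+1%:R * x ^+ m)) 0 s s0 _ cphi.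
  by move=> x; rewrite in_itv /= => /andP[x0 _]; exact: dphi.
move: cs; rewrite in_itv /= => /andP[c0 cs].
have -> : phi s - phi 0 = 0 by rewrite /phi Th0 expr0n /=; ring.
rewrite subr0 mulrC => /esym/eqP.
rewrite mulf_eq0 (gt_eqF s0) /= subr_eq0 => /eqP h.
have eTh : Th s / s ^+ m.+1 = G c / m.+1%:R.
  have cm : c ^+ m != 0 by rewrite expf_neq0// gt_eqF.
  have sm : s ^+ m.+1 != 0 by rewrite expf_neq0// gt_eqF.
  apply: (mulfI cm); apply: (mulIf sm); apply: (mulIf (lt0r_neq0 m0)).
  rewrite [LHS](_ : _ = Th s * (m.+1%:R * c ^+ m)); last by field.
  by rewrite -h; field; rewrite lt0r_neq0.
rewrite eTh -mulrBl normrM [`|_^-1|]ger0_norm ?invr_ge0 ?ler0n//.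
apply: (@le_lt_trans _ _ `|G 0 - G c|).
  by rewrite ler_piMr// invf_le1// ler1n.
by apply: hd; [exact: ltW|rewrite sub0r normrN gtr0_norm//; exact: lt_trans cs sd].
Unshelve. all: by end_near. Qed.

(** The derivative of such a mean is again one, with [m.+1] and [G'] in place of [m] and [G]:
    integrating by parts, [Th1] is the primitive of [t ^+ m.+1 * G']. The singularity at [t = 0] is
    thus only apparent, at every order. *)
Lemma Cr_avg k m (Th G : R -> R) : Th 0 = 0 -> hcont Th ->
  (forall t, 0 < t -> is_derive t 1 Th (t ^+ m * G t)) -> Cr k G -> Cr k (avg m Th G).
Proof.
elim: k m Th G => [|k IH] m Th G Th0 cT dT CG.
  by split => //; apply: avg_hcont => //; exact: Cr_hcont CG.
split; first by apply: avg_hcont => //; exact: Cr_hcont CG.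
have [cG [G' dG CG']] := CG.
pose Th1 t := t ^+ m.+1 * G t - m.+1%:R * Th t.
exists (avg m.+1 Th1 G').
  move=> t t0; have tm : t != 0 by rewrite gt_eqF.
  apply: (@is_drv_near (fun s => Th s * (s ^+ m.+1)^-1)) => //.
    by move=> s s0; rewrite /avg s0.
  have dV : is_derive t 1 (fun s => (s ^+ m.+1)^-1) (- (m.+1%:R * t ^+ m) / (t ^+ m.+1) ^+ 2).
    have h := @is_deriveV R (fun s => s ^+ m.+1) t _ 1 (expf_neq0 _ tm) (is_drv_pow m t).
    by apply: (is_drv_eq h); rewrite /GRing.scale /= mulrC mulNr mulrN.
  apply: (is_drv_eq (is_drvM (dT t t0) dV)).
  rewrite /avg t0 /Th1 !exprS; field.
  by rewrite expf_neq0// tm.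
apply: IH => //.
- by rewrite /Th1 Th0 mulr0 subr0 expr0n /= mul0r.
- apply: hcontB; first by apply: hcontM => //; exact: Cr_hcont (CrX 0 m.+1).
  by apply: hcontM => //; exact: Cr_hcont (Cr_cst 0 _).
- move=> t t0; apply: (is_drv_eq (is_drvB (is_drvM (is_drv_pow m t) (dG t t0)) (is_drvZ m.+1%:R (dT t t0)))).
  by ring.
Qed.

(** A function of [x = ln t] read in the coordinate [t]; [a] is meant to be its limit at
    [x = - oo]. *)
Definition lnext (a : R) (phi : R -> R) t : R := if 0 < t then phi (ln t) else a.

Lemma lnext_drv (a : R) (phi : R -> R) t (b : R) : 0 < t -> is_derive (ln t) 1 phi b ->
  is_derive t 1 (lnext a phi) (b / t).
Proof.
move=> t0 dp; apply: (@is_drv_near (fun s => phi (ln s))) => //.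
  by move=> s s0; rewrite /lnext s0.
exact: (is_drv_comp (is_derive1_ln t0) dp).
Qed.

Lemma lnext_hcont (a : R) (phi : R -> R) : continuous phi ->
  phi (- x) @[x --> +oo] --> a -> hcont (lnext a phi).
Proof.
move=> cp lim t; rewrite le_eqVlt => /predU1P[<-|t0] e e0.
  move/cvgrPdist_lt: lim => /(_ e e0)[X [_ hX]].
  exists (expR (- X)); first exact: expR_gt0.
  move=> s s0; rewrite sub0r normrN ger0_norm// => sX; rewrite /lnext ltxx.
  case: (ltP 0 s) => [sp|_]; last by rewrite subrr normr0.
  have := hX (- ln s); rewrite opprK; apply.
  by rewrite ltrNr -[ltRHS]expRK ltr_ln ?posrE ?expR_gt0.
have cl : {for t, continuous (fun s => phi (ln s))}.
  exact: (@continuous_comp R R R (@ln R) phi t (continuous_ln t0) (cp _)).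
have /cvgrPdist_lt/(_ e e0)[d /= d0 hd] := cl.
exists (Num.min d t); first by rewrite lt_min d0.
move=> s s0; rewrite lt_min => /andP[sd st].
have spos : 0 < s by move: st; rewrite ltr_norml => /andP[]; lra.
by rewrite /lnext t0 spos; exact: hd.
Qed.

End HalfLine.

Section Smooth.
Variable R : realType.
Implicit Types (h G : R -> R) (s t : R).

Definition sm h : Prop := forall k, Cr k h.

Lemma smD h1 h2 : sm h1 -> sm h2 -> sm (fun t => h1 t + h2 t).
Proof. by move=> a b k; exact: CrD. Qed.

Lemma smB h1 h2 : sm h1 -> sm h2 -> sm (fun t => h1 t - h2 t).
Proof. by move=> a b k; exact: CrB. Qed.

Lemma smM h1 h2 : sm h1 -> sm h2 -> sm (fun t => h1 t * h2 t).
Proof. by move=> a b k; exact: CrM. Qed.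

Lemma smZ (c : R) h : sm h -> sm (fun t => c * h t).
Proof. by move=> a k; exact: CrZ. Qed.

Lemma sm_cst (c : R) : sm (fun=> c).
Proof. by move=> k; exact: Cr_cst. Qed.

Lemma smX m : sm (fun t => t ^+ m).
Proof. by move=> k; exact: CrX. Qed.

Lemma sm_exp h : sm h -> sm (fun t => expR (h t)).
Proof. by move=> a k; exact: Cr_exp. Qed.

Lemma hcont_eq0 h1 h2 : hcont h1 -> hcont h2 -> (forall t, 0 < t -> h1 t = h2 t) ->
  forall t, 0 <= t -> h1 t = h2 t.
Proof.
move=> c1 c2 h12 t; rewrite le_eqVlt => /predU1P[<-|/h12//].
apply/eqP; rewrite -subr_eq0 -normr_eq0; apply/negPn/negP => n0.
have e0 : 0 < `|h1 0 - h2 0| / 2 by rewrite divr_gt0// lt_neqAle eq_sym n0 normr_ge0.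
have [d1 d10 h1d] := c1 0 (lexx 0) _ e0; have [d2 d20 h2d] := c2 0 (lexx 0) _ e0.
pose s := Num.min d1 d2 / 2.
have m0 : 0 < Num.min d1 d2 by rewrite lt_min d10.
have s0 : 0 < s by rewrite /s divr_gt0.
have sm : s < Num.min d1 d2 by rewrite /s; lra.
have := sm; rewrite lt_min => /andP[sd1 sd2].
have := h1d s (ltW s0); rewrite sub0r normrN gtr0_norm// => /(_ sd1).
have := h2d s (ltW s0); rewrite sub0r normrN gtr0_norm// => /(_ sd2).
rewrite (h12 s s0) => a b.
have : `|h1 0 - h2 0| <= `|h1 0 - h2 s| + `|h2 0 - h2 s|.
  by rewrite [`|h2 0 - _|]distrC; exact: ler_distD.
lra.
Qed.

Lemma is_drv_unique h t (a b : R) : is_derive t 1 h a -> is_derive t 1 h b -> a = b.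
Proof. by move=> [_ <-] [_ <-]. Qed.

Lemma hcont_ext h1 h2 : (forall t, 0 <= t -> h1 t = h2 t) -> hcont h1 -> hcont h2.
Proof.
move=> e c t t0 x x0; have [d d0 hd] := c t t0 x x0.
by exists d => // s s0 ts; rewrite -!e//; exact: hd.
Qed.

Lemma Cr_ext k h1 h2 : (forall t, 0 <= t -> h1 t = h2 t) -> Cr k h1 -> Cr k h2.
Proof.
case: k => [|k] e [c1 C1]; split => //; try exact: hcont_ext c1.
have [h' dh Ch'] := C1; exists h' => // t t0.
by apply: (is_drv_near t0 _ (dh t t0)) => s s0; apply: e; exact: ltW.
Qed.

(** Each order of regularity comes with its own choice of derivative. The choices agree for [0 < t]
    by uniqueness and at 0 by continuity, so one function serves for all orders. *)
Lemma sm_derivative h : sm h ->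
  exists2 h' : R -> R, (forall t, 0 < t -> is_derive t 1 h (h' t)) & sm h'.
Proof.
move=> sh; have [_ [h' dh Ch']] := sh 1%N.
exists h' => // k; have [_ [h'' dh' Ch'']] := sh k.+1.
apply: (Cr_ext _ Ch''); apply: hcont_eq0; [exact: (@Cr_hcont _ k _ Ch'')|exact: (@Cr_hcont _ 0%N _ Ch')|].
by move=> t t0; exact: is_drv_unique (dh' t t0) (dh t t0).
Qed.

(* [h' + t h''] is the flat Laplacian d/dz d/dzbar of [z |-> h (|z|^2)]. *)
Definition radial_lap h G : Prop := exists h1 h2 : R -> R,
  [/\ forall t, 0 < t -> is_derive t 1 h (h1 t),
      forall t, 0 < t -> is_derive t 1 h1 (h2 t), sm h, sm h1 & sm h2] /\
  forall t, 0 <= t -> h1 t + t * h2 t = G t.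

Lemma radial_lap_ex h : sm h -> exists G, radial_lap h G.
Proof.
move=> sh; have [h1 d1 s1] := sm_derivative sh; have [h2 d2 s2] := sm_derivative s1.
by exists (fun t => h1 t + t * h2 t), h1, h2.
Qed.

Lemma radial_lapD h1 G1 h2 G2 : radial_lap h1 G1 -> radial_lap h2 G2 ->
  radial_lap (fun t => h1 t + h2 t) (fun t => G1 t + G2 t).
Proof.
move=> [a1 [a2 [[da1 da2 sa sa1 sa2] ea]]] [b1 [b2 [[db1 db2 sb sb1 sb2] eb]]].
exists (fun t => a1 t + b1 t), (fun t => a2 t + b2 t); split; first split.
- by move=> t t0; exact: (is_drvD (da1 t t0) (db1 t t0)).
- by move=> t t0; exact: (is_drvD (da2 t t0) (db2 t t0)).
- exact: smD.
- exact: smD.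
- exact: smD.
- by move=> t t0; rewrite -ea// -eb//; ring.
Qed.

Lemma radial_lapZ (c : R) h G : radial_lap h G -> radial_lap (fun t => c * h t) (fun t => c * G t).
Proof.
move=> [a1 [a2 [[da1 da2 sa sa1 sa2] ea]]].
exists (fun t => c * a1 t), (fun t => c * a2 t); split; first split.
- by move=> t t0; exact: (is_drvZ c (da1 t t0)).
- by move=> t t0; exact: (is_drvZ c (da2 t t0)).
- exact: smZ.
- exact: smZ.
- exact: smZ.
- by move=> t t0; rewrite -ea//; ring.
Qed.

Lemma radial_lap_cst (c : R) : radial_lap (fun=> c) (fun=> 0).
Proof.
exists (fun=> 0), (fun=> 0); split; first split.
- by move=> t t0; exact: is_drv_cst.
- by move=> t t0; exact: is_drv_cst.
- exact: sm_cst.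
- exact: sm_cst.
- exact: sm_cst.
- by move=> t t0; rewrite mulr0 addr0.
Qed.

(** Here [Th = t h'], so that [Th' = h' + t h'']; continuity carries the identity to [t = 0]. *)
Lemma radial_lap_intro h Th G : sm h -> sm G ->
  (forall t, 0 < t -> is_derive t 1 h (Th t / t)) ->
  (forall t, 0 < t -> is_derive t 1 Th (G t)) -> radial_lap h G.
Proof.
move=> sh sG dh dTh; have [h1 d1 s1] := sm_derivative sh; have [h2 d2 s2] := sm_derivative s1.
exists h1, h2; split=> //; apply: hcont_eq0; [|exact: Cr_hcont (sG 0%N)|].
  by have s : sm (fun t => h1 t + t * h2 t); [apply: smD => //; apply: smM => // k; exact: Cr_id|exact: Cr_hcont (s 0%N)].
move=> t t0; apply: (@is_drv_unique (fun s => s * h1 s) t).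
  by apply: (is_drv_eq (is_drvM (is_drv_id t) (d2 t t0))); rewrite mul1r.
apply: (is_drv_near t0 _ (dTh t t0)) => s s0.
rewrite (is_drv_unique (d1 s s0) (dh s s0)).
by rewrite mulrC divfK// gt_eqF.
Qed.

End Smooth.

Section LogProfile.
Variable R : realType.
Implicit Types (h H : R -> R) (x t : R).

(* In the variable [t = exp x], an even solution [h x] of slope [- a] at infinity
   minus [a x] extends continuously to [t = 0], i.e. [x = -oo]. *)
Lemma log_profile h H (H' : R -> R) (a C d z : R) : 0 < d ->
  (forall x, is_derive x 1 h (H x)) -> (forall x, is_derive x 1 H (H' x)) ->
  (forall x, h (- x) = h x) -> (forall x, H (- x) = - H x) ->
  (forall x, 0 <= x -> `|H' x| <= C * expR (- d * x)) -> H x @[x --> +oo] --> - a ->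
  exists b : R, let w t := lnext b (fun x => h x - a * x) t + z in
    let Th := lnext 0 (fun x => H x - a) in
    [/\ hcont w, hcont Th, Th 0 = 0 & forall t, 0 < t -> is_derive t 1 w (Th t / t)].
Proof.
move=> d0 dh dH eh oH tH hH.
have [a' ha'] := exp_tail_limit d0 dH tH.
have tail x : 0 <= x -> `|H x + a| <= C / d * expR (- d * x).
  by rewrite -[a]opprK (cvgy_unique hH (exp_tail_cvg d0 ha')); exact: ha'.
have dha (x : R) : is_derive x 1 (fun y => h y + a * y) (H x + a).
  by apply: (is_drv_eq (is_drvD (dh x) (is_drvZ a (is_drv_id x)))); rewrite mulr1.
have [b hb] := exp_tail_limit d0 dha tail.
exists b; split.
- apply: hcontD; last exact: Cr_hcont (Cr_cst 0 z).
  apply: lnext_hcont; first exact: drv_continuous (fun x => is_drvB (dh x) (is_drvZ a (is_drv_id x))).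
  by under eq_fun do rewrite eh mulrN opprK; exact: exp_tail_cvg d0 hb.
- apply: lnext_hcont; first exact: drv_continuous (fun x => is_drvB (dH x) (is_drv_cst a x)).
  under eq_fun do rewrite oH; rewrite -(subrr a).
  by apply: cvgB; [rewrite -[X in _ --> X]opprK; exact: cvgN|exact: cvg_cst].
- by rewrite /lnext ltxx.
- move=> t t0; have hd := is_drvB (dh (ln t)) (is_drvZ a (is_drv_id (ln t))).
  apply: (is_drv_eq (is_drvD (lnext_drv b t0 hd) (is_drv_cst z t))).
  by rewrite /lnext t0 mulr1 addr0.
Qed.

End LogProfile.

(** * The profiles in the variable [t] *)

Section Profiles.
Variables (R : realType) (l k : nat) (tau rho : R).
Hypothesis l_gt0 : (0 < l)%N.
Hypothesis k_gt0 : (0 < k)%N.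
Hypothesis tau_gt0 : 0 < tau.
Let N := (l + l + k)%N.
Hypothesis rho_lo : N%:R < rho.
Hypothesis rho_hi : rho < 2 * (l + k)%N%:R.
Implicit Types s t : R.

(** The dictionary is [u = f - l x + ln tau] and [v = g - (n - l) x + ln Qc]; it gives
    [t ^+ l * expR (u t) = tau * expR (f x)], [qp t = P x / t] and [tau * om t = w x / t]. The
    inversion laws for [u] and [v] express the evenness of [f] and [g]. *)
Lemma profiles : exists (c c0 : R) (u v nu Mv : R -> R),
  let om t := expR (c0 + (u t + v t) / N%:R - t ^+ l * expR (u t) / (N%:R * tau)) in
  let qp t := c ^+ 2 * t ^+ k.-1 * expR (v t - u t) in
  let nn t := t ^+ k * nu t in
  [/\ radial_lap u (fun t => qp t + (t ^+ l * expR (u t) - tau) / 2 * om t),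
      radial_lap v (fun t => - qp t - tau / 2 * om t),
      sm nu /\ (forall t, 0 < t -> is_derive t 1 nn (c * t ^+ k.-1 * expR (v t - u t))),
      forall t, 0 < t -> [/\ u t^-1 = u t + (2 * l)%N%:R * ln t,
         v t^-1 = v t + (2 * (l + k))%N%:R * ln t & nn t^-1 = 1 - nn t] &
      [/\ hcont Mv, Mv 0 = 0, forall t, 0 < t -> is_derive t 1 Mv (om t) &
          Mv t @[t --> +oo] --> 2 * rho / tau]].
Proof.
pose n : R := N%:R; pose lr : R := l%:R.
have nE : n = 2 * lr + k%:R by rewrite /n /N /lr !natrD; ring.
have l_ge1 : 1 <= lr by rewrite ler1n.
have k_ge1 : 1 <= k%:R :> R by rewrite ler1n.
have l_lt : 2 * lr + 1 <= n by rewrite nE lerD2l.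
have n0 : 0 < n by lra.
have nl : n - lr = (l + k)%N%:R by rewrite nE natrD -/lr; ring.
have hrho : rho < 2 * (n - lr) by rewrite nl.
have [m [th [f [g [F [G [Q [th01 sol [hF hG hQ] [K [d [d0 htail]]]]]]]]]]] :=
  radial_solution l_ge1 l_lt rho_lo hrho.
have th01' : 0 <= th <= 1 by case/andP: th01 => a b; rewrite !ltW.
have [[f0 g0 F0 G0 Q0] [df dg dF dG dQ] ef eg hneg] := sol.
have Fodd := F_odd sol; have Godd := G_odd sol; have Qodd := Q_odd sol.
pose P x := Pdens n lr m th (f x) (g x); pose w x := wdens n lr m th (f x) (g x).
have P0 x : 0 <= P x := P_ge0 m f g l_ge1 l_lt th01' x.
have w0 x : 0 <= w x := w_ge0 m f g l_ge1 l_lt th01' x.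
have Yw0 x : 0 <= expR (f x) * w x by rewrite mulr_ge0// expR_ge0.
have E0 := energy_gt0 l_ge1 l_lt.
(* The integral of [P] over the whole line: from [G' = - P - w / 2], each half-line carries
   [(n - l) - rho / 2]. It is the witness for [c], and it is positive by the upper bound on
   [rho]. *)
pose Pi := 2 * (n - lr) - rho.
have Pi0 : 0 < Pi by rewrite /Pi; lra.
pose a := energy n lr * (1 - th) * expR m.
have a0 : 0 < a.
  case/andP: th01 => _ h; have h' : 0 < 1 - th by rewrite subr_gt0.
  exact: (mulr_gt0 (mulr_gt0 E0 h') (expR_gt0 _)).
pose b := wamp n lr m th.
have b0 : 0 < b.
  case/andP: th01 => h _; have h2 : 0 < 2 * energy n lr by rewrite mulr_gt0.
  exact: (mulr_gt0 (mulr_gt0 (divr_gt0 h2 n0) h) (expR_gt0 _)).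
(* The value for which [qp t = P (ln t) / t], given that [c = Pi]. *)
pose Qc := tau * a / Pi ^+ 2.
have Qc0 : 0 < Qc by apply: divr_gt0; [exact: mulr_gt0|exact: exprn_gt0].
have dFle (x : R) : 0 <= x -> `|P x + (expR (f x) - 1) / 2 * w x| <= 2 * K * expR (- d * x).
  move=> x0; have [h1 h2 h3] := htail x x0; have := P0 x; have := w0 x; have := Yw0 x.
  by rewrite /P /w ler_norml => *; apply/andP; split; lra.
have dGle (x : R) : 0 <= x -> `|- P x - w x / 2| <= 2 * K * expR (- d * x).
  by move=> x0; have [h1 h2 _] := htail x x0; rewrite -mulrA; exact: force_norm_le.
have [u0] := log_profile (ln tau) d0 df dF ef Fodd dFle hF.
set u := fun t => _; set ThU := lnext 0 _ => -[hu hThU ThU0 du].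
have [v0] := log_profile (ln Qc) d0 dg dG eg Godd dGle hG.
set v := fun t => _; set ThV := lnext 0 _ => -[hv hThV ThV0 dv].
(* The value for which [tau * om t = w (ln t) / t]; the last term compensates the constants added to
   [f] and [g]. *)
pose c0 := ln b - ln tau - (ln tau + ln Qc) / n.
pose om t := expR (c0 + (u t + v t) / n - t ^+ l * expR (u t) / (n * tau)).
pose qp t := Pi ^+ 2 * t ^+ k.-1 * expR (v t - u t).
pose GU t := qp t + (t ^+ l * expR (u t) - tau) / 2 * om t.
pose GV t := - qp t - tau / 2 * om t.
have expln (z : R) j : 0 < z -> expR (j%:R * ln z) = z ^+ j by move=> z0; rewrite expRM_natl lnK.
have eu t : 0 < t -> t ^+ l * expR (u t) = tau * expR (f (ln t)).
  move=> t0; rewrite /u /lnext t0 expRD expRB expln// lnK ?posrE//.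
  by field; rewrite expf_neq0// gt_eqF.
have eP t : 0 < t -> qp t = P (ln t) / t.
  move=> t0; rewrite /qp /u /v /lnext t0 /P /Pdens.
  have -> : g (ln t) - (n - lr) * ln t + ln Qc - (f (ln t) - lr * ln t + ln tau) =
     (g (ln t) - (f (ln t) - m)) + (- m) + ln Qc - ln tau - k%:R * ln t by rewrite nE; ring.
  rewrite expRB expln// expRB expRD lnK ?posrE// lnK ?posrE// expRD expRN.
  have -> : t ^+ k = t * t ^+ k.-1 by rewrite -exprS prednK.
  rewrite /Qc /a; field.
  by rewrite !gt_eqF ?expR_gt0 ?exprn_gt0.
have ew t : 0 < t -> tau * om t = w (ln t) / t.
  move=> t0; rewrite /om eu// /w /wdens -/b /kap.
  have -> : c0 + (u t + v t) / n - tau * expR (f (ln t)) / (n * tau) =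
    ln b - ln tau + (f (ln t) - expR (f (ln t))) / n + g (ln t) / n - ln t.
    by rewrite /c0 /u /v /lnext t0; field; rewrite !gt_eqF.
  rewrite !expRD !expRN !lnK ?posrE//.
  by field; rewrite !gt_eqF.
have dThU t : 0 < t -> is_derive t 1 ThU (GU t).
  move=> t0; apply: (is_drv_eq (lnext_drv 0 t0 (is_drvB (dF (ln t)) (is_drv_cst lr _)))).
  rewrite /GU eP// eu// (_ : _ / 2 * om t = (expR (f (ln t)) - 1) / 2 * (tau * om t)); last by ring.
  by rewrite ew// -/(P _) -/(w _); field; rewrite gt_eqF.
have dThV t : 0 < t -> is_derive t 1 ThV (GV t).
  move=> t0; apply: (is_drv_eq (lnext_drv 0 t0 (is_drvB (dG (ln t)) (is_drv_cst (n - lr) _)))).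
  rewrite /GV eP// (_ : tau / 2 * om t = (tau * om t) / 2); last by ring.
  by rewrite ew// -/(P _) -/(w _); field; rewrite gt_eqF.
have Com j : Cr j u -> Cr j v -> Cr j om.
  move=> cu cv; apply: Cr_exp; apply: CrB; first apply: CrD.
  - exact: Cr_cst.
  - by apply: CrM; [exact: CrD|exact: Cr_cst].
  - by apply: CrM; [apply: CrM; [exact: CrX|exact: Cr_exp]|exact: Cr_cst].
have Cvu j : Cr j u -> Cr j v -> Cr j (fun t => expR (v t - u t)).
  by move=> cu cv; apply: Cr_exp; exact: CrB.
have Cqp j : Cr j u -> Cr j v -> Cr j qp.
  by move=> cu cv; apply: CrM; [apply: CrZ; exact: CrX|exact: Cvu].
have CGU j : Cr j u -> Cr j v -> Cr j GU.
  move=> cu cv; apply: CrD; first exact: Cqp.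
  apply: CrM; last exact: Com.
  apply: CrM; last exact: Cr_cst.
  by apply: CrD; [apply: CrM; [exact: CrX|exact: Cr_exp]|exact: Cr_cst].
have CGV j : Cr j u -> Cr j v -> Cr j GV.
  move=> cu cv; apply: CrB; last by apply: CrZ; exact: Com.
  by under eq_fun do rewrite -mulN1r; apply: CrZ; exact: Cqp.
(* Bootstrap: [GU] and [GV] are as regular as [u] and [v], while [u'] and [v'] are means of them, so
   that each round gains one derivative. *)
have Cuv j : Cr j u /\ Cr j v.
  elim: j => [|j [cu cv]]; first by split; split.
  split; split => //.
    exists (avg 0 ThU GU); last first.
      apply: Cr_avg => //; last exact: CGU.
      by move=> t t0; rewrite expr0 mul1r; exact: dThU.
    by move=> t t0; rewrite /avg t0 expr1; exact: du.
  exists (avg 0 ThV GV); last first.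
    apply: Cr_avg => //; last exact: CGV.
    by move=> t t0; rewrite expr0 mul1r; exact: dThV.
  by move=> t t0; rewrite /avg t0 expr1; exact: dv.
have su : sm u by move=> j; case: (Cuv j).
have sv : sm v by move=> j; case: (Cuv j).
(* The primitive of [P / Pi] that rises from 0 at [- oo] to 1 at [+ oo]. It differs from 1/2 by an
   odd function, whence [nn t^-1 = 1 - nn t]. *)
pose nx x := 2^-1 + Pi^-1 * (- G x - Q x / 2).
pose nn0 := lnext 0 nx.
pose rhs t := Pi * expR (v t - u t).
have srhs : sm rhs by move=> j; apply: CrZ; exact: Cvu.
have dnx (x : R) : is_derive x 1 nx (Pi^-1 * P x).
  have h := is_drvD (is_drv_cst 2^-1 x) (is_drvZ Pi^-1
    (is_drvB (is_drvN (dG x)) (is_drvM (dQ x) (is_drv_cst 2^-1 x)))).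
  by apply: (is_drv_eq h); rewrite -/(P x) -/(w x); ring.
have dnn0 t : 0 < t -> is_derive t 1 nn0 (t ^+ k.-1 * rhs t).
  move=> t0; apply: (is_drv_eq (lnext_drv 0 t0 (dnx (ln t)))).
  rewrite -mulrA -eP// /qp /rhs; field; exact: lt0r_neq0.
have hnn0 : hcont nn0.
  apply: lnext_hcont; first exact: drv_continuous dnx.
  rewrite (_ : (fun x => nx (- x)) = fun x => 2^-1 + Pi^-1 * (G x + Q x * 2^-1)); last first.
    by apply/funext => x; rewrite /nx Godd Qodd; ring.
  rewrite (_ : 0 = 2^-1 + Pi^-1 * (- (n - lr) + rho * 2^-1)).
    apply: cvgD; first exact: cvg_cst.
    by apply: cvgMl_tmp; apply: cvgD => //; exact: cvgMr_tmp.
  by have := Pi0; rewrite /Pi => h; field; exact: lt0r_neq0.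
pose nu := avg k.-1 nn0 rhs.
have nn00 : nn0 0 = 0 by rewrite /nn0 /lnext ltxx.
have enn t : 0 < t -> t ^+ k * nu t = nn0 t.
  move=> t0; rewrite /nu /avg t0 prednK// mulrC divfK//.
  by rewrite expf_neq0// gt_eqF.
exists Pi, c0, u, v, nu, (lnext 0 (fun x => tau^-1 * (Q x + rho))) => /=; split.
- by apply: (radial_lap_intro (Th := ThU)) => // j; exact: CGU.
- by apply: (radial_lap_intro (Th := ThV)) => // j; exact: CGV.
- split; first by move=> j; apply: Cr_avg.
  move=> t t0; apply: (is_drv_near t0 (h1 := nn0)); first by move=> s s0; rewrite enn.
  by apply: (is_drv_eq (dnn0 t t0)); rewrite /rhs; ring.
- move=> t t0; have ti : 0 < t^-1 by rewrite invr_gt0.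
  have lni : ln t^-1 = - ln t by rewrite lnV.
  rewrite /u /v !enn// /nn0 /lnext t0 ti lni ef eg; split.
  + by rewrite natrM -/lr; ring.
  + by rewrite natrM -nl; ring.
  + by rewrite /nx Godd Qodd; field; exact: lt0r_neq0.
- split.
  + apply: lnext_hcont; first exact: drv_continuous (fun x => is_drvZ tau^-1 (is_drvD (dQ x) (is_drv_cst rho x))).
    rewrite (_ : (fun x => _) = fun x => tau^-1 * (- Q x + rho)); last by apply/funext => x; rewrite Qodd.
    rewrite -(mulr0 tau^-1); apply: cvgMl_tmp; rewrite -(addNr rho).
    by apply: cvgD; [exact: cvgN|exact: cvg_cst].
  + by rewrite /lnext ltxx.
  + move=> t t0; apply: (is_drv_eq (lnext_drv 0 t0 (is_drvZ tau^-1 (is_drvD (dQ (ln t)) (is_drv_cst rho _))))).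
    rewrite addr0 -mulrA -/(w _) -ew// mulrA mulVf ?mul1r// gt_eqF//.
  + apply/cvgrPdist_lt => e e0.
    have h : tau^-1 * (Q x + rho) @[x --> +oo] --> 2 * rho / tau.
      rewrite (_ : 2 * rho / tau = tau^-1 * (rho + rho)); last by ring.
      by apply: cvgMl_tmp; apply: cvgD; [exact: hQ|exact: cvg_cst].
    have /cvgrPdist_lt/(_ e e0)[X [_ hX]] := h.
    near=> t; have t0 : 0 < t by near: t; apply: nbhs_pinfty_gt; exact: num_real.
    rewrite /lnext t0; apply: hX; rewrite -[ltLHS]expRK ltr_ln ?posrE ?expR_gt0//.
Unshelve. all: by end_near. Qed.

End Profiles.

(** * Calculus on the plane *)

Section PlaneCalculus.
Variable R : realType.
Implicit Types (p : R * R) (f g : R * R -> R) (h : R -> R) (t x y : R).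
Local Notation e1 := ((1, 0) : R * R).
Local Notation e2 := ((0, 1) : R * R).

Lemma is_derive_dx f p a : is_derive p.1 1 (fun x => f (x, p.2)) a -> is_derive p e1 f a.
Proof.
case: p => x y /= [ex ev].
have E : (fun k : R => k^-1 *: ((f \o shift (x, y)) (k *: e1) - f (x, y))) =
         (fun k : R => k^-1 *: (((fun z => f (z, y)) \o shift x) (k *: (1 : R)) - f (x, y))).
  by apply/funext => k /=; congr (_ *: (f _ - _)); congr (_, _); rewrite /= /GRing.scale /= ?mulr0 ?add0r.
split; first by rewrite /derivable E.
by rewrite /derive E.
Qed.

Lemma is_derive_dy f p a : is_derive p.2 1 (fun y => f (p.1, y)) a -> is_derive p e2 f a.
Proof.
case: p => x y /= [ex ev].
have E : (fun k : R => k^-1 *: ((f \o shift (x, y)) (k *: e2) - f (x, y))) =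
         (fun k : R => k^-1 *: (((fun z => f (x, z)) \o shift y) (k *: (1 : R)) - f (x, y))).
  by apply/funext => k /=; congr (_ *: (f _ - _)); congr (_, _); rewrite /= /GRing.scale /= ?mulr0 ?add0r.
split; first by rewrite /derivable E.
by rewrite /derive E.
Qed.

Lemma is_pdrvM (v : R * R) f g p a b : is_derive p v f a -> is_derive p v g b ->
  is_derive p v (fun q => f q * g q) (a * g p + f p * b).
Proof.
move=> hf hg; have h := @is_deriveM R (R * R)%type f g p v a b hf hg.
by apply: (is_derive_eq h); rewrite /GRing.scale /=; ring.
Qed.

Lemma is_pdrvD (v : R * R) f g p a b : is_derive p v f a -> is_derive p v g b ->
  is_derive p v (fun q => f q + g q) (a + b).
Proof. by move=> hf hg; apply: is_deriveD. Qed.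

Lemma is_pdrvB (v : R * R) f g p a b : is_derive p v f a -> is_derive p v g b ->
  is_derive p v (fun q => f q - g q) (a - b).
Proof. by move=> hf hg; apply: is_deriveB. Qed.

Lemma is_pdrv_cst (v : R * R) p (c : R) : is_derive p v (fun=> c) 0.
Proof. exact: is_derive_cst. Qed.

Lemma CkW k f : Ck k.+1 f -> Ck k f.
Proof.
elim: k f => [|k IH] f [cf [d1 d2 C1 C2]]; first exact: (conj cf I).
exact: (conj cf (And4 d1 d2 (IH _ C1) (IH _ C2))).
Qed.

Lemma Ck_intro k f fx fy : continuous f -> (forall p, is_derive p e1 f (fx p)) ->
  (forall p, is_derive p e2 f (fy p)) -> Ck k fx -> Ck k fy -> Ck k.+1 f.
Proof.
move=> cf hx hy Cx Cy; split; first exact: cf.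
split.
- by move=> p; case: (hx p).
- by move=> p; case: (hy p).
- by rewrite (_ : dx f = fx); [exact: Cx|apply/funext => p; case: (hx p)].
- by rewrite (_ : dy f = fy); [exact: Cy|apply/funext => p; case: (hy p)].
Qed.

Lemma Ck_cst k (c : R) : Ck k (fun=> c).
Proof.
elim: k c => [|k IH] c; first by split; [move=> p; exact: cvg_cst|exact: I].
apply: (Ck_intro _ (fun p => is_pdrv_cst e1 p c) (fun p => is_pdrv_cst e2 p c) (IH 0) (IH 0)).
by move=> p; exact: cvg_cst.
Qed.

Lemma CkD k f g : Ck k f -> Ck k g -> Ck k (fun p => f p + g p).
Proof.
elim: k f g => [|k IH] f g Cf Cg.
  by split; [move=> p; apply: cvgD; [exact: Cf.1|exact: Cg.1]|exact: I].
have [cf [f1 f2 F1 F2]] := Cf; have [cg [g1 g2 G1 G2]] := Cg.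
apply: (Ck_intro _ (fun p => is_pdrvD (derivableP (f1 p)) (derivableP (g1 p)))
  (fun p => is_pdrvD (derivableP (f2 p)) (derivableP (g2 p))) (IH _ _ F1 G1) (IH _ _ F2 G2)).
by move=> p; apply: cvgD; [exact: cf|exact: cg].
Qed.

Lemma CkM k f g : Ck k f -> Ck k g -> Ck k (fun p => f p * g p).
Proof.
elim: k f g => [|k IH] f g Cf Cg.
  by split; [move=> p; apply: cvgM; [exact: Cf.1|exact: Cg.1]|exact: I].
have [cf [f1 f2 F1 F2]] := Cf; have [cg [g1 g2 G1 G2]] := Cg.
apply: (Ck_intro _ (fun p => is_pdrvM (derivableP (f1 p)) (derivableP (g1 p)))
  (fun p => is_pdrvM (derivableP (f2 p)) (derivableP (g2 p)))
  (CkD (IH _ _ F1 (CkW Cg)) (IH _ _ (CkW Cf) G1))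
  (CkD (IH _ _ F2 (CkW Cg)) (IH _ _ (CkW Cf) G2))).
by move=> p; apply: cvgM; [exact: cf|exact: cg].
Qed.

Lemma is_dx_fst p : is_derive p e1 (fun q => q.1) 1.
Proof. by apply: is_derive_dx; exact: is_drv_id. Qed.
Lemma is_dy_fst p : is_derive p e2 (fun q => q.1) 0.
Proof. by apply: is_derive_dy; exact: is_drv_cst. Qed.
Lemma is_dx_snd p : is_derive p e1 (fun q => q.2) 0.
Proof. by apply: is_derive_dx; exact: is_drv_cst. Qed.
Lemma is_dy_snd p : is_derive p e2 (fun q => q.2) 1.
Proof. by apply: is_derive_dy; exact: is_drv_id. Qed.

Lemma Ck_fst k : Ck k (fun p => p.1).
Proof.
case: k => [|k]; first by split; [move=> p; exact: cvg_fst|exact: I].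
apply: (Ck_intro _ is_dx_fst is_dy_fst (Ck_cst k 1) (Ck_cst k 0)).
by move=> p; exact: cvg_fst.
Qed.

Lemma Ck_snd k : Ck k (fun p => p.2).
Proof.
case: k => [|k]; first by split; [move=> p; exact: cvg_snd|exact: I].
apply: (Ck_intro _ is_dx_snd is_dy_snd (Ck_cst k 0) (Ck_cst k 1)).
by move=> p; exact: cvg_snd.
Qed.

Lemma normsq_ge0 p : 0 <= normsq p.
Proof. by rewrite /normsq addr_ge0// sqr_ge0. Qed.

Lemma continuous_normsq : continuous (@normsq R).
Proof.
have h : Ck 0 (fun p : R * R => p.1 * p.1 + p.2 * p.2).
  by apply: CkD; apply: CkM; [exact: Ck_fst|exact: Ck_fst|exact: Ck_snd|exact: Ck_snd].
by rewrite (_ : normsq (R := R) = fun p => p.1 * p.1 + p.2 * p.2); [case: h|apply/funext => p; rewrite /normsq !expr2].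
Qed.

Lemma radial_continuous h : hcont h -> continuous (fun p => h (normsq p)).
Proof.
move=> ch p; apply/cvgrPdist_lt => e e0.
have [d d0 hd] := ch (normsq p) (normsq_ge0 p) e e0.
have /cvgrPdist_lt/(_ d d0) hn := @continuous_normsq p.
near=> q; apply: hd; first exact: normsq_ge0.
by near: q.
Unshelve. all: by end_near. Qed.

(** The chain rule applies except when [x ^+ 2 + b = 0], where [h] is only known on one side. There
    [h (z ^+ 2) - h 0] is [z ^+ 2] times the continuous mean of [h'], and Caratheodory's criterion
    gives the derivative 0. *)
Lemma radial_drv_aux h h' (x b : R) : hcont h -> hcont h' ->
  (forall t, 0 < t -> is_derive t 1 h (h' t)) -> 0 <= b ->
  is_derive x 1 (fun z => h (z ^+ 2 + b)) (2 * x * h' (x ^+ 2 + b)).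
Proof.
move=> ch ch' dh b0.
have s0 : 0 <= x ^+ 2 + b by rewrite addr_ge0// sqr_ge0.
case: (ltP 0 (x ^+ 2 + b)) => [spos|sle].
  have dq : is_derive x 1 (fun z : R => z ^+ 2 + b) (2 * x).
    have := is_drvD (is_drv_pow 1 x) (is_drv_cst b x).
    by move=> h0; apply: (is_drv_eq h0); rewrite addr0 expr1.
  by apply: (is_drv_eq (is_drv_comp dq (dh _ spos))); rewrite mulrC.
have sz : x ^+ 2 + b = 0 by apply/eqP; rewrite eq_le sle s0.
have bz : b = 0 by apply/eqP; rewrite eq_le b0 andbT; have := sqr_ge0 x; lra.
have xz : x = 0 by apply/eqP; rewrite -sqrf_eq0; move: sz; rewrite bz addr0 => ->.
rewrite xz bz mulr0 mul0r.
pose A := avg 0 (fun t => h t - h 0) h'.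
have cA : hcont A.
  apply: avg_hcont => //; first by rewrite subrr.
    by apply: hcontD => //; exact: Cr_hcont (Cr_cst 0 _).
  move=> t t0; rewrite expr0 mul1r; apply: (is_drv_eq (is_drvB (dh t t0) (is_drv_cst _ t))).
  by rewrite subr0.
apply/is_derive1_caratheodory; exists (fun z => z * A (z ^+ 2)); split.
- move=> z; rewrite expr0n /= !addr0 subr0 /A /avg.
  have [->|z0] := eqVneq z 0; first by rewrite expr0n /= subrr mulr0.
  rewrite ifT; last by rewrite lt_neqAle sqr_ge0 andbT eq_sym sqrf_eq0.
  by rewrite expr1; field.
- have c2 : continuous (fun z : R => A (z ^+ 2)).
    move=> z; apply/cvgrPdist_lt => e e0.
    have [d d0 hd] := cA (z ^+ 2) (sqr_ge0 z) e e0.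
    have /cvgrPdist_lt/(_ d d0) hn : y ^+ 2 @[y --> z] --> z ^+ 2 by exact: exprn_continuous.
    by near=> y; apply: hd; [exact: sqr_ge0|near: y].
  by apply: cvgM; [exact: cvg_id|exact: c2].
- by rewrite mul0r.
Unshelve. all: by end_near. Qed.

Lemma radial_dx h h' p : hcont h -> hcont h' ->
  (forall t, 0 < t -> is_derive t 1 h (h' t)) ->
  is_derive p e1 (fun q => h (normsq q)) (2 * p.1 * h' (normsq p)).
Proof.
by move=> ch ch' dh; apply: is_derive_dx; exact: (radial_drv_aux p.1 ch ch' dh (sqr_ge0 p.2)).
Qed.

Lemma radial_dy h h' p : hcont h -> hcont h' ->
  (forall t, 0 < t -> is_derive t 1 h (h' t)) ->
  is_derive p e2 (fun q => h (normsq q)) (2 * p.2 * h' (normsq p)).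
Proof.
move=> ch ch' dh; apply: is_derive_dy.
have := radial_drv_aux p.2 ch ch' dh (sqr_ge0 p.1).
rewrite /normsq /= [p.1 ^+ 2 + _]addrC.
by rewrite (_ : (fun z => _) = fun y => h (p.1 ^+ 2 + y ^+ 2))//; apply/funext => y; rewrite addrC.
Qed.

Lemma sm_hcont h : sm h -> hcont h.
Proof. by move=> s; exact: Cr_hcont (s 0%N). Qed.

Lemma radial_smooth h : sm h -> smooth (fun p => h (normsq p)).
Proof.
move=> sh k; elim: k h sh => [|k IH] h sh.
  by split; [exact: radial_continuous (sm_hcont sh)|exact: I].
have [h' dh sh'] := sm_derivative sh.
apply: (Ck_intro _ (fun p => radial_dx p (sm_hcont sh) (sm_hcont sh') dh)
  (fun p => radial_dy p (sm_hcont sh) (sm_hcont sh') dh)).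
- exact: radial_continuous (sm_hcont sh).
- by apply: CkM; [apply: CkM; [exact: Ck_cst|exact: Ck_fst]|exact: IH].
- by apply: CkM; [apply: CkM; [exact: Ck_cst|exact: Ck_snd]|exact: IH].
Qed.

End PlaneCalculus.

(** * Wirtinger derivatives *)

Section Wirtinger.
Variable R : realType.
Local Open Scope complex_scope.
Implicit Types (p : R * R) (g : R * R -> R[i]) (a b : R[i]) (h : R -> R) (t : R).
Local Notation e1 := ((1, 0) : R * R).
Local Notation e2 := ((0, 1) : R * R).
Local Notation Re := complex.Re.
Local Notation Im := complex.Im.

(* [g] has partial derivatives at [p], and [dg/dz = a], [dg/dzbar = b]; the
   conditions read [dg/dx = a + b] and [dg/dy = i (a - b)]. *)
Definition Wd g p a b : Prop :=
  [/\ is_derive p e1 (fun q => Re (g q)) (Re a + Re b),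
      is_derive p e1 (fun q => Im (g q)) (Im a + Im b),
      is_derive p e2 (fun q => Re (g q)) (Im b - Im a) &
      is_derive p e2 (fun q => Im (g q)) (Re a - Re b)].

Lemma complexE (x : R[i]) : x = (Re x) +i* (Im x).
Proof. by case: x. Qed.

Lemma ReD (x y : R[i]) : Re (x + y) = Re x + Re y. Proof. by case: x y => ? ? []. Qed.
Lemma ImD (x y : R[i]) : Im (x + y) = Im x + Im y. Proof. by case: x y => ? ? []. Qed.
Lemma ReM (x y : R[i]) : Re (x * y) = Re x * Re y - Im x * Im y. Proof. by case: x y => ? ? []. Qed.
Lemma ImM (x y : R[i]) : Im (x * y) = Re x * Im y + Im x * Re y. Proof. by case: x y => ? ? []. Qed.

Lemma Wd_dz g p a b : Wd g p a b -> dz g p = a.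
Proof.
move=> [[_ h1] [_ h2] [_ h3] [_ h4]].
rewrite /dz /cdx /cdy /dx /dy h1 h2 h3 h4.
case: a h1 h2 h3 h4 => a1 a2; case: b => b1 b2 /= _ _ _ _.
apply/eqP; rewrite -(inj_eq (mulIf (_ : 2 != 0 :> R[i]))) ?pnatr_eq0// divfK ?pnatr_eq0//.
by rewrite eq_complex; simpc; apply/andP; split; apply/eqP => /=; ring.
Qed.

Lemma Wd_dzbar g p a b : Wd g p a b -> dzbar g p = b.
Proof.
move=> [[_ h1] [_ h2] [_ h3] [_ h4]].
rewrite /dzbar /cdx /cdy /dx /dy h1 h2 h3 h4.
case: a h1 h2 h3 h4 => a1 a2; case: b => b1 b2 /= _ _ _ _.
apply/eqP; rewrite -(inj_eq (mulIf (_ : 2 != 0 :> R[i]))) ?pnatr_eq0// divfK ?pnatr_eq0//.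
by rewrite eq_complex; simpc; apply/andP; split; apply/eqP => /=; ring.
Qed.

Lemma Wd_eq g p a b a' b' : Wd g p a b -> a = a' -> b = b' -> Wd g p a' b'.
Proof. by move=> h <- <-. Qed.

Lemma Wd_cst (c : R[i]) p : Wd (fun=> c) p 0 0.
Proof. by split; rewrite /= ?addr0 ?subr0; exact: is_pdrv_cst. Qed.

Lemma WdD g1 g2 p a1 b1 a2 b2 : Wd g1 p a1 b1 -> Wd g2 p a2 b2 ->
  Wd (fun q => g1 q + g2 q) p (a1 + a2) (b1 + b2).
Proof.
move=> [x1 x2 x3 x4] [y1 y2 y3 y4].
split; under eq_fun do rewrite (ReD, ImD).
- by apply: (is_derive_eq (is_pdrvD x1 y1)); rewrite !ReD; ring.
- by apply: (is_derive_eq (is_pdrvD x2 y2)); rewrite !ImD; ring.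
- by apply: (is_derive_eq (is_pdrvD x3 y3)); rewrite !ImD; ring.
- by apply: (is_derive_eq (is_pdrvD x4 y4)); rewrite !ReD; ring.
Qed.

Lemma WdM g1 g2 p a1 b1 a2 b2 : Wd g1 p a1 b1 -> Wd g2 p a2 b2 ->
  Wd (fun q => g1 q * g2 q) p (a1 * g2 p + g1 p * a2) (b1 * g2 p + g1 p * b2).
Proof.
move=> [x1 x2 x3 x4] [y1 y2 y3 y4].
split; under eq_fun do rewrite (ReM, ImM).
- by apply: (is_derive_eq (is_pdrvB (is_pdrvM x1 y1) (is_pdrvM x2 y2))); rewrite !(ReD, ReM); ring.
- by apply: (is_derive_eq (is_pdrvD (is_pdrvM x1 y2) (is_pdrvM x2 y1))); rewrite !(ImD, ImM); ring.
- by apply: (is_derive_eq (is_pdrvB (is_pdrvM x3 y3) (is_pdrvM x4 y4))); rewrite !(ImD, ImM); ring.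
- by apply: (is_derive_eq (is_pdrvD (is_pdrvM x3 y4) (is_pdrvM x4 y3))); rewrite !(ReD, ReM); ring.
Qed.

Lemma WdZ (c : R[i]) g p a b : Wd g p a b -> Wd (fun q => c * g q) p (c * a) (c * b).
Proof. by move=> h; apply: (Wd_eq (WdM (Wd_cst c p) h)); rewrite mul0r add0r. Qed.

Lemma WdN g p a b : Wd g p a b -> Wd (fun q => - g q) p (- a) (- b).
Proof.
move=> h; under eq_fun do rewrite -mulN1r.
by apply: (Wd_eq (WdZ (- 1) h)); rewrite mulN1r.
Qed.

Lemma WdB g1 g2 p a1 b1 a2 b2 : Wd g1 p a1 b1 -> Wd g2 p a2 b2 ->
  Wd (fun q => g1 q - g2 q) p (a1 - a2) (b1 - b2).
Proof. by move=> h1 h2; exact: WdD h1 (WdN h2). Qed.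

Definition zbar p : R[i] := p.1 -i* p.2.

Lemma Wd_z p : Wd (@cplx R) p 1 0.
Proof.
split.
- by apply: (is_derive_eq (is_dx_fst p)); rewrite /=; ring.
- by apply: (is_derive_eq (is_dx_snd p)); rewrite /=; ring.
- by apply: (is_derive_eq (is_dy_fst p)); rewrite /=; ring.
- by apply: (is_derive_eq (is_dy_snd p)); rewrite /=; ring.
Qed.

Lemma Wd_zbar p : Wd zbar p 0 1.
Proof.
have N (v : R * R) (f : R * R -> R) (a : R) : is_derive p v f a -> is_derive p v (fun q => - f q) (- a).
  by move=> h; apply: is_deriveN.
split.
- by apply: (is_derive_eq (is_dx_fst p)); rewrite /=; ring.
- by apply: (is_derive_eq (N _ _ _ (is_dx_snd p))); rewrite /=; ring.
- by apply: (is_derive_eq (is_dy_fst p)); rewrite /=; ring.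
- by apply: (is_derive_eq (N _ _ _ (is_dy_snd p))); rewrite /=; ring.
Qed.

Lemma WdX g p a b n : Wd g p a b ->
  Wd (fun q => g q ^+ n) p (n%:R * g p ^+ n.-1 * a) (n%:R * g p ^+ n.-1 * b).
Proof.
have E (x c : R[i]) m : c * x ^+ m + x * (m%:R * x ^+ m.-1 * c) = m.+1%:R * x ^+ m * c.
  rewrite -[m.+1%:R]natr1; case: m => [|m]; first by rewrite !mul0r mulr0; ring.
  by rewrite [m.+1.-1]/= [x ^+ m.+1]exprS; ring.
move=> h; elim: n => [|n IH].
  by rewrite !mul0r; under eq_fun do rewrite expr0; exact: Wd_cst.
rewrite (_ : (fun q => _) = fun q => g q * g q ^+ n); last by apply/funext => q; rewrite exprS.
by apply: (Wd_eq (WdM h IH)); rewrite E.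
Qed.

Lemma cplx_zbar p : cplx p * zbar p = (normsq p)%:C.
Proof.
case: p => x y; rewrite /cplx /zbar /normsq /=; simpc.
by rewrite [y * x]mulrC addNr -!expr2.
Qed.

Lemma Wd_radial h h' p : hcont h -> hcont h' ->
  (forall t, 0 < t -> is_derive t 1 h (h' t)) ->
  Wd (fun q => (h (normsq q))%:C) p ((h' (normsq p))%:C * zbar p) ((h' (normsq p))%:C * cplx p).
Proof.
move=> ch ch' dh; split.
- apply: (is_derive_eq (radial_dx p ch ch' dh)); rewrite /= ; ring.
- by apply: (is_derive_eq (is_pdrv_cst _ p 0)); rewrite /=; ring.
- apply: (is_derive_eq (radial_dy p ch ch' dh)); rewrite /= ; ring.
- by apply: (is_derive_eq (is_pdrv_cst _ p 0)); rewrite /=; ring.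
Qed.

Lemma iddbar_radial h G p : radial_lap h G ->
  iddbar (fun q => (h (normsq q))%:C) p = (G (normsq p))%:C.
Proof.
move=> [h1 [h2 [[d1 d2 s0 s1 s2] e]]]; rewrite /iddbar.
rewrite (_ : dzbar _ = fun q => (h1 (normsq q))%:C * cplx q); last first.
  by apply/funext => q; exact: (Wd_dzbar (Wd_radial q (sm_hcont s0) (sm_hcont s1) d1)).
rewrite (Wd_dz (WdM (Wd_radial p (sm_hcont s1) (sm_hcont s2) d2) (Wd_z p))).
rewrite -e ?normsq_ge0// rmorphD rmorphM /= -cplx_zbar; ring.
Qed.

Lemma csmooth_cst (c : R[i]) : csmooth (fun=> c).
Proof. by split => k; exact: Ck_cst. Qed.

Lemma csmoothD g1 g2 : csmooth g1 -> csmooth g2 -> csmooth (fun q => g1 q + g2 q).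
Proof.
by move=> [a1 a2] [b1 b2]; split => k; under eq_fun do rewrite (ReD, ImD); exact: CkD.
Qed.

Lemma csmoothM g1 g2 : csmooth g1 -> csmooth g2 -> csmooth (fun q => g1 q * g2 q).
Proof.
move=> [a1 a2] [b1 b2]; split => k; under eq_fun do rewrite (ReM, ImM).
  apply: CkD; first exact: CkM.
  by under eq_fun do rewrite -mulN1r; apply: CkM; [exact: Ck_cst|exact: CkM].
by apply: CkD; exact: CkM.
Qed.

Lemma csmoothB g1 g2 : csmooth g1 -> csmooth g2 -> csmooth (fun q => g1 q - g2 q).
Proof.
move=> h1 h2; apply: csmoothD => //; under eq_fun do rewrite -mulN1r.
by apply: csmoothM => //; exact: csmooth_cst.
Qed.

Lemma csmooth_z : csmooth (@cplx R).
Proof. by split => k; [exact: Ck_fst|exact: Ck_snd]. Qed.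

Lemma csmooth_zbar : csmooth zbar.
Proof.
split => k; first exact: Ck_fst.
by under eq_fun do rewrite /= -mulN1r; apply: CkM; [exact: Ck_cst|exact: Ck_snd].
Qed.

Lemma csmoothX g n : csmooth g -> csmooth (fun q => g q ^+ n).
Proof.
move=> cg; elim: n => [|n IH]; first by under eq_fun do rewrite expr0; exact: csmooth_cst.
by under eq_fun do rewrite exprS; exact: csmoothM.
Qed.

Lemma csmooth_radial h : sm h -> csmooth (fun q => (h (normsq q))%:C).
Proof. by move=> sh; split; [exact: radial_smooth|move=> k; exact: Ck_cst]. Qed.

End Wirtinger.

(** * Two-by-two matrices and the vortex equation *)

Section TwoByTwo.
Variable R : realType.
Local Open Scope complex_scope.
Local Open Scope sesquilinear_scope.
Implicit Types (p q : R * R).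

Definition mat2 (T : Type) (a b c d : T) : 'M[T]_2 :=
  \matrix_(i, j) if i == 0 then (if j == 0 then a else b) else (if j == 0 then c else d).

Lemma ord2P (i : 'I_2) : i = 0 \/ i = 1.
Proof. by case: i => [[|[|//]] h]; [left|right]; apply/val_inj. Qed.

Lemma mat2P (T : Type) (A B : 'M[T]_2) : A 0 0 = B 0 0 -> A 0 1 = B 0 1 ->
  A 1 0 = B 1 0 -> A 1 1 = B 1 1 -> A = B.
Proof.
by move=> *; apply/matrixP => i j; case: (ord2P i) => ->; case: (ord2P j) => ->.
Qed.

Lemma sum_ord2 (V : nmodType) (F : 'I_2 -> V) : \sum_i F i = F 0 + F 1.
Proof.
rewrite !big_ord_recl big_ord0 addr0.
by rewrite (_ : lift ord0 ord0 = 1)//; apply/val_inj.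
Qed.

Lemma mulmx2E m n (A : 'M[R[i]]_(m, 2)) (B : 'M[R[i]]_(2, n)) i j :
  (A *m B) i j = A i 0 * B 0 j + A i 1 * B 1 j.
Proof. by rewrite mxE sum_ord2. Qed.

Lemma mat2_unit (a b c d : R[i]) : a * d - b * c != 0 -> mat2 a b c d \in unitmx.
Proof.
move=> h; rewrite unitmxE unitfE.
rewrite (expand_det_row _ 0) sum_ord2 /cofactor !det_mx11 !mxE /= expr0 expr1 mul1r.
by move: h; congr (_ != 0); ring.
Qed.

(** A matrix [t] with [dH/dz = H t] is [H^-1 dH/dz] since [H] is invertible, so the inverse is never
    computed; the vortex equation then prescribes [dt/dzbar] entry by entry. *)
Lemma vortex_from_entries (tau : R) (w : R * R -> R)
    (h11 h12 h21 h22 t11 t12 t21 t22 s1 s2 s1c s2c : R * R -> R[i]) :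
  (forall q, (s1 q)^* = s1c q) -> (forall q, (s2 q)^* = s2c q) ->
  (forall q, h11 q * h22 q - h12 q * h21 q != 0) ->
  (forall q, dz h11 q = h11 q * t11 q + h12 q * t21 q) ->
  (forall q, dz h12 q = h11 q * t12 q + h12 q * t22 q) ->
  (forall q, dz h21 q = h21 q * t11 q + h22 q * t21 q) ->
  (forall q, dz h22 q = h21 q * t12 q + h22 q * t22 q) ->
  (forall q, dzbar t11 q =
     (w q / 2)%:C * (s1 q * (s1c q * h11 q + s2c q * h21 q)) - (tau / 2 * w q)%:C) ->
  (forall q, dzbar t12 q = (w q / 2)%:C * (s1 q * (s1c q * h12 q + s2c q * h22 q))) ->
  (forall q, dzbar t21 q = (w q / 2)%:C * (s2 q * (s1c q * h11 q + s2c q * h21 q))) ->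
  (forall q, dzbar t22 q =
     (w q / 2)%:C * (s2 q * (s1c q * h12 q + s2c q * h22 q)) - (tau / 2 * w q)%:C) ->
  vortex_eq tau w (fun q => mat2 (h11 q) (h12 q) (h21 q) (h22 q))
    (fun q => \col_i (if i == 0 then s1 q else s2 q)).
Proof.
move=> c1 c2 hdet d11 d12 d21 d22 b11 b12 b21 b22 p.
have E : (fun q => invmx (mat2 (h11 q) (h12 q) (h21 q) (h22 q)) *m
    mxdz (fun q => mat2 (h11 q) (h12 q) (h21 q) (h22 q)) q) =
    (fun q => mat2 (t11 q) (t12 q) (t21 q) (t22 q)).
  apply/funext => q; have hu := mat2_unit (hdet q).
  rewrite -[RHS]mul1mx -(mulVmx hu) -mulmxA; congr (_ *m _).
  apply: mat2P; rewrite mulmx2E !mxE /= -?d11 -?d12 -?d21 -?d22;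
    by congr (dz _ q); apply/funext => r; rewrite mxE.
rewrite /iF E /phi_phi_star.
have D i j t : (fun q => mat2 (t11 q) (t12 q) (t21 q) (t22 q) i j) = t ->
  mxdzbar (fun q => mat2 (t11 q) (t12 q) (t21 q) (t22 q)) p i j = dzbar t p.
  by move=> <-; rewrite mxE.
have D11 := D 0 0 t11; have D12 := D 0 1 t12; have D21 := D 1 0 t21; have D22 := D 1 1 t22.
have f (t t' : R * R -> R[i]) : t =1 t' -> t = t' by move=> ?; apply/funext.
rewrite b11 in D11; rewrite b12 in D12; rewrite b21 in D21; rewrite b22 in D22.
set X := mxdzbar _ _ in D11 D12 D21 D22 *.
have PP (phi : 'cV[R[i]]_2) (H : 'M[R[i]]_2) i j (x y : R[i]) :
    (phi 0 0)^* = x -> (phi 1 0)^* = y ->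
    (phi *m phi ^t* *m H) i j = phi i 0 * (x * H 0 j + y * H 1 j).
  by move=> <- <-; rewrite -mulmxA mxE big_ord1 mulmx2E !mxE.
have DD (Y Z : 'M[R[i]]_2) (c : R[i]) i j : (- Y + c *: Z) i j = - Y i j + c * Z i j.
  by rewrite !mxE.
set phi := \col_i _.
have C1 : (phi 0 0)^* = s1c p by rewrite mxE; exact: c1.
have C2 : (phi 1 0)^* = s2c p by rewrite mxE; exact: c2.
apply: mat2P; rewrite DD (PP _ _ _ _ _ _ C1 C2).
- rewrite D11; last by apply: f => q; rewrite mxE.
  by rewrite !mxE /=; ring.
- rewrite D12; last by apply: f => q; rewrite mxE.
  by rewrite !mxE /=; ring.
- rewrite D21; last by apply: f => q; rewrite mxE.
  by rewrite !mxE /=; ring.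
- rewrite D22; last by apply: f => q; rewrite mxE.
  by rewrite !mxE /=; ring.
Qed.

End TwoByTwo.

(** * The metric *)

Section Geometry.
Variables (R : realType) (l k : nat) (tau c c0 : R) (u v nu : R -> R).
Local Open Scope complex_scope.
Local Open Scope sesquilinear_scope.
Hypothesis k_gt0 : (0 < k)%N.
Hypothesis tau_gt0 : 0 < tau.
Let N := (l + l + k)%N.
Implicit Types (p q : R * R) (t : R).

Definition omega_profile t : R :=
  expR (c0 + (u t + v t) / N%:R - t ^+ l * expR (u t) / (N%:R * tau)).
Local Notation om := omega_profile.
Let qp t : R := c ^+ 2 * t ^+ k.-1 * expR (v t - u t).

Hypothesis Lu : radial_lap u (fun t => qp t + (t ^+ l * expR (u t) - tau) / 2 * om t).
Hypothesis Lv : radial_lap v (fun t => - qp t - tau / 2 * om t).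
Hypothesis snu : sm nu.
Hypothesis dnn : forall t, 0 < t ->
  is_derive t 1 (fun s => s ^+ k * nu s) (c * t ^+ k.-1 * expR (v t - u t)).

Let rd (h : R -> R) q : R[i] := (h (normsq q))%:C.
Let P := rd (fun t => expR (u t)).
Let Q := rd (fun t => expR (v t)).
Let NU := rd nu.
Local Notation z := (@cplx R).
Local Notation zb := (@zbar R).
Let mu q := zb q ^+ k * NU q.
Let mub q := z q ^+ k * NU q.
Let one q := 1 - z q ^+ k * mu q.

(* With [s = (1, z^k)], [H (a, b) = P |one a + mu b|^2 + Q |b - z^k a|^2]: here
   [mu] is the coefficient of the projection of [(0, 1)] onto [s], and [one] that
   of the projection of [(1, 0)]. *)
Definition h11 q : R[i] := P q * (one q * one q) + z q ^+ k * zb q ^+ k * Q q.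
Definition h12 q : R[i] := P q * mu q * one q - zb q ^+ k * Q q.
Definition h21 q : R[i] := P q * mub q * one q - z q ^+ k * Q q.
Definition h22 q : R[i] := Q q + P q * (mub q * mu q).

Let su : sm u. Proof. by have [h1 [h2 [[]]]] := Lu. Qed.
Let sv : sm v. Proof. by have [h1 [h2 [[]]]] := Lv. Qed.

Lemma sm_omega_exponent : sm (fun t => c0 + (u t + v t) / N%:R - t ^+ l * expR (u t) / (N%:R * tau)).
Proof.
apply: smB; first apply: smD; first exact: sm_cst.
  by apply: smM; [exact: smD|exact: sm_cst].
by apply: smM; [apply: smM; [exact: smX|exact: sm_exp]|exact: sm_cst].
Qed.

Lemma sm_omega : sm om.
Proof. exact: sm_exp sm_omega_exponent. Qed.

(** The equation for [t ^+ k * nu] is divided by [t ^+ k.-1], then differentiated once; both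
    relations extend to [t = 0] by continuity. The first one is the radial form of
    [dmu/dzbar = c zbar^(k-1) expR (v - u)]. *)
Lemma nu_relations : exists nu1 nu2 u1 v1 : R -> R,
  [/\ sm nu1 /\ sm nu2, forall t, 0 < t -> is_derive t 1 nu (nu1 t),
      forall t, 0 < t -> is_derive t 1 nu1 (nu2 t),
      [/\ exists u2 : R -> R, [/\ forall t, 0 < t -> is_derive t 1 u1 (u2 t), sm u2 &
        forall t, 0 <= t -> u1 t + t * u2 t = qp t + (t ^+ l * expR (u t) - tau) / 2 * om t],
      sm u1 & forall t, 0 < t -> is_derive t 1 u (u1 t)] &
      [/\ exists v2 : R -> R, [/\ forall t, 0 < t -> is_derive t 1 v1 (v2 t), sm v2 &
        forall t, 0 <= t -> v1 t + t * v2 t = - qp t - tau / 2 * om t],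
      sm v1 & forall t, 0 < t -> is_derive t 1 v (v1 t)]] /\
  (forall t, 0 <= t -> k%:R * nu t + t * nu1 t = c * expR (v t - u t)) /\
  (forall t, 0 <= t -> k.+1%:R * nu1 t + t * nu2 t = c * expR (v t - u t) * (v1 t - u1 t)).
Proof.
have [u1 [u2 [[du1 du2 _ su1 su2] eu]]] := Lu.
have [v1 [v2 [[dv1 dv2 _ sv1 sv2] ev]]] := Lv.
have [nu1 dnu1 snu1] := sm_derivative snu; have [nu2 dnu2 snu2] := sm_derivative snu1.
have smid : sm (fun t : R => t) by move=> j; exact: Cr_id.
have svu : sm (fun t => expR (v t - u t)) by apply: sm_exp; exact: smB.
have rel1 t : 0 < t -> k%:R * nu t + t * nu1 t = c * expR (v t - u t).
  move=> t0; have := is_drvM (is_drv_pow k.-1 t) (dnu1 t t0); rewrite prednK// => h.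
  have := is_drv_unique h (dnn t0).
  have -> : t ^+ k = t * t ^+ k.-1 by rewrite -exprS prednK.
  move=> e.
  have tk : t ^+ k.-1 != 0 by rewrite expf_neq0// gt_eqF.
  apply: (mulIf tk); rewrite [RHS](_ : _ = c * t ^+ k.-1 * expR (v t - u t)); last by ring.
  by rewrite -e; ring.
exists nu1, nu2, u1, v1; split; first split => //.
- by split => //; exists u2.
- by split => //; exists v2.
split.
  apply: hcont_eq0 rel1; apply: sm_hcont.
    by apply: smD; [exact: smZ|exact: smM].
  by apply: smZ.
apply: hcont_eq0; [apply: sm_hcont|apply: sm_hcont|].
- by apply: smD; [exact: smZ|exact: smM].
- by apply: smM; [exact: smZ|exact: smB].
- move=> t t0; apply: (@is_drv_unique _ (fun t => c * expR (v t - u t)) t).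
    have h := is_drvD (is_drvZ k%:R (dnu1 t t0)) (is_drvM (is_drv_id t) (dnu2 t t0)).
    apply: (is_drv_near t0 _ (is_drv_eq h _)); first by move=> s s0; exact: rel1.
    by rewrite -[k.+1%:R]natr1; ring.
  by apply: (is_drv_eq (is_drvZ c (is_drv_exp (is_drvB (dv1 t t0) (du1 t t0))))); ring.
Qed.

Let zzb q : z q * zb q = (normsq q)%:C. Proof. exact: cplx_zbar. Qed.

Let expC (x : R) : (expR x)%:C != 0 :> R[i].
Proof.
by rewrite eq_complex /= eqxx andbT gt_eqF// expR_gt0.
Qed.

(** The coordinates [one a + mu b] and [b - z^k a], in which the metric is diagonal with entries [P]
    and [Q], depend on [a] and [b] with determinant [one + z^k mu = 1]. *)
Lemma det_h q : h11 q * h22 q - h12 q * h21 q = P q * Q q.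
Proof.
rewrite /h11 /h12 /h21 /h22 /one /mub /mu; ring.
Qed.

Lemma det_h_neq0 q : h11 q * h22 q - h12 q * h21 q != 0.
Proof. by rewrite det_h mulf_neq0// /P /Q /rd; exact: expC. Qed.

(* The [t]'s are the entries of [H^-1 dH/dz]. *)
Lemma entries : exists t11 t12 t21 t22 : R * R -> R[i],
  let s1 q := z q ^+ l in let s2 q := z q ^+ (l + k) in
  let s1c q := zb q ^+ l in let s2c q := zb q ^+ (l + k) in
  let w q := om (normsq q) in
  [/\ [/\ forall q, dz h11 q = h11 q * t11 q + h12 q * t21 q,
      forall q, dz h12 q = h11 q * t12 q + h12 q * t22 q,
      forall q, dz h21 q = h21 q * t11 q + h22 q * t21 q &
      forall q, dz h22 q = h21 q * t12 q + h22 q * t22 q],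
  forall q, dzbar t11 q =
     (w q / 2)%:C * (s1 q * (s1c q * h11 q + s2c q * h21 q)) - (tau / 2 * w q)%:C,
  forall q, dzbar t12 q = (w q / 2)%:C * (s1 q * (s1c q * h12 q + s2c q * h22 q)),
  forall q, dzbar t21 q = (w q / 2)%:C * (s2 q * (s1c q * h11 q + s2c q * h21 q)) &
  forall q, dzbar t22 q =
     (w q / 2)%:C * (s2 q * (s1c q * h12 q + s2c q * h22 q)) - (tau / 2 * w q)%:C].
Proof.
have [nu1 [nu2 [u1 [v1 [[[snu1 snu2] dnu1 dnu2 [[u2 [du2 su2 eu]] su1 du1] [[v2 [dv2 sv2 ev]] sv1 dv1]] [rel1 rel2]]]]]] := nu_relations.
pose U1 := rd u1; pose V1 := rd v1; pose NU1 := rd nu1; pose RR := rd (fun t => expR (v t - u t)).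
(* In the frame made of [s] and [(0, 1)] the connection matrix has first row [A], [B] and second row
   [h], [D]. Its off-diagonal entry [h] is holomorphic, which is the point of the equation imposed
   on [mu]. *)
pose h q : R[i] := c%:C * z q ^+ k.-1.
pose m1 q := zb q ^+ k * (NU1 q * zb q).
pose A q := U1 q * zb q - mu q * h q.
pose B q := A q * mu q + m1 q - mu q * (V1 q * zb q).
pose D q := h q * mu q + V1 q * zb q.
have hc (f : R -> R) (sf : sm f) := sm_hcont sf.
have ek (x : R[i]) : x ^+ k = x * x ^+ k.-1 by rewrite -exprS prednK.
have WP q : Wd P q (U1 q * P q * zb q) (U1 q * P q * z q).
  have := Wd_radial q (hc _ (sm_exp su)) (hc _ (smM su1 (sm_exp su))) (fun t ht => is_drv_exp (du1 t ht)).
  by rewrite rmorphM.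
have WQ q : Wd Q q (V1 q * Q q * zb q) (V1 q * Q q * z q).
  have := Wd_radial q (hc _ (sm_exp sv)) (hc _ (smM sv1 (sm_exp sv))) (fun t ht => is_drv_exp (dv1 t ht)).
  by rewrite rmorphM.
have WN q : Wd NU q (NU1 q * zb q) (NU1 q * z q) := Wd_radial q (hc _ snu) (hc _ snu1) dnu1.
have WN1 q : Wd NU1 q (rd nu2 q * zb q) (rd nu2 q * z q) := Wd_radial q (hc _ snu1) (hc _ snu2) dnu2.
have WU1 q : Wd U1 q (rd u2 q * zb q) (rd u2 q * z q) := Wd_radial q (hc _ su1) (hc _ su2) du2.
have WV1 q : Wd V1 q (rd v2 q * zb q) (rd v2 q * z q) := Wd_radial q (hc _ sv1) (hc _ sv2) dv2.
have Wzk q := WdX k (Wd_z q). have Wzbk q := WdX k (Wd_zbar q).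
have Wmu q := WdM (Wzbk q) (WN q).
have Wmub q := WdM (Wzk q) (WN q).
have Wh q := WdZ c%:C (WdX k.-1 (Wd_z q)).
have Wm1 q := WdM (Wzbk q) (WdM (WN1 q) (Wd_zbar q)).
have r1 q : k%:R * NU q + z q * zb q * NU1 q = c%:C * RR q.
  rewrite zzb /NU /NU1 /RR /rd -!rmorphM /= -(rel1 _ (normsq_ge0 q)) rmorphD /= !rmorphM /=.
  by rewrite rmorph_nat.
have r2 q : k.+1%:R * NU1 q + z q * zb q * rd nu2 q = c%:C * RR q * (V1 q - U1 q).
  rewrite zzb /NU1 /RR /V1 /U1 /rd -rmorphB -!rmorphM /= -(rel2 _ (normsq_ge0 q)) rmorphD /= !rmorphM /=.
  by rewrite rmorph_nat.
have QE q : Q q = P q * RR q.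
  by rewrite /Q /P /RR /rd -rmorphM /= -expRD addrC subrK.
have RR0 q : RR q != 0 by exact: expC.
pose OM := rd om; pose X q := z q ^+ l * zb q ^+ l * P q.
have half (x : R) : (x / 2)%:C = x%:C / 2 :> R[i] by rewrite rmorphM /= fmorphV rmorph_nat.
have zzX q j : ((normsq q) ^+ j)%:C = z q ^+ j * zb q ^+ j by rewrite -exprMn zzb rmorphXn.
have euC q : U1 q + z q * zb q * rd u2 q =
    c%:C ^+ 2 * (z q ^+ k.-1 * zb q ^+ k.-1) * RR q + (X q - tau%:C) / 2 * OM q.
  rewrite zzb /U1 /RR /X /OM /rd -rmorphM -rmorphD /= eu ?normsq_ge0// -!zzX /qp.
  rewrite !(rmorphD, rmorphM, rmorphB) /= fmorphV rmorph_nat rmorphXn /=.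
  by rewrite /P /rd rmorphN expr2.
have evC q : V1 q + z q * zb q * rd v2 q =
    - (c%:C ^+ 2 * (z q ^+ k.-1 * zb q ^+ k.-1) * RR q) - tau%:C / 2 * OM q.
  rewrite zzb /V1 /RR /OM /rd -rmorphM -rmorphD /= ev ?normsq_ge0// -!zzX /qp.
  rewrite !(rmorphD, rmorphM, rmorphN) /= fmorphV rmorph_nat rmorphXn /=.
  by rewrite expr2.
have Wmu' q : Wd mu q (m1 q) (zb q ^+ k.-1 * (c%:C * RR q)).
  apply: (Wd_eq (Wmu q)); first by rewrite /m1; ring.
  rewrite -r1 !ek. ring.
have Wm1' q : Wd m1 q (zb q ^+ k * (rd nu2 q * zb q * zb q)) (zb q ^+ k * (c%:C * RR q * (V1 q - U1 q))).
  apply: (Wd_eq (Wm1 q)); first by ring.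
  by rewrite -r2 -natr1 !ek; ring.
have WVb q := WdM (WV1 q) (Wd_zbar q).
have WVb' q : Wd (fun q => V1 q * zb q) q (rd v2 q * zb q * zb q)
    (- (c%:C ^+ 2 * (z q ^+ k.-1 * zb q ^+ k.-1) * RR q) - tau%:C / 2 * OM q).
  by apply: (Wd_eq (WVb q)); [ring|rewrite -evC; ring].
(* The term [dmu/dzbar * h] cancels the [qp] part of the Laplacian of [u]: this is the decoupling.
   The same cancellation occurs below for [D], with [v]. *)
have WA' q : exists a, Wd A q a ((X q - tau%:C) / 2 * OM q).
  eexists; apply: (Wd_eq (WdB (WdM (WU1 q) (Wd_zbar q)) (WdM (Wmu' q) (Wh q)))); first by [].
  rewrite (_ : rd u2 q * z q * zb q + U1 q * 1 = U1 q + z q * zb q * rd u2 q); last by ring.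
  by rewrite euC /h; ring.
have WB' q : exists b, Wd B q b (X q / 2 * OM q * mu q).
  have [a wa] := WA' q; eexists.
  apply: (Wd_eq (WdB (WdD (WdM wa (Wmu' q)) (Wm1' q)) (WdM (Wmu' q) (WVb' q)))); first by [].
  by rewrite /A /h !ek; field.
have WD' q : exists d, Wd D q d (- (tau%:C / 2 * OM q)).
  eexists; apply: (Wd_eq (WdD (WdM (Wh q) (Wmu' q)) (WVb' q))); first by [].
  by rewrite /h; ring.
(* Back to the standard frame; the change of frame depends on [z], which accounts for the last term
   of [t21]. *)
pose t11 q := A q - z q ^+ k * B q.
pose t21 q := z q ^+ k * A q + h q - z q ^+ k * (z q ^+ k * B q + D q) - k%:R * z q ^+ k.-1.
pose t22 q := z q ^+ k * B q + D q.
(* Eliminating [c] by the first relation turns the four equations for [dH/dz] into rational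
   identities. *)
have cE q : c%:C = (k%:R * NU q + z q * zb q * NU1 q) / RR q by rewrite r1 mulfK.
have omC q : (om (normsq q) / 2)%:C = OM q / 2 by exact: half.
have tomC q : (tau / 2 * om (normsq q))%:C = tau%:C / 2 * OM q by rewrite rmorphM /= half.
have Wone' q := WdB (Wd_cst 1 q) (WdM (Wzk q) (Wmu' q)).
exists t11, B, t21, t22 => /=; split; first split.
- move=> q; rewrite (Wd_dz (WdD (WdM (WP q) (WdM (Wone' q) (Wone' q))) (WdM (WdM (Wzk q) (Wzbk q)) (WQ q)))).
  rewrite /h11 /h12 /t11 /t21 /B /D /A /one /mu /m1 /h QE (cE q) !ek; field; exact: RR0.
- move=> q; rewrite (Wd_dz (WdB (WdM (WdM (WP q) (Wmu' q)) (Wone' q)) (WdM (Wzbk q) (WQ q)))).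
  rewrite /h11 /h12 /t22 /B /D /A /one /mu /m1 /h QE (cE q) !ek; field; exact: RR0.
- move=> q; rewrite (Wd_dz (WdB (WdM (WdM (WP q) (Wmub q)) (Wone' q)) (WdM (Wzk q) (WQ q)))).
  rewrite /h21 /h22 /t11 /t21 /B /D /A /one /mu /mub /m1 /h QE (cE q) !ek; field; exact: RR0.
- move=> q; rewrite (Wd_dz (WdD (WQ q) (WdM (WP q) (WdM (Wmub q) (Wmu' q))))).
  rewrite /h21 /h22 /t22 /B /D /A /one /mu /mub /m1 /h QE (cE q) !ek; field; exact: RR0.
- move=> q; have [a wa] := WA' q; have [b wb] := WB' q.
  rewrite (Wd_dzbar (WdB wa (WdM (Wzk q) wb))). rewrite omC tomC.
  by rewrite /h11 /h21 /one /mu /mub /X !exprD; field.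
- move=> q; have [b wb] := WB' q; rewrite (Wd_dzbar wb) omC.
  by rewrite /h12 /h22 /one /mu /mub /X !exprD; field.
- move=> q; have [a wa] := WA' q; have [b wb] := WB' q; have [d wd] := WD' q.
  rewrite (Wd_dzbar (WdB (WdB (WdD (WdM (Wzk q) wa) (Wh q)) (WdM (Wzk q) (WdD (WdM (Wzk q) wb) wd)))
    (WdZ k%:R (WdX k.-1 (Wd_z q))))) omC.
  by rewrite /h11 /h21 /one /mu /mub /X !exprD; field.
- move=> q; have [b wb] := WB' q; have [d wd] := WD' q.
  rewrite (Wd_dzbar (WdD (WdM (Wzk q) wb) wd)) omC tomC.
  by rewrite /h12 /h22 /one /mu /mub /X !exprD; field.
Qed.

(** Inversion exchanges the two summands, so the same entries, permuted, serve in the coordinate at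
    infinity. *)
Definition metric (ch : chart) q : 'M[R[i]]_2 :=
  if ch is chart0 then mat2 (h11 q) (h12 q) (h21 q) (h22 q)
  else mat2 (h22 q) (h21 q) (h12 q) (h11 q).

Lemma section_locX M j ch p : (j <= M)%N ->
  section_loc M 'X^j ch p = z p ^+ (if ch is chart0 then j else M - j).
Proof.
move=> jM; case: ch; first by rewrite /section_loc hornerXn.
rewrite /section_loc (_ : \poly_(i < _) _ = 'X^(M - j)) ?hornerXn//.
apply/polyP => i; rewrite coef_poly !coefXn ltnS.
case: leqP => iM; last by rewrite gtn_eqF// (leq_ltn_trans (leq_subr _ _) iM).
congr (nat_of_bool _)%:R; apply/eqP/eqP => [<-|->]; first by rewrite subKn.
by rewrite subKn.
Qed.

Lemma section2_locE ch : section2_loc N 'X^l 'X^(l + k) ch = fun q : R * R =>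
  \col_i (if i == 0 then z q ^+ (if ch is chart0 then l else l + k)
                    else z q ^+ (if ch is chart0 then l + k else l)).
Proof.
have lN : (l <= N)%N by rewrite /N -addnA leq_addr.
have lkN : (l + k <= N)%N by rewrite /N -addnA leq_addl.
apply/funext => q; apply/matrixP => i j; rewrite !mxE (section_locX _ _ lN) (section_locX _ _ lkN).
by case: ch; rewrite // /N -addnA addKn addnK.
Qed.

Lemma conj_zX m q : ((z q ^+ m)^*)%C = zb q ^+ m.
Proof. by rewrite rmorphXn. Qed.

Lemma metric_vortex ch : vortex_eq tau (fun q => om (normsq q)) (metric ch)
  (section2_loc N 'X^l 'X^(l + k) ch).
Proof.
have [t11 [t12 [t21 [t22 [[d11 d12 d21 d22] b11 b12 b21 b22]]]]] := entries.
rewrite section2_locE; case: ch.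
  by apply: (vortex_from_entries (conj_zX l) (conj_zX (l + k)) det_h_neq0 d11 d12 d21 d22).
apply: (vortex_from_entries (conj_zX (l + k)) (conj_zX l)
  (t11 := t22) (t12 := t21) (t21 := t12) (t22 := t11)) => q.
- by rewrite [h22 q * _]mulrC [h21 q * _]mulrC; exact: det_h_neq0.
- by rewrite d22 addrC.
- by rewrite d21 addrC.
- by rewrite d12 addrC.
- by rewrite d11 addrC.
- by rewrite b22; congr (_ * (_ * _) - _); rewrite addrC.
- by rewrite b21; congr (_ * (_ * _)); rewrite addrC.
- by rewrite b12; congr (_ * (_ * _)); rewrite addrC.
- by rewrite b11; congr (_ * (_ * _) - _); rewrite addrC.
Qed.

Lemma metric_norm2 ch p : norm2_H (metric ch) (section2_loc N 'X^l 'X^(l + k) ch) p =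
  (normsq p ^+ l * expR (u (normsq p)))%:C.
Proof.
rewrite rmorphM /= -/(P p) rmorphXn /= -cplx_zbar exprMn.
have E (phi : 'cV[R[i]]_2) (H : 'M[R[i]]_2) (x y : R[i]) :
    (phi 0 0)^* = x -> (phi 1 0)^* = y ->
    (phi ^t* *m H *m phi) 0 0 =
      (x * H 0 0 + y * H 1 0) * phi 0 0 + (x * H 0 1 + y * H 1 1) * phi 1 0.
  by move=> <- <-; rewrite !mulmx2E !mxE.
rewrite section2_locE /norm2_H; case: ch.
  rewrite (E _ _ (zb p ^+ l) (zb p ^+ (l + k))); try by [rewrite mxE; exact: conj_zX].
  by rewrite !mxE /= /h11 /h12 /h21 /h22 /one /mu /mub !exprD; ring.
rewrite (E _ _ (zb p ^+ (l + k)) (zb p ^+ l)); try by [rewrite mxE; exact: conj_zX].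
by rewrite !mxE /= /h11 /h12 /h21 /h22 /one /mu /mub !exprD; ring.
Qed.

(** The sum of the equations for [u] and [v], which is the trace of the vortex equation, reads
    [iddbar (u + v) = f om / 2]. As [2 alpha tau = 1 / N], the gravity equation says that
    [- ln om + (u + v) / N - 2 alpha f] is harmonic, and [om] was chosen to make it constant. *)
Lemma metric_gravity alpha ch : 2 * N%:R * alpha * tau = 1 ->
  gravity_eq alpha tau (fun q => om (normsq q)) (metric ch)
    (section2_loc N 'X^l 'X^(l + k) ch).
Proof.
move=> ha f p; pose X (t : R) := t ^+ l * expR (u t).
have sX : sm X by apply: smM; [exact: smX|exact: sm_exp].
have [G LG] := radial_lap_ex sX.
have n0 : (N%:R : R) != 0 by rewrite pnatr_eq0 -lt0n /N addn_gt0 k_gt0 orbT.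
have t0 : tau != 0 by rewrite gt_eqF.
have LE := radial_lapD (radial_lap_cst c0) (radial_lapD (radial_lapZ N%:R^-1 (radial_lapD Lu Lv))
  (radial_lapZ (- (N%:R * tau)^-1) LG)).
have Lf := radial_lapD LG (radial_lap_cst (- (2 * tau))).
have -> : f = fun q => (X (normsq q) + - (2 * tau))%:C.
  by apply/funext => q; rewrite /f metric_norm2 rmorphD rmorphN.
rewrite (iddbar_radial p Lf).
rewrite /Ricci (_ : (fun q => _) = fun q => (c0 + (N%:R^-1 * (u (normsq q) + v (normsq q)) +
    - (N%:R * tau)^-1 * X (normsq q)))%:C); last first.
  by apply/funext => q; rewrite /omega_profile expRK /X; congr (_%:C); ring.
rewrite (iddbar_radial p LE) -/(X _).
set t := normsq p; have -> : alpha = (2 * N%:R * tau)^-1.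
  apply: (mulfI (_ : 2 * N%:R * tau != 0)); first by rewrite !mulf_neq0// pnatr_eq0.
  rewrite mulfV ?mulf_neq0// ?pnatr_eq0//; apply: etrans ha; ring.
rewrite -[2 : R[i]](rmorph_nat (real_complex R) 2).
rewrite -!(rmorphN (real_complex R), rmorphM (real_complex R), rmorphD (real_complex R)) /=.
apply: (congr1 (real_complex R) (y := 0)); rewrite -/(X t); field.
by rewrite n0 t0.
Qed.

Hypothesis inv : forall t, 0 < t -> [/\ u t^-1 = u t + (2 * l)%N%:R * ln t,
  v t^-1 = v t + (2 * (l + k))%N%:R * ln t &
  t^-1 ^+ k * nu t^-1 = 1 - t ^+ k * nu t].

Lemma normsq_gt0 p : p != 0 -> 0 < normsq p.
Proof.
move=> p0; rewrite lt_neqAle normsq_ge0 andbT eq_sym.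
apply: contra p0; case: p => x y; rewrite /normsq /= paddr_eq0 ?sqr_ge0// !expf_eq0 /=.
by move=> /andP[/eqP -> /eqP ->].
Qed.

Lemma z_neq0 p : p != 0 -> z p != 0.
Proof.
move=> /normsq_gt0 h; apply/eqP => e; have := cplx_zbar p; rewrite e mul0r => /esym/eqP.
by rewrite eq_complex /= eqxx andbT gt_eqF.
Qed.

Lemma z_inv p : z (plane_inv p) = (z p)^-1.
Proof. exact: (esym (complexE _)). Qed.

Lemma zb_inv p : zb (plane_inv p) = (zb p)^-1.
Proof.
have e (x : R * R) : zb x = ((z x)^*)%C by [].
by rewrite !e z_inv fmorphV.
Qed.

Lemma normsq_inv p : normsq (plane_inv p) = (normsq p)^-1.
Proof.
apply: (fmorph_inj (real_complex R)); rewrite fmorphV /= -!cplx_zbar z_inv zb_inv.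
by rewrite invfM.
Qed.

Lemma expR_u_inv t : 0 < t -> expR (u t^-1) = expR (u t) * t ^+ (2 * l).
Proof. by move=> t0; have [-> _ _] := inv t0; rewrite expRD expRM_natl lnK. Qed.

Lemma expR_v_inv t : 0 < t -> expR (v t^-1) = expR (v t) * t ^+ (2 * (l + k)).
Proof. by move=> t0; have [_ -> _] := inv t0; rewrite expRD expRM_natl lnK. Qed.

(** Under inversion [u + v] gains [2 N ln t] while [t ^+ l * expR (u t)] is invariant. The exponent
    [1 / N] is exactly what makes [om] transform as the coefficient of a 2-form. *)
Lemma om_inv t : 0 < t -> om t^-1 = t ^+ 2 * om t.
Proof.
move=> t0; rewrite /omega_profile (expR_u_inv t0); have [-> -> _] := inv t0.
have n0 : (N%:R : R) != 0 by rewrite pnatr_eq0 -lt0n /N addn_gt0 k_gt0 orbT.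
have tn : t != 0 by rewrite gt_eqF.
rewrite -[t ^+ 2]lnK ?posrE ?exprn_gt0// -expRD lnXn//; congr expR.
have t2l : t ^+ (2 * l) = t ^+ l * t ^+ l by rewrite mul2n -addnn exprD.
rewrite exprVn t2l.
have -> : t ^- l * (expR (u t) * (t ^+ l * t ^+ l)) = t ^+ l * expR (u t).
  by field; rewrite expf_neq0.
have -> : (u t + (2 * l)%N%:R * ln t + (v t + (2 * (l + k))%N%:R * ln t)) / N%:R =
    (u t + v t) / N%:R + 2 * ln t.
  have -> : (2 * l)%N%:R = 2 * l%:R :> R by rewrite natrM.
  have -> : (2 * (l + k))%N%:R = 2 * l%:R + 2 * k%:R :> R by rewrite natrM natrD; ring.
  have nE : N%:R = 2 * l%:R + k%:R :> R by rewrite /N !natrD; ring.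
  by rewrite nE in n0 *; field.
ring.
Qed.

Lemma om_kahler : kahler_form (fun (_ : chart) p => om (normsq p)).
Proof.
split.
- by move=> _; apply: radial_smooth; exact: sm_omega.
- by move=> _ p; exact: expR_gt0.
- by move=> _ p p0; rewrite normsq_inv om_inv// normsq_gt0.
Qed.

Let conj_real (h : R -> R) q : ((rd h q)^*)%C = rd h q.
Proof. exact: conjc_real. Qed.

Let conj_mu q : ((mu q)^*)%C = mub q.
Proof.
rewrite rmorphM /=; congr (_ * _); last exact: conj_real.
by rewrite -conj_zX; exact: conjcK.
Qed.

Let conj_mub q : ((mub q)^*)%C = mu q.
Proof. by rewrite -conj_mu conjcK. Qed.

Let conj_zk q : ((z q ^+ k)^*)%C = zb q ^+ k.
Proof. exact: conj_zX. Qed.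

Let conj_zbk q : ((zb q ^+ k)^*)%C = z q ^+ k.
Proof. by rewrite -conj_zk conjcK. Qed.

Let conjD (x y : R[i]) : ((x + y)^*)%C = (x^*)%C + (y^*)%C.
Proof. exact: (rmorphD (@conjc R)). Qed.

Let conjN (x : R[i]) : ((- x)^*)%C = - (x^*)%C.
Proof. exact: (rmorphN (@conjc R)). Qed.

Let conjM (x y : R[i]) : ((x * y)^*)%C = (x^*)%C * (y^*)%C.
Proof. exact: (rmorphM (@conjc R)). Qed.

Let one_real q : ((one q)^*)%C = one q.
Proof. by rewrite rmorphB rmorph1 rmorphM /= conj_zk conj_mu /one /mub /mu; ring. Qed.

Let P_real q : ((P q)^*)%C = P q. Proof. exact: conj_real. Qed.
Let Q_real q : ((Q q)^*)%C = Q q. Proof. exact: conj_real. Qed.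

Lemma metric_herm ch q : metric ch q \is hermsymmx.
Proof.
have E (a b c' d : R[i]) : (a^*)%C = a -> (d^*)%C = d -> (b^*)%C = c' -> mat2 a b c' d \is hermsymmx.
  move=> ea ed eb; apply/is_hermitianmxP; rewrite expr0 scale1r.
  by apply: mat2P; rewrite !mxE /=; [exact: esym ea| |exact: esym eb|exact: esym ed];
    rewrite -eb; exact: esym (conjcK _).
have e11 : ((h11 q)^*)%C = h11 q.
  by rewrite /h11 conjD 4!conjM one_real conj_zk conj_zbk P_real Q_real; ring.
have e22 : ((h22 q)^*)%C = h22 q.
  by rewrite /h22 conjD 2!conjM conj_mu conj_mub P_real Q_real; ring.
have e12 : ((h12 q)^*)%C = h21 q.
  rewrite /h12 conjD conjN; congr (_ - _); first by rewrite 2!conjM P_real conj_mu one_real.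
  by rewrite conjM conj_zbk Q_real.
case: ch; first exact: E e11 e22 e12.
by apply: E e22 e11 _; rewrite -e12; exact: conjcK.
Qed.

(** In the coordinates [x] and [y] the form is [P |x|^2 + Q |y|^2]; if [y] vanishes then [b = z^k a]
    and [x = a]. *)
Lemma metric_entries_pos q (a b : R[i]) : (a != 0) || (b != 0) ->
  0 < (a^* * h11 q + b^* * h21 q) * a + (a^* * h12 q + b^* * h22 q) * b.
Proof.
move=> ab; pose x := one q * a + mu q * b; pose y := b - z q ^+ k * a.
have cx : x^* = one q * a^* + mub q * b^*.
  rewrite rmorphD 2!rmorphM /=; congr (_ * _ + _ * _); [exact: one_real|exact: conj_mu].
have cy : y^* = b^* - zb q ^+ k * a^*.
  by rewrite rmorphB rmorphM /=; congr (_ - _ * _); exact: conj_zk.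
rewrite [ltRHS](_ : _ = P q * (x * x^*) + Q q * (y * y^*)); last first.
  transitivity (P q * (x * (one q * a^* + mub q * b^*)) + Q q * (y * (b^* - zb q ^+ k * a^*))).
    by rewrite /x /y /h11 /h12 /h21 /h22; ring.
  by rewrite -cx -cy.
have pos (h : R -> R) : 0 < rd (fun t => expR (h t)) q by rewrite /rd ltcR expR_gt0.
have [y0|y0] := eqVneq y 0; last first.
  apply: ltr_wpDl; first by apply: mulr_ge0; [exact: ltW (pos u)|exact: mul_conjC_ge0].
  by apply: mulr_gt0; [exact: pos v|rewrite mul_conjC_gt0].
have bE : b = z q ^+ k * a by apply/eqP; rewrite -subr_eq0; exact/eqP.
have xE : x = a by rewrite /x bE /one; ring.
have a0 : a != 0.
  by apply: contraTneq ab => a0; rewrite bE a0 mulr0 eqxx.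
rewrite y0 mul0r mulr0 addr0 xE; apply: mulr_gt0; first exact: pos u.
by rewrite mul_conjC_gt0.
Qed.

Lemma csmooth_entries : [/\ csmooth h11, csmooth h12, csmooth h21 & csmooth h22].
Proof.
have cP : csmooth P by apply: csmooth_radial; exact: sm_exp.
have cQ : csmooth Q by apply: csmooth_radial; exact: sm_exp.
have cN : csmooth NU by apply: csmooth_radial.
have czk : csmooth (fun q => z q ^+ k) by apply: csmoothX; exact: csmooth_z.
have czbk : csmooth (fun q => zb q ^+ k) by apply: csmoothX; exact: csmooth_zbar.
have cmu : csmooth mu by exact: csmoothM.
have cmub : csmooth mub by exact: csmoothM.
have cone : csmooth one by apply: csmoothB; [exact: csmooth_cst|exact: csmoothM].
have m3 f g h : csmooth f -> csmooth g -> csmooth h -> csmooth (fun q => f q * g q * h q).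
  by move=> ? ? ?; apply: csmoothM => //; exact: csmoothM.
split.
- by apply: csmoothD; [apply: csmoothM => //; exact: csmoothM|exact: m3].
- by apply: csmoothB; [exact: m3|exact: csmoothM].
- by apply: csmoothB; [exact: m3|exact: csmoothM].
- by apply: csmoothD => //; apply: csmoothM => //; exact: csmoothM.
Qed.

(** The law [nn t^-1 = 1 - nn t] says that inversion exchanges [z ^+ k * mu] and [one], the
    projections of the two summands onto [s]; the rest is the scaling of [P] and [Q]. *)
Lemma entries_inv p : p != 0 ->
  let T := (normsq p ^+ N)%:C in
  [/\ h11 (plane_inv p) = T * h22 p, h12 (plane_inv p) = T * h21 p,
      h21 (plane_inv p) = T * h12 p & h22 (plane_inv p) = T * h11 p].
Proof.
move=> p0; have t0 := normsq_gt0 p0; have z0 := z_neq0 p0.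
have zb0 : zb p != 0.
  by apply/eqP => e; have := cplx_zbar p; rewrite e mulr0 => /esym/eqP; rewrite eq_complex /= eqxx andbT gt_eqF.
have iP : P (plane_inv p) = P p * (z p ^+ l * zb p ^+ l) ^+ 2.
  rewrite /P /rd normsq_inv expR_u_inv// rmorphM /= -exprMn cplx_zbar -exprM mulnC.
  by rewrite rmorphXn.
have iQ : Q (plane_inv p) = Q p * (z p ^+ l * zb p ^+ l * z p ^+ k * zb p ^+ k) ^+ 2.
  rewrite (_ : z p ^+ l * _ * _ * _ = (z p * zb p) ^+ (l + k)); last by rewrite exprMn !exprD; ring.
  rewrite /Q /rd normsq_inv expR_v_inv// rmorphM /= cplx_zbar -exprM mulnC.
  by rewrite rmorphXn.
have iN : NU (plane_inv p) = z p ^+ k * zb p ^+ k * (1 - z p ^+ k * zb p ^+ k * NU p).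
  have [_ _ h] := inv t0.
  rewrite -exprMn cplx_zbar /NU /rd normsq_inv.
  rewrite (_ : nu _ = normsq p ^+ k * (1 - normsq p ^+ k * nu (normsq p))).
    by rewrite rmorphM rmorphB rmorphM rmorphXn /= rmorph1.
  by rewrite -h exprVn mulrA mulfV ?mul1r// expf_neq0// gt_eqF.
have TE : (normsq p ^+ N)%:C = (z p ^+ l * zb p ^+ l) ^+ 2 * (z p ^+ k * zb p ^+ k).
  rewrite rmorphXn /= -cplx_zbar /N !exprD !exprMn; ring.
have zk0 : z p ^+ k != 0 by rewrite expf_neq0.
have zbk0 : zb p ^+ k != 0 by rewrite expf_neq0.
move=> T; rewrite /T TE /h11 /h12 /h21 /h22 /one /mub /mu z_inv zb_inv iP iQ iN !exprVn.
move: (z p ^+ k) (zb p ^+ k) zk0 zbk0 (z p ^+ l) (zb p ^+ l) (P p) (Q p) (NU p).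
move=> a b a0 b0 a' b' pp qq nn.
by split; field; rewrite a0 b0.
Qed.

Lemma metric_hermitian : hermitian_metric N metric.
Proof.
split.
- move=> ch i j; have [c11 c12 c21 c22] := csmooth_entries.
  have e f g : csmooth f -> g = f -> csmooth g by move=> ? ->.
  case: ch; case: (ord2P i) => ->; case: (ord2P j) => ->;
    [apply: e c11 _|apply: e c12 _|apply: e c21 _|apply: e c22 _
    |apply: e c22 _|apply: e c21 _|apply: e c12 _|apply: e c11 _];
    by apply/funext => q; rewrite mxE.
- exact: metric_herm.
- move=> ch q w w0.
  have w01 : (w 0 0 != 0) || (w 1 0 != 0).
    rewrite -negb_and; apply: contra w0 => /andP[/eqP a /eqP b].
    apply/eqP/matrixP => i j; rewrite (ord1 j) mxE.
    by case: (ord2P i) => ->.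
  rewrite !mulmx2E !mxE; case: ch; rewrite !mxE /=.
    exact: metric_entries_pos.
  rewrite orbC in w01.
  apply: (eq_ind _ (fun x : R[i] => 0 < x) (metric_entries_pos q w01)).
  by rewrite [LHS]addrC; congr (_ * _ + _ * _); exact: addrC.
- move=> ch p p0; have [i11 i12 i21 i22] := entries_inv p0.
  by case: ch; apply: mat2P; rewrite !mxE /=;
    [exact: i22|exact: i21|exact: i12|exact: i11|exact: i11|exact: i12|exact: i21|exact: i22].
Qed.

End Geometry.

(** * The volume *)

Section Volume.
Variable R : realType.
Implicit Types (g M : R -> R) (t x y v : R).
Local Notation mu := (@lebesgue_measure R).

Lemma integral_dilation g x : continuous g -> (forall t, 0 <= g t) -> 0 < x ->
  (\int[mu]_y (g y)%:E = \int[mu]_v (g (x * v) * x)%:E)%E.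
Proof.
move=> cg g0 x0; have dF (v : R) : is_derive v 1 (fun v => x * v) x.
  by apply: (is_drv_eq (is_drvZ x (is_drv_id v))); rewrite mulr1.
have F' : (fun v => x * v)^`()%classic = (fun=> x).
  by apply/funext => v; rewrite derive1E; have [_ ->] := dF v.
rewrite (@increasing_ge0_integration_by_substitutionT R (fun v => x * v) g)//.
- by rewrite F'.
- by move=> a b ab; rewrite ltr_pM2l.
- by rewrite F' => ?; exact: cvg_cst.
- by rewrite F'; exact: is_cvg_cst.
- by rewrite F'; exact: is_cvg_cst.
- by apply: gt0_cvgMrNy => //; exact: cvg_id.
- by apply: gt0_cvgMry => //; exact: cvg_id.
Qed.

(** The integrand is even, and on the positive half-line it has the primitive
    [c^-1 * M (x ^+ 2 * c)]. *)
Lemma integral_half_line g M (V c : R) : 0 < c -> continuous g -> (forall t, 0 <= g t) ->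
  hcont M -> M 0 = 0 -> (forall t, 0 < t -> is_derive t 1 M (g t)) ->
  M t @[t --> +oo] --> V ->
  (\int[mu]_x (2 * g (x ^+ 2 * c) * `|x|)%:E = (2 * (V / c))%:E)%E.
Proof.
move=> c0 cg g0 hM M0 dM limM.
have cq (x : R) : {for x, continuous (fun x => x ^+ 2 * c)}.
  by apply: cvgM; [exact: exprn_continuous|exact: cvg_cst].
have cf : continuous (fun x => 2 * g (x ^+ 2 * c) * `|x|).
  move=> x; apply: cvgM; last exact: (@norm_continuous _ R).
  apply: cvgM; first exact: cvg_cst.
  exact: (@continuous_comp R R R (fun x => x ^+ 2 * c) g x (cq x) (cg _)).
have dF (x : R) : 0 < x ->
    is_derive x 1 (fun x => c^-1 * M (x ^+ 2 * c)) (2 * g (x ^+ 2 * c) * `|x|).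
  move=> x0; have h : 0 < x ^+ 2 * c by rewrite mulr_gt0// exprn_gt0.
  have dq := is_drvM (is_drvM (is_drv_id x) (is_drv_id x)) (is_drv_cst c x).
  apply: (is_drv_eq (is_drvZ c^-1 (is_drv_comp dq (dM (x ^+ 2 * c) h)))).
  by rewrite gtr0_norm//; field; rewrite gt_eqF.
rewrite ge0_symfun_integralT//; last 2 first.
- by move=> x; rewrite mulr_ge0// mulr_ge0.
- by move=> x /=; rewrite sqrrN normrN.
rewrite (_ : [set x : R | 0 <= x] = `[0, +oo[%classic); last first.
  by apply/seteqP; split => x /=; rewrite in_itv/= andbT.
rewrite (@ge0_continuous_FTC2y R _ (fun x => c^-1 * M (x ^+ 2 * c)) 0 (c^-1 * V)).
- by rewrite expr0n /= mul0r M0 mulr0 oppr0 adde0 -EFinM; congr (_%:E); ring.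
- by move=> x _; rewrite mulr_ge0// mulr_ge0.
- by apply: continuous_subspaceT; exact: cf.
- apply: cvgM; first exact: cvg_cst.
  apply: (@cvg_comp _ _ _ (fun x : R => x ^+ 2 * c) M _ _ _ _ limM).
  by apply: gt0_cvgMly => //; exact: cvgr_expr2.
- by move=> x x0; case: (dF x x0).
- apply/cvgrPdist_lt => e e0; have ce : 0 < c * e by rewrite mulr_gt0.
  have [d d0 hd] := hM 0 (lexx 0) _ ce.
  have /cvgrPdist_lt/(_ d d0) hq : x ^+ 2 * c @[x --> 0^'+] --> 0 ^+ 2 * c.
    by apply: cvg_at_right_filter; exact: cq.
  near=> x; rewrite expr0n /= mul0r -mulrBr normrM [`|c^-1|]gtr0_norm ?invr_gt0//.
  rewrite ltr_pdivrMl//; apply: hd; first by rewrite mulr_ge0 ?sqr_ge0// ltW.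
  have : `|0 ^+ 2 * c - x ^+ 2 * c| < d by near: x.
  by rewrite expr0n /= mul0r.
- by move=> x; rewrite in_itv /= andbT => x0; rewrite derive1E; have [_ ->] := dF x x0.
Unshelve. all: by end_near. Qed.

(* Polar coordinates are avoided: substituting [y = |x| v] and exchanging the
   integrals gives [int 2 V / (1 + v^2) dv]. *)
Lemma plane_integral_radial g M (V : R) : 0 <= V -> continuous g -> (forall t, 0 <= g t) ->
  hcont M -> M 0 = 0 -> (forall t, 0 < t -> is_derive t 1 M (g t)) ->
  M t @[t --> +oo] --> V ->
  (\int[mu \x mu]_p (2 * g (normsq p))%:E = (2 * pi * V)%:E)%E.
Proof.
move=> V0 cg g0 hM M0 dM limM.
have m_pair (h : R * R -> R) : measurable_fun setT h -> measurable_fun setT (EFin \o h).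
  by move=> mh; apply/measurable_EFinP.
have m_normsq : measurable_fun setT (fun p : R * R => 2 * g (p.1 ^+ 2 + p.2 ^+ 2)).
  apply: measurable_funM; first exact: measurable_cst.
  apply: (measurableT_comp (continuous_measurable_fun cg)).
  by apply: measurable_funD; apply: measurable_funX; [exact: measurable_fst|exact: measurable_snd].
have m_dil : measurable_fun setT (fun p : R * R => 2 * g (p.1 ^+ 2 * (1 + p.2 ^+ 2)) * `|p.1|).
  apply: measurable_funM; last first.
    by apply: (measurableT_comp (@normr_measurable R setT)); exact: measurable_fst.
  apply: measurable_funM; first exact: measurable_cst.
  apply: (measurableT_comp (continuous_measurable_fun cg)).
  apply: measurable_funM; first by apply: measurable_funX; exact: measurable_fst.
  apply: measurable_funD; first exact: measurable_cst.
  by apply: measurable_funX; exact: measurable_snd.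
rewrite fubini_tonelli1; last 2 first.
- exact: m_pair m_normsq.
- by move=> p; rewrite lee_fin mulr_ge0.
(* The point [x = 0], where the dilation [y = |x| v] degenerates, is removed before substituting. *)
have mD : measurable ([set: R] `\ 0) by apply: measurableD.
transitivity (\int[mu]_x \int[mu]_v (2 * g (x ^+ 2 * (1 + v ^+ 2)) * `|x|)%:E)%E.
  have mF : measurable_fun [set: R] (fun x => \int[mu]_y (2 * g (x ^+ 2 + y ^+ 2))%:E)%E.
    apply: (@measurable_fun_fubini_tonelli_F _ _ (measurableTypeR R) (measurableTypeR R) R mu _ (m_pair _ m_normsq)).
    by move=> p; rewrite lee_fin mulr_ge0.
  have mH : measurable_fun [set: R] (fun x => \int[mu]_v (2 * g (x ^+ 2 * (1 + v ^+ 2)) * `|x|)%:E)%E.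
    apply: (@measurable_fun_fubini_tonelli_F _ _ (measurableTypeR R) (measurableTypeR R) R mu _ (m_pair _ m_dil)).
    by move=> p; rewrite lee_fin mulr_ge0// mulr_ge0.
  have mS (f : R -> \bar R) : measurable_fun setT f -> measurable_fun ([set: R] `\ 0) f.
    exact: measurable_funS.
  apply: etrans (esym (integral_setD1 mD (mS _ mF))) _.
  apply: etrans (integral_setD1 mD (mS _ mH)).
  apply: eq_integral => x; rewrite inE /= => -[_ /eqP x0].
  have x0' : 0 < `|x| by rewrite normr_gt0.
  have cgx : continuous (fun y => 2 * g (x ^+ 2 + y ^+ 2)).
    move=> y; apply: cvgM; first exact: cvg_cst.
    apply: (@continuous_comp R R R (fun y => x ^+ 2 + y ^+ 2) g y _ (cg _)).
    by apply: cvgD; [exact: cvg_cst|exact: exprn_continuous].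
  have gx0 t : 0 <= 2 * g (x ^+ 2 + t ^+ 2) by rewrite mulr_ge0.
  apply: etrans (integral_dilation cgx gx0 x0') _.
  apply: eq_integral => v _; rewrite exprMn real_normK ?num_real//.
  by congr (2 * g _ * _)%:E; ring.
rewrite (@fubini_tonelli _ _ _ _ _ mu mu (fun p => (2 * g (p.1 ^+ 2 * (1 + p.2 ^+ 2)) * `|p.1|)%:E)); last 2 first.
- exact: m_pair m_dil.
- by move=> p; rewrite lee_fin mulr_ge0// mulr_ge0.
transitivity (\int[mu]_v (2 * (V / (1 + v ^+ 2)))%:E)%E.
  apply: eq_integral => v _; have v0 : 0 < 1 + v ^+ 2 by rewrite ltr_pwDl// sqr_ge0.
  exact: (integral_half_line v0 cg g0 hM M0 dM limM).
under eq_integral do rewrite (mulrA 2 V).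
transitivity ((2 * V)%:E * \int[mu]_v (oneDsqr v)^-1%:E)%E.
  rewrite -ge0_integralZl//.
  - by apply/measurable_EFinP; apply: continuous_measurable_fun; exact: continuous_oneDsqrV.
  - by rewrite lee_fin mulr_ge0.
rewrite ge0_symfun_integralT; last 3 first.
- by move=> v; rewrite invr_ge0 ltW// oneDsqr_gt0.
- exact: continuous_oneDsqrV.
- by move=> v /=; rewrite /oneDsqr sqrrN.
rewrite (_ : [set x : R | 0 <= x] = `[0, +oo[%classic); last first.
  by apply/seteqP; split => x /=; rewrite in_itv/= andbT.
rewrite integral0y_oneDsqr -!EFinM; by congr (_%:E); field.
Qed.

(** Regularity of the profile is known on the half-line only; the even extension supplies the
    continuity on the line that [plane_integral_radial] asks for. *)
Lemma hcont_norm_continuous g : hcont g -> continuous (fun t => g `|t|).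
Proof.
move=> hg t; apply/cvgrPdist_lt => e e0; have [d d0 hd] := hg _ (normr_ge0 t) e e0.
exists d => // s /= ts; apply: hd; first exact: normr_ge0.
exact: le_lt_trans (ler_dist_dist _ _) ts.
Qed.

End Volume.

Theorem theorem1p1 (R : realType) (N l : nat) (alpha tau V : R)
    (l_gt0 : (0 < l)%N) (l_lt_N : (l < N)%N) (l_le : (l <= N - l)%N)
    (alpha_gt0 : 0 < alpha) (tau_gt0 : 0 < tau)
    (Nalphatau : 2 * N%:R * alpha * tau = 1)
    (V_lo : N%:R < tau * V / 2) (V_hi : tau * V / 2 < 2 * N%:R - 2 * l%:R) :
  exists (omega : chart -> R * R -> R) (H : chart -> R * R -> 'M[R[i]]_2),
    [/\ kahler_form omega,
        form_integral omega = (2 * pi * V)%:E,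
        hermitian_metric N H &
        forall c : chart,
          let phi := section2_loc N 'X^l 'X^(N - l) c in
          vortex_eq tau (omega c) (H c) phi /\
          gravity_eq alpha tau (omega c) (H c) phi].
Proof.
have [k NE] : exists k, N = (l + l + k)%N.
  by exists (N - l - l)%N; rewrite -addnA !subnKC// ltnW.
subst N; have NlE : (l + l + k - l = l + k)%N by rewrite -addnA addKn.
(* The interval prescribed for [tau * V / 2] is nonempty only if [2 * l < N]. *)
have k_gt0 : (0 < k)%N.
  rewrite lt0n; apply/eqP => k0; move: (lt_trans V_lo V_hi).
  by rewrite k0 addn0 natrD; lra.
have rho_hi : tau * V / 2 < 2 * (l + k)%N%:R by move: V_hi; rewrite !natrD; lra.
have [c [c0 [u [v [nu [M]]]]]] := profiles l_gt0 k_gt0 tau_gt0 V_lo rho_hi.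
set om := fun t : R => expR _; move=> /= [Lu Lv [snu dnn] inv [hM M0 dM limM]].
have VE : 2 * (tau * V / 2) / tau = V by field; rewrite gt_eqF.
rewrite VE in limM.
have V0 : 0 <= V.
  rewrite -(@pmulr_rge0 _ tau)//; have := ler0n R (l + l + k); lra.
exists (fun _ p => om (normsq p)), (metric k u v nu); rewrite NlE; split.
- exact: om_kahler k_gt0 Lu Lv inv.
- have som : sm om := sm_omega Lu Lv.
  rewrite /form_integral -(plane_integral_radial (g := fun t => om `|t|) V0 _ _ hM M0 _ limM).
  - by apply: eq_integral => p _; rewrite ger0_norm// normsq_ge0.
  - exact: hcont_norm_continuous (sm_hcont som).
  - by move=> t; exact: expR_ge0.
  - by move=> t t0; rewrite gtr0_norm//; exact: dM.
- exact: metric_hermitian Lu Lv snu inv.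
- move=> ch; split.
    exact: (metric_vortex k_gt0 Lu Lv snu dnn ch).
  exact: (metric_gravity nu k_gt0 tau_gt0 Lu Lv ch Nalphatau).
Qed.
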